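(* Let $a\in\mathcal{CF}_D^*$ and let $\{b_{0,d}\in\mathcal{AT}_D^*: d\in D\}$ be a set of infinitesimal characters. Consider the map $\varphi$ from $D$ to (the completion of) $\mathcal{AT}_D$ with $\varphi(d)=\delta_\sigma(b_{0,d})$, let $F_D(d)=f_d$ for $d\in D$, and let $S_\varphi=F_D\circ A_\varphi\circ\delta_\sigma$. Then $$S_\varphi(a)=S(b_c^{\otimes D}\star a),$$ where $b_c^{\otimes D}=\otimes_{d\in D}b_{c,d}\iota_d$ with $b_{c,d}$ being the character of $\mathcal{CF}_D$ that extends $b_{0,d}$.
   Context: **Decorated aromatic and clumped forests.** Consider graphs $(V,E,S)$ with vertex decoration $\alpha:V\to D$: $V$ finite, $E\subset V\times V$ directed edges (loops allowed; each vertex has at most one successor; if $(v,w)\in E$, $v$ is a predecessor of $w$), $S$ a set of unordered pairs (stolons) of vertices without successor, each vertex in at most one stolon. Roots are vertices without successor and not in a stolon. Components have one root (trees) or none (aromas). Isomorphism classes are decorated aromatic forests; those with one root span $\mathcal{AT}_D$, those without root span $\mathcal A_D$. $\mathcal{CF}_D:=S(\mathcal{AT}_D)$ (symmetric algebra over $\mathbb R$), with basis the clumped forests (monomials of aromatic trees, i.e. each aroma is attached to a specific rooted tree). $\sigma$ is the number of automorphisms and $\delta_\sigma(a)=\sum_\pi\frac{a(\pi)}{\sigma(\pi)}\pi$ (in the completion by number of vertices). $D$ is a set such that the sums over $D$-colourings below are finite (e.g. $D$ finite). **S-series.** For smooth vector fields $(f_d)_{d\in D}$ on $\mathbb R^d$,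 $F_D(\pi)[\phi]=\sum_{(i_v)_{v\in V}}\delta_{I_S}\big(\prod_{v\in V}f^{i_v}_{\alpha(v),I_{\Pi(v)}}\big)\phi_{I_R}$, with $R$ the roots, $\Pi(v)$ the predecessors of $v$, lower multi-indices denoting partial derivatives and $\delta_{I_S}$ identifying indices of vertices linked by a stolon (for clumped forests, the clumping is forgotten). $F_D$ is extended linearly to formal sums, and $S(a)=F_D(\delta_\sigma(a))$. **$A_\varphi$.** Grafting $\tau\curvearrowright\gamma$ is the sum over all ways of attaching the root of $\tau$ to a vertex of $\gamma$; the trace/divergence $d(\tau)$ sums over all ways to attach the root of $\tau$ to one of its own vertices; $\langle\tau,\gamma\rangle$ links the two roots by a stolon. $A_\varphi$ is the unique morphism $\mathcal{CF}_D\to\mathcal{CF}_D$ (completed) sending the single vertex $\bullet_d$ to $\varphi(d)$, which is multiplicative for concatenation of clumped forests and of aromas and commutes with $\curvearrowright$, divergence and stolon product (on aromatic trees, it is the endomorphism of the free tracial stolonic pre-Lie-Rinehart algebra $(\mathcal{AT}_D,\mathcal A_D)$ determined by $\varphi$). **Substitution.** $\mathcal{CF}_D^{\otimes D}=\bigotimes_{d\in D}\mathcal{CF}_D\iota_d$ with formal symbols $\iota_d$, and $b_c^{\otimes D}(\otimes_d\pi_d\iota_d)=\prod_db_{c,d}(\pi_d)$, where $b_{c,d}(\tau_1\cdots\tau_n)=\prod_ib_{0,d}(\tau_i)$. $\Delta_{CEM}:\mathcal{CF}_D\to\mathcal{CF}_D^{\otimes D}\otimes\mathcal{CF}_D$,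 $\Delta_{CEM}(\pi)=\sum(\otimes_dp_d\iota_d)\otimes\pi/_{\otimes_dp_d\iota_d}$, over all partitions of $\pi$ into disjoint coloured clumped subforests: choose a subset of edges and stolons of $\pi$ to keep, assign each resulting aroma to one of the resulting rooted components inside the same clump, and assign to each resulting aromatic tree a colour $d\in D$; $p_d$ collects those of colour $d$; the quotient contracts each aromatic tree of colour $d$ into a vertex decorated by $d$, keeping the non-chosen edges and stolons (the vertex inherits the outgoing edge, stolon or root status of the root of the contracted tree). Finally $b^{\otimes D}\star a=(b^{\otimes D}\otimes a)\circ\Delta_{CEM}$. An infinitesimal character is a functional supported on $\mathcal{AT}_D$. *)

(* Defs.v *)
From HB Require Import structures.
From mathcomp Require Import all_boot all_order all_algebra all_fingroup.
From mathcomp Require Import generic_quotient.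

Set Implicit Arguments.
Unset Strict Implicit.
Unset Printing Implicit Defensive.

Section Graphs.
Variable D : finType.
Implicit Types V W : finType.

(* (E, S, alpha) on the vertex set V; a stolon is a two-element set of vertices. *)
Definition graph V : finType :=
  ({set V * V} * {set {set V}} * {ffun V -> D})%type.

Definition edges V (g : graph V) : {set V * V} := g.1.1.
Definition stolons V (g : graph V) : {set {set V}} := g.1.2.
Definition deco V (g : graph V) : {ffun V -> D} := g.2.

Definition succs V (g : graph V) (v : V) : {set V} := [set w | (v, w) \in edges g].
Definition preds V (g : graph V) (v : V) : {set V} := [set w | (w, v) \in edges g].

Definition roots V (g : graph V) : {set V} :=
  [set v | (succs g v == set0) && (v \notin cover (stolons g))].

Definition aromatic V (g : graph V) : bool :=
  [&& [forall v, #|succs g v| <= 1],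
      [forall s in stolons g, (#|s| == 2) && [forall v in s, succs g v == set0]]
    & trivIset (stolons g)].

(* Every vertex is sent to the root of the rooted component to which its own
   component is attached; a tree vertex is sent to the root of its tree. *)
Definition clumping V (g : graph V) (c : {ffun V -> V}) : bool :=
  [&& [forall v, c v \in roots g],
      [forall r in roots g, c r == r],
      [forall e in edges g, c e.1 == c e.2]
    & [forall s in stolons g, [forall v in s, [forall w in s, c v == c w]]]].

(* Aromatic forests with k roots: k = 0 for the basis of A_D, k = 1 for AT_D. *)
Definition kforest k V : finType := {g : graph V | aromatic g && (#|roots g| == k)}.
Definition cforest V : finType :=
  {x : graph V * {ffun V -> V} | aromatic x.1 && clumping x.1 x.2}.

Definition forget V (g : cforest V) : graph V := (val g).1.
Definition clump V (g : cforest V) : {ffun V -> V} := (val g).2.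

Definition gnil : graph void := (set0, set0, [ffun v : void => match v with end]).
Definition gdot (d : D) : graph unit := (set0, set0, [ffun=> d]).

Definition gunion V W (g : graph V) (h : graph W) : graph (V + W)%type :=
  ([set (inl e.1, inl e.2) | e in edges g] :|: [set (inr e.1, inr e.2) | e in edges h],
   [set inl @: (s : {set V}) | s in stolons g]
     :|: [set inr @: (s : {set W}) | s in stolons h],
   [ffun x => match x with inl v => deco g v | inr w => deco h w end]).

(* In all uses below, A is the singleton of the root of a tree, and so is B. *)
Definition glink V (A : {set V}) (v : V) (g : graph V) : graph V :=
  (edges g :|: [set (r, v) | r in A], stolons g, deco g).
Definition gtie V (A B : {set V}) (g : graph V) : graph V :=
  (edges g, stolons g :|: [set [set r; s] | r in A, s in B], deco g).

(* For f injective: the subgraph induced on the image of f, relabelled by W. *)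
Definition gpull V W (f : W -> V) (g : graph V) : graph W :=
  ([set e | (f e.1, f e.2) \in edges g],
   [set s : {set W} | f @: s \in stolons g],
   [ffun w => deco g (f w)]).

Lemma rootsP V (g : graph V) v :
  reflect ((forall w, (v, w) \notin edges g) /\
           (forall s, s \in stolons g -> v \notin s)) (v \in roots g).
Proof.
rewrite inE; apply: (iffP andP) => [[/eqP s0 nc]|[s0 nc]]; split.
- by move=> w; move/setP: s0 => /(_ w); rewrite !inE => ->.
- move=> s sS; apply: contra nc => vs; apply/bigcupP; by exists s.
- by apply/eqP/setP => w; rewrite !inE; apply/negbTE.
- by apply/bigcupP => -[s sS]; apply/negP/nc.
Qed.

Lemma aromaticP V (g : graph V) :
  reflect [/\ forall v w w', (v, w) \in edges g -> (v, w') \in edges g -> w = w',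
              forall s, s \in stolons g -> #|s| = 2,
              forall s v w, s \in stolons g -> v \in s -> (v, w) \notin edges g
            & forall s s' v, s \in stolons g -> s' \in stolons g ->
                v \in s -> v \in s' -> s = s'] (aromatic g).
Proof.
apply: (iffP and3P) => [[/forallP h1 /forall_inP h2 /trivIsetP h3]|[h1 h2 h3 h4]]; split.
- move=> v w w' e e'; move/card_le1_eqP: (h1 v); apply; by rewrite inE.
- by move=> s /h2 /andP[/eqP].
- move=> s v w /h2 /andP[_ /forall_inP h] /h /eqP/setP /(_ w).
  by rewrite !inE => ->.
- move=> s s' v sS s'S vs vs'; apply/eqP; apply: contraT => /h3 -/(_ sS s'S).
  by move=> /pred0P/(_ v); rewrite /= vs vs'.
- apply/forallP => v; apply/card_le1_eqP => w w'; rewrite !inE => e e'; exact: (h1 v).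
- apply/forall_inP => s sS; rewrite h2 ?eqxx //=; apply/forall_inP => v vs.
  by apply/eqP/setP => w; rewrite !inE; apply/negbTE/(h3 s).
- apply/trivIsetP => s s' sS s'S; apply: contraNT => /pred0Pn[v /= /andP[vs vs']].
  by apply/eqP/(h4 s s' v).
Qed.

Lemma clumpingP V (g : graph V) (c : {ffun V -> V}) :
  reflect [/\ forall v, c v \in roots g,
              forall r, r \in roots g -> c r = r,
              forall v w, (v, w) \in edges g -> c v = c w
            & forall s v w, s \in stolons g -> v \in s -> w \in s -> c v = c w]
          (clumping g c).
Proof.
apply: (iffP and4P) => [[/forallP h1 /forall_inP h2 /forall_inP h3 /forall_inP h4]|[h1 h2 h3 h4]]; split.
- by [].
- by move=> r /h2/eqP.
- by move=> v w /h3/eqP.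
- by move=> s v w /h4/forall_inP h /h/forall_inP h' /h'/eqP.
- exact/forallP.
- by apply/forall_inP => r /h2->.
- by apply/forall_inP => -[v w] /h3 /= ->.
- apply/forall_inP => s sS; apply/forall_inP => v vs; apply/forall_inP => w ws.
  by rewrite (h4 s v w).
Qed.

Lemma cardsU_inl_inr V W (A : {set V}) (B : {set W}) :
  #|(inl @: A :|: inr @: B : {set V + W})| = #|A| + #|B|.
Proof.
rewrite cardsU !card_imset; [|by move=> ? ? []..].
rewrite (_ : _ :&: _ = set0) ?cards0 ?subn0 //.
by apply/setP => x; rewrite !inE; apply/andP => -[/imsetP[? _ ->] /imsetP[? _]].
Qed.

Section Union.
Variables (V W : finType) (g : graph V) (h : graph W).
Lemma gunion_ll v v' : ((inl v, inl v') \in edges (gunion g h)) = ((v, v') \in edges g).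
Proof.
rewrite inE; apply/orP/idP => [[/imsetP[[a b] ab [-> ->]] //|/imsetP[? _ []] //]|e].
by left; apply/imsetP; exists (v, v').
Qed.
Lemma gunion_rr v v' : ((inr v, inr v') \in edges (gunion g h)) = ((v, v') \in edges h).
Proof.
rewrite inE; apply/orP/idP => [[/imsetP[? _ []] //|/imsetP[[a b] ab [-> ->]] //]|e].
by right; apply/imsetP; exists (v, v').
Qed.
Lemma gunion_lr v v' : ((inl v, inr v') \in edges (gunion g h)) = false.
Proof. by rewrite inE; apply/orP => -[/imsetP[? _ []] //|/imsetP[? _ []] //]. Qed.
Lemma gunion_rl v v' : ((inr v, inl v') \in edges (gunion g h)) = false.
Proof. by rewrite inE; apply/orP => -[/imsetP[? _ []] //|/imsetP[? _ []] //]. Qed.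
Definition gunionE := (gunion_ll, gunion_rr, gunion_lr, gunion_rl).

Lemma gunion_stolonP s : reflect ((exists2 t, t \in stolons g & s = inl @: t) \/
   (exists2 t, t \in stolons h & s = inr @: t)) (s \in stolons (gunion g h)).
Proof.
rewrite inE; apply: (iffP orP) => [[/imsetP|/imsetP]|[|]]; [by left|by right|..].
- by move=> H; left; apply/imsetP.
- by move=> H; right; apply/imsetP.
Qed.

Lemma mem_inl (A : {set V}) v : (inl v \in (inl @: A : {set V + W})) = (v \in A).
Proof. by rewrite mem_imset // => ? ? []. Qed.
Lemma mem_inr (A : {set W}) v : (inr v \in (inr @: A : {set V + W})) = (v \in A).
Proof. by rewrite mem_imset // => ? ? []. Qed.
Lemma mem_inlr (A : {set V}) v : (inr v \in (inl @: A : {set V + W})) = false.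
Proof. by apply/imsetP => -[]. Qed.
Lemma mem_inrl (A : {set W}) v : (inl v \in (inr @: A : {set V + W})) = false.
Proof. by apply/imsetP => -[]. Qed.
Definition mem_sumE := (mem_inl, mem_inr, mem_inlr, mem_inrl).

Lemma gunion_aromatic : aromatic g -> aromatic h -> aromatic (gunion g h).
Proof.
move=> /aromaticP[g1 g2 g3 g4] /aromaticP[h1 h2 h3 h4]; apply/aromaticP; split.
- move=> [v|v] [w|w] [w'|w']; rewrite !gunionE // => e e'.
    by rewrite (g1 _ _ _ e e').
  by rewrite (h1 _ _ _ e e').
- move=> s /gunion_stolonP[] [t tS ->]; rewrite card_imset; [exact: g2|by move=> ? ? []|
    exact: h2|by move=> ? ? []].
- move=> s [v|v] [w|w] /gunion_stolonP[] [t tS ->]; rewrite !(gunionE, mem_sumE) //.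
    exact: g3.
  exact: h3.
- move=> s s' [v|v] /gunion_stolonP[] [t tS ->] /gunion_stolonP[] [t' tS' ->];
    rewrite !mem_sumE // => vt vt'.
    by rewrite (g4 t t' v).
  by rewrite (h4 t t' v).
Qed.

Lemma gunion_roots : roots (gunion g h) = inl @: roots g :|: inr @: roots h.
Proof.
apply/setP => -[v|v]; rewrite [RHS]inE !mem_sumE /= ?orbF.
  apply/rootsP/rootsP => -[e s]; split.
  - by move=> w; move: (e (inl w)); rewrite gunionE.
  - move=> t tS; move: (s (inl @: t)); rewrite mem_sumE; apply.
    by apply/gunion_stolonP; left; exists t.
  - by move=> [w|w]; rewrite gunionE.
  - by move=> t /gunion_stolonP[] [t' tS ->]; rewrite mem_sumE //; apply: s.
apply/rootsP/rootsP => -[e s]; split.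
- by move=> w; move: (e (inr w)); rewrite gunionE.
- move=> t tS; move: (s (inr @: t)); rewrite mem_sumE; apply.
  by apply/gunion_stolonP; right; exists t.
- by move=> [w|w]; rewrite gunionE.
- by move=> t /gunion_stolonP[] [t' tS ->]; rewrite mem_sumE //; apply: s.
Qed.
End Union.

Lemma glink_aromatic V (A : {set V}) v (g : graph V) :
  A \subset roots g -> aromatic g -> aromatic (glink A v g).
Proof.
move=> /subsetP sA /aromaticP[g1 g2 g3 g4].
apply/aromaticP; split=> //.
- move=> u w w'; rewrite !inE => /orP[e|/imsetP[r rA [-> ->]]] /orP[e'|/imsetP[r' rA' [er er']]].
  + exact: g1 e e'.
  + by move: rA' => /sA/rootsP[/(_ w)]; rewrite -er e.
  + by move: rA => /sA/rootsP[/(_ w')]; rewrite e'.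
  + by [].
- move=> s u w sS us; rewrite inE negb_or (g3 s) //=.
  by apply/imsetP => -[r /sA/rootsP[_ /(_ s sS)] nr [ur _]]; rewrite -ur us in nr.
Qed.

Lemma glink_roots V (A : {set V}) v (g : graph V) : roots (glink A v g) = roots g :\: A.
Proof.
apply/setP => u; rewrite [RHS]inE; apply/rootsP/andP => [[e s]|[uA /rootsP[e s]]]; split=> //.
- by apply/negP => uA; move: (e v); rewrite inE negb_or imset_f ?andbF //.
- by apply/rootsP; split=> // w; move: (e w); rewrite inE negb_or => /andP[].
- move=> w; rewrite inE negb_or e /=; apply/imsetP => -[r rA [ur _]].
  by rewrite ur rA in uA.
Qed.

Lemma gtie_aromatic V (r s : V) (g : graph V) : r != s ->
  r \in roots g -> s \in roots g -> aromatic g -> aromatic (gtie [set r] [set s] g).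
Proof.
move=> rs /rootsP[r1 r2] /rootsP[s1 s2] /aromaticP[g1 g2 g3 g4].
have E t : t \in stolons (gtie [set r] [set s] g) -> t \in stolons g \/ t = [set r; s].
  rewrite inE => /orP[|/imset2P[a b]]; first by left.
  by rewrite !inE => /eqP-> /eqP-> ->; right.
apply/aromaticP; split=> //.
- by move=> t /E[/g2 //|->]; rewrite cards2 rs.
- by move=> t u w /E[/g3|->]; [exact|rewrite !inE => /orP[] /eqP->].
- move=> t t' u /E[tS|->] /E[tS'|->] //; first exact: g4.
    by move=> ut; rewrite !inE => /orP[] /eqP eu; move: ut; rewrite eu => ut;
      [move: (r2 _ tS)|move: (s2 _ tS)]; rewrite ut.
  by rewrite !inE => /orP[] /eqP -> ut;
      [move: (r2 _ tS')|move: (s2 _ tS')]; rewrite ut.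
Qed.

Lemma gtie_roots V (r s : V) (g : graph V) :
  roots (gtie [set r] [set s] g) = roots g :\: [set r; s].
Proof.
have E : [set r; s] \in stolons (gtie [set r] [set s] g).
  by rewrite inE; apply/orP; right; apply/imset2P; exists r s; rewrite ?in_set1.
apply/setP => u; rewrite [RHS]inE; apply/rootsP/andP => [[e h]|[uA /rootsP[e h]]]; split=> //.
- exact: h.
- by apply/rootsP; split=> // t tS; apply: h; rewrite inE tS.
- move=> t; rewrite inE => /orP[/h //|/imset2P[a b]].
  by rewrite !in_set1 => /eqP-> /eqP-> ->.
Qed.

Lemma gpull_aromatic V W (f : W -> V) (g : graph V) : injective f ->
  aromatic g -> aromatic (gpull f g).
Proof.
move=> fI /aromaticP[g1 g2 g3 g4]; apply/aromaticP; split.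
- by move=> v w w'; rewrite !inE => e e'; apply/fI/(g1 _ _ _ e e').
- by move=> s; rewrite inE => /g2; rewrite card_imset.
- by move=> s v w; rewrite !inE => sS vs; apply: (g3 _ _ _ sS); apply: imset_f.
- move=> s s' v; rewrite !inE => sS sS' vs vs'; apply: (imset_inj fI).
  by apply: (g4 _ _ (f v)); rewrite ?imset_f.
Qed.

Lemma gpull_roots V W (f : W -> V) (g : graph V) : injective f ->
  (forall w u, (f w, u) \in edges g -> u \in codom f) ->
  (forall s w u, s \in stolons g -> f w \in s -> u \in s -> u \in codom f) ->
  roots (gpull f g) = f @^-1: roots g.
Proof.
move=> fI hE hS; apply/setP => w; rewrite [RHS]inE; apply/rootsP/rootsP => -[e s]; split.
- move=> u; apply/negP => eu; have /codomP[x xu] := hE _ _ eu.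
  by move: (e x); rewrite inE /= -xu eu.
- move=> t tS; apply/negP => wt.
  have tE : t = f @: (f @^-1: t).
    apply/setP => u; apply/idP/imsetP => [ut|[x]]; last by rewrite inE => ? ->.
    by have /codomP[x xu] := hS _ _ _ tS wt ut; exists x; rewrite // inE -xu.
  have := s (f @^-1: t); rewrite !inE -tE wt; by move/(_ tS).
- by move=> u; rewrite inE e.
- by move=> t; rewrite inE => /s; apply: contra => wt; apply: imset_f.
Qed.

Section Kforest.
Variable k : nat.

Lemma kforest_aromatic j V (g : kforest j V) : aromatic (val g).
Proof. by case/andP: (valP g). Qed.
Lemma kforest_roots j V (g : kforest j V) : #|roots (val g)| = j.
Proof. by case/andP: (valP g) => _ /eqP. Qed.

Lemma knil_proof : aromatic gnil && (#|roots gnil| == 0).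
Proof.
apply/andP; split; first by apply/aromaticP; split=> [[]||? []|? ? []] // s; rewrite inE.
by rewrite cards_eq0; apply/eqP/setP => -[].
Qed.
Definition knil : kforest 0 void := exist _ gnil knil_proof.

Lemma kdot_proof d : aromatic (gdot d) && (#|roots (gdot d)| == 1).
Proof.
apply/andP; split; first by apply/aromaticP; split=> [? ? ?|s|s ? ?|s ? ?]; rewrite inE.
apply/cards1P; exists tt; apply/setP => -[]; rewrite in_set1 eqxx.
by apply/rootsP; split=> [w|t]; rewrite inE.
Qed.
Definition kdot d : kforest 1 unit := exist _ (gdot d) (kdot_proof d).

Lemma kunion_proof j V W (g : kforest k V) (h : kforest j W) :
  aromatic (gunion (val g) (val h)) && (#|roots (gunion (val g) (val h))| == k + j).
Proof.
by rewrite gunion_aromatic ?kforest_aromatic // gunion_roots cardsU_inl_inr !kforest_roots eqxx.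
Qed.
Definition kunion j V W (g : kforest k V) (h : kforest j W) : kforest (k + j) (V + W)%type :=
  exist _ (gunion (val g) (val h)) (kunion_proof g h).

Lemma kgraft_proof V W (t : kforest 1 V) (g : kforest k W) (w : W)
  (h := glink (inl @: roots (val t)) (inr w) (gunion (val t) (val g))) :
  aromatic h && (#|roots h| == k).
Proof.
rewrite glink_aromatic ?gunion_aromatic ?kforest_aromatic ?gunion_roots ?subsetUl //=.
rewrite glink_roots gunion_roots setDUl setDv set0U.
rewrite (_ : _ :\: _ = inr @: roots (val g)).
  by rewrite card_imset ?kforest_roots // => ? ? [].
by apply/setP => -[v|v]; rewrite inE !mem_sumE ?andbF.
Qed.
(* the summand of t |> g attaching the root of t to the vertex w of g *)
Definition kgraft V W (t : kforest 1 V) (g : kforest k W) (w : W) : kforest k (V + W)%type :=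
  exist _ (glink (inl @: roots (val t)) (inr w) (gunion (val t) (val g))) (kgraft_proof t g w).

Lemma kdiv_proof V (t : kforest 1 V) (v : V) (h := glink (roots (val t)) v (val t)) :
  aromatic h && (#|roots h| == 0).
Proof. by rewrite glink_aromatic ?kforest_aromatic //= glink_roots setDv cards0. Qed.
Definition kdiv V (t : kforest 1 V) (v : V) : kforest 0 V :=
  exist _ (glink (roots (val t)) v (val t)) (kdiv_proof t v).

Lemma kstolon_proof V W (t : kforest 1 V) (u : kforest 1 W)
  (h := gtie (inl @: roots (val t)) (inr @: roots (val u)) (gunion (val t) (val u))) :
  aromatic h && (#|roots h| == 0).
Proof.
rewrite {}/h; have /eqP/cards1P[r rE] := kforest_roots t.
have /eqP/cards1P[s sE] := kforest_roots u.
have rU := gunion_roots (val t) (val u).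
rewrite rE sE !imset_set1 in rU *.
rewrite gtie_aromatic ?gunion_aromatic ?kforest_aromatic ?rU ?inE ?eqxx ?orbT //=.
by rewrite gtie_roots rU setDv cards0.
Qed.
Definition kstolon V W (t : kforest 1 V) (u : kforest 1 W) : kforest 0 (V + W)%type :=
  exist _ (gtie (inl @: roots (val t)) (inr @: roots (val u)) (gunion (val t) (val u)))
    (kstolon_proof t u).

Lemma bij_codom V W (f : W -> V) : bijective f -> forall v, v \in codom f.
Proof. by move=> [f' _ K] v; apply/codomP; exists (f' v). Qed.

Lemma krelabel_proof V W (f : W -> V) (fB : bijective f) (g : kforest k V) :
  aromatic (gpull f (val g)) && (#|roots (gpull f (val g))| == k).
Proof.
rewrite gpull_aromatic ?kforest_aromatic //; last exact: bij_inj.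
rewrite gpull_roots; [|exact: bij_inj|by move=> *; exact: bij_codom..].
by rewrite (on_card_preimset (onW_bij _ fB)) (kforest_roots g) eqxx.
Qed.
Definition krelabel V W (f : W -> V) (fB : bijective f) (g : kforest k V) : kforest k W :=
  exist _ (gpull f (val g)) (krelabel_proof fB g).

End Kforest.

Section Cforest.

Lemma cforest_aromatic V (g : cforest V) : aromatic (forget g).
Proof. by case/andP: (valP g). Qed.
Lemma cforest_clumping V (g : cforest V) : clumping (forget g) (clump g).
Proof. by case/andP: (valP g). Qed.
Lemma clump_root V (g : cforest V) v : clump g v \in roots (forget g).
Proof. by case/clumpingP: (cforest_clumping g). Qed.

Definition mk_cforest V (g : graph V) (c : {ffun V -> V}) (gA : aromatic g)
  (gC : clumping g c) : cforest V :=
  exist (fun x : graph V * {ffun V -> V} => aromatic x.1 && clumping x.1 x.2)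
    (g, c) (introT andP (conj gA gC)).

Lemma cnil_proof : clumping gnil [ffun v => v].
Proof. by apply/clumpingP; split=> [[]|[]|[]|? []]. Qed.
Definition cnil : cforest void := mk_cforest (kforest_aromatic knil) cnil_proof.

(* The embedding AT_D -> CF_D: all aromas are attached to the unique root. *)
Definition root_clumping V (g : graph V) : {ffun V -> V} :=
  [ffun v => odflt v [pick r in roots g]].
Lemma ctree_proof V (t : kforest 1 V) : clumping (val t) (root_clumping (val t)).
Proof.
have /eqP/cards1P[r rE] := kforest_roots t.
have cE v : root_clumping (val t) v = r.
  rewrite ffunE; case: pickP => [x|/(_ r)]; rewrite rE !inE ?eqxx //.
  by move/eqP.
apply/clumpingP; split=> *; rewrite ?cE //; first by rewrite rE inE.
by apply/esym/eqP; rewrite -in_set1 -rE.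
Qed.
Definition ctree V (t : kforest 1 V) : cforest V :=
  mk_cforest (kforest_aromatic t) (ctree_proof t).

Definition sum_clumping V W (c : {ffun V -> V}) (c' : {ffun W -> W}) : {ffun V + W -> V + W} :=
  [ffun x => match x with inl v => inl (c v) | inr w => inr (c' w) end].
Lemma cunion_proof V W (g : cforest V) (h : cforest W) :
  clumping (gunion (forget g) (forget h)) (sum_clumping (clump g) (clump h)).
Proof.
have /clumpingP[g1 g2 g3 g4] := cforest_clumping g.
have /clumpingP[h1 h2 h3 h4] := cforest_clumping h.
apply/clumpingP; split.
- by move=> [v|v]; rewrite ffunE gunion_roots inE !mem_sumE ?g1 ?h1 ?orbT.
- by move=> [v|v]; rewrite ffunE gunion_roots inE !mem_sumE ?orbF /= => H; rewrite ?g2 ?h2.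
- by move=> [v|v] [w|w]; rewrite !gunionE // => e; rewrite !ffunE ?(g3 _ _ e) ?(h3 _ _ e).
- move=> s [v|v] [w|w] /gunion_stolonP[] [t tS ->]; rewrite !mem_sumE // => vt wt;
  by rewrite !ffunE ?(g4 t v w) ?(h4 t v w).
Qed.
Definition cunion V W (g : cforest V) (h : cforest W) : cforest (V + W)%type :=
  mk_cforest (gunion_aromatic (cforest_aromatic g) (cforest_aromatic h)) (cunion_proof g h).

Lemma gpull_clumping V W (f : W -> V) (g : cforest V) (c : {ffun W -> W}) : injective f ->
  (forall w u, clump g u = clump g (f w) -> u \in codom f) ->
  (forall w, f (c w) = clump g (f w)) -> clumping (gpull f (forget g)) c.
Proof.
move=> fI sat fc; have /clumpingP[g1 g2 g3 g4] := cforest_clumping g.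
have rE : roots (gpull f (forget g)) = f @^-1: roots (forget g).
  apply: gpull_roots => // [w u e|s w u sS ws us]; apply: (sat w).
    by rewrite (g3 _ _ e).
  exact: (g4 s).
apply/clumpingP; split.
- by move=> w; rewrite rE inE fc.
- by move=> w; rewrite rE inE => /g2 e; apply: fI; rewrite fc.
- by move=> v w; rewrite inE => /g3 e; apply: fI; rewrite !fc.
- by move=> s v w; rewrite inE => sS vs ws; apply: fI; rewrite !fc; apply: (g4 _ _ _ sS);
    apply: imset_f.
Qed.

Lemma crelabel_proof V W (f : W -> V) (f' : V -> W) (fK : cancel f f') (fK' : cancel f' f)
  (g : cforest V) : clumping (gpull f (forget g)) [ffun w => f' (clump g (f w))].
Proof.
apply: gpull_clumping => [|w u _|w]; first exact: can_inj fK.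
  by apply/codomP; exists (f' u).
by rewrite ffunE fK'.
Qed.
Definition crelabel V W (f : W -> V) (f' : V -> W) (fK : cancel f f') (fK' : cancel f' f)
  (g : cforest V) : cforest W :=
  mk_cforest (gpull_aromatic (can_inj fK) (cforest_aromatic g)) (crelabel_proof fK fK' g).

(* The clump of g with root r, an aromatic tree. *)
Lemma cclump_proof V (g : cforest V) (r : {r : V | r \in roots (forget g)})
  (h := gpull (val : {v | clump g v == val r} -> V) (forget g)) :
  aromatic h && (#|roots h| == 1).
Proof.
have /clumpingP[g1 g2 g3 g4] := cforest_clumping g.
rewrite {}/h; rewrite gpull_aromatic ?cforest_aromatic //=; last exact: val_inj.
have rP : clump g (val r) == val r by rewrite g2 // (valP r).
have sat u : clump g u == val r -> u \in codom (val : {v | clump g v == val r} -> V).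
  by move=> uP; apply/codomP; exists (exist _ u uP).
rewrite gpull_roots; [|exact: val_inj| |].
- apply/cards1P; exists (exist _ (val r) rP); apply/setP => u; rewrite in_set1 inE.
  apply/idP/eqP => [/g2 uE|->]; last exact: (valP r).
  by apply/val_inj; rewrite /= -uE; apply/eqP/(valP u).
- by move=> w u /g3 e; apply: sat; rewrite -e (valP w).
- by move=> s w u sS ws us; apply: sat; rewrite -(g4 s (val w) u) // (valP w).
Qed.
Definition cclump V (g : cforest V) (r : {r : V | r \in roots (forget g)}) :
  kforest 1 {v : V | clump g v == val r} :=
  exist _ (gpull val (forget g)) (cclump_proof r).

(* The vertex of the quotient into which v is contracted. *)
Definition cproj V (h : cforest V) (v : V) : {r : V | r \in roots (forget h)} :=
  exist _ (clump h v) (clump_root h v).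

(* h is a partition of g into clumped subforests: it keeps a subset of the
   edges and stolons, and attaches every resulting aroma to a resulting rooted
   component lying in the same clump of g. *)
Definition subforest V (g h : cforest V) : bool :=
  [&& edges (forget h) \subset edges (forget g),
      stolons (forget h) \subset stolons (forget g),
      deco (forget h) == deco (forget g)
    & [forall v, clump g (clump h v) == clump g v]].

Definition cpart V (g : cforest V) : finType := {h : cforest V | subforest g h}.
Definition coloring V (h : cforest V) : finType :=
  {ffun {r : V | r \in roots (forget h)} -> D}.

(* The trees of colour d.  The default value of insubd is never used. *)
Definition colored V (h : cforest V) (c : coloring h) (d : D) : pred V :=
  fun v => c (cproj h v) == d.
Lemma ccolor_proof V (h : cforest V) (c : coloring h) (d : D) :
  clumping (gpull (val : {v | colored c d v} -> V) (forget h))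
    [ffun v => insubd v (clump h (val v))].
Proof.
have /clumpingP[g1 g2 g3 g4] := cforest_clumping h.
have cE u v : clump h u = clump h v -> colored c d u = colored c d v.
  by rewrite /colored => e; congr (c _ == d); apply: val_inj.
apply: gpull_clumping => [|w u /cE e|w]; first exact: val_inj.
  by rewrite (valP w) in e; apply/codomP; exists (exist _ u e).
rewrite ffunE val_insubd (_ : colored c d _) //.
by rewrite (cE _ (val w)) ?(valP w) // g2.
Qed.
Definition ccolor V (h : cforest V) (c : coloring h) (d : D) :
  cforest {v : V | colored c d v} :=
  mk_cforest (gpull_aromatic val_inj (cforest_aromatic h)) (ccolor_proof c d).

Section Quotient.
Variables (V : finType) (g : cforest V) (p : cpart g) (c : coloring (val p)).
Let h := val p.

Definition gquot : graph {r : V | r \in roots (forget h)} :=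
  ([set (cproj h e.1, cproj h e.2) | e in edges (forget g) :\: edges (forget h)],
   [set cproj h @: (s : {set V}) | s in stolons (forget g) :\: stolons (forget h)],
   c).
Definition quot_clumping : {ffun {r : V | r \in roots (forget h)} -> _} :=
  [ffun r => cproj h (clump g (val r))].

Lemma cproj_id (r : {r : V | r \in roots (forget h)}) : cproj h (val r) = r.
Proof.
have /clumpingP[_ h2 _ _] := cforest_clumping h.
by apply: val_inj; apply/h2/(valP r).
Qed.

Lemma subforest_roots r : r \in roots (forget g) -> r \in roots (forget h).
Proof.
have /and4P[/subsetP sE /subsetP sS _ _] := valP p.
move=> /rootsP[e s]; apply/rootsP; split=> [w|t /sS /s //].
by apply: contra (e w); apply: sE.
Qed.

Lemma newedge_root v w :
  (v, w) \in edges (forget g) :\: edges (forget h) -> v \in roots (forget h).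
Proof.
have /and4P[/subsetP sE /subsetP sS _ _] := valP p.
have /aromaticP[g1 g2 g3 g4] := cforest_aromatic g.
rewrite inE => /andP[nh gvw]; apply/rootsP; split.
- by move=> u; apply: contra nh => hvu; rewrite (g1 _ _ _ gvw (sE _ hvu)).
- by move=> t /sS tS; apply/negP => vt; move: (g3 t v w tS vt); rewrite gvw.
Qed.

Lemma newstolon_root s v :
  s \in stolons (forget g) :\: stolons (forget h) -> v \in s -> v \in roots (forget h).
Proof.
have /and4P[/subsetP sE /subsetP sS _ _] := valP p.
have /aromaticP[g1 g2 g3 g4] := cforest_aromatic g.
rewrite inE => /andP[nh gs] vs; apply/rootsP; split.
- by move=> u; apply: contra (g3 s v u gs vs); apply: sE.
- by move=> t tS; apply/negP => vt; move: nh; rewrite (g4 s t v) // ?tS //; apply: sS.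
Qed.

Lemma gquot_edgeP r r' : reflect
  (exists2 w, (val r, w) \in edges (forget g) :\: edges (forget h) & r' = cproj h w)
  ((r, r') \in edges gquot).
Proof.
have /clumpingP[h1 h2 _ _] := cforest_clumping h.
apply: (iffP imsetP) => [[[v w] vw [-> ->]]|[w vw ->]].
  by exists w => //=; rewrite h2 // (newedge_root vw).
by exists (val r, w) => //=; rewrite cproj_id.
Qed.

Lemma gquot_stolonP (s : {set {r : V | r \in roots (forget h)}}) : reflect
  (val @: s \in stolons (forget g) :\: stolons (forget h)) (s \in stolons gquot).
Proof.
have /clumpingP[h1 h2 _ _] := cforest_clumping h.
apply: (iffP imsetP) => [[t tS ->]|sS].
  suff -> : val @: (cproj h @: t) = t by [].
  rewrite -imset_comp -[RHS]imset_id; apply: eq_in_imset => v vt /=.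
  by rewrite h2 // (newstolon_root tS).
exists (val @: s) => //; rewrite -imset_comp -[LHS]imset_id; apply: eq_in_imset => v vt /=.
by rewrite cproj_id.
Qed.

Lemma gquot_aromatic : aromatic gquot.
Proof.
have /aromaticP[g1 g2 g3 g4] := cforest_aromatic g.
apply/aromaticP; split.
- move=> r x y /gquot_edgeP[v] + -> /gquot_edgeP[w] + ->.
  by rewrite !inE => /andP[_ e] /andP[_ e']; rewrite (g1 _ _ _ e e').
- move=> s /gquot_stolonP; rewrite inE => /andP[_ /g2].
  by rewrite card_imset //; apply: val_inj.
- move=> s r r' /gquot_stolonP; rewrite inE => /andP[_ sS] rs.
  apply/gquot_edgeP => -[w]; rewrite inE => /andP[_ rw] _.
  by move: (g3 _ (val r) w sS (imset_f _ rs)); rewrite rw.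
- move=> s s' r /gquot_stolonP + /gquot_stolonP; rewrite !inE => /andP[_ sS] /andP[_ sS'] rs rs'.
  by apply: (imset_inj val_inj); apply: (g4 _ _ (val r)); rewrite ?imset_f.
Qed.

Lemma gquot_roots : roots gquot = val @^-1: roots (forget g).
Proof.
apply/setP => r; rewrite [RHS]inE; have /rootsP[re rs] := valP r.
apply/rootsP/rootsP => -[e s]; split.
- move=> w; apply/negP => rw; have /negP := e (cproj h w); apply; apply/gquot_edgeP.
  by exists w; rewrite // inE rw re.
- move=> t tS; apply/negP => rt; have tN : t \in stolons (forget g) :\: stolons (forget h).
    by rewrite inE tS andbT; apply/negP => /rs; rewrite rt.
  by have := s (cproj h @: t); rewrite imset_f // -{1}(cproj_id r) imset_f // => /(_ isT).
- by move=> w; apply/gquot_edgeP => -[v]; rewrite inE (negbTE (e v)) andbF.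
- move=> t /gquot_stolonP; rewrite inE => /andP[_ /s]; apply: contra; exact: imset_f.
Qed.

Lemma gquot_clumping : clumping gquot quot_clumping.
Proof.
have /clumpingP[g1 g2 g3 g4] := cforest_clumping g.
have /clumpingP[h1 h2 h3 h4] := cforest_clumping h.
have /and4P[_ _ _ /forallP sC] := valP p.
have gh v : clump h (clump g v) = clump g v by rewrite h2 // subforest_roots.
have gproj w : clump g (val (cproj h w)) = clump g w by apply/eqP/sC.
apply/clumpingP; split.
- by move=> r; rewrite gquot_roots inE ffunE /= gh.
- by move=> r; rewrite gquot_roots inE ffunE => /g2 ->; rewrite cproj_id.
- move=> r r' /gquot_edgeP[w]; rewrite inE => /andP[_ /g3 e] ->.
  by rewrite !ffunE gproj e.
- move=> s r r' /gquot_stolonP; rewrite inE => /andP[_ sS] rs rs'.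
  by rewrite !ffunE (g4 _ _ _ sS (imset_f _ rs) (imset_f _ rs')).
Qed.

Definition cquot : cforest {r : V | r \in roots (forget h)} :=
  mk_cforest gquot_aromatic gquot_clumping.
End Quotient.
End Cforest.

End Graphs.

(* A family of finite sets X n of structures on 'I_n, with relabelling. *)
Structure species := Species {
  structures : nat -> finType;
  relabelling : forall n, {action {perm 'I_n} &-> structures n} }.

Local Open Scope quotient_scope.

Section Isomorphism_classes.
Variables (X : species) (n : nat).

Definition isomorphic : rel (structures X n) :=
  fun x y => y \in orbit (relabelling X n) [set: {perm 'I_n}] x.
Lemma isomorphic_refl : reflexive isomorphic.
Proof. by move=> x; apply: orbit_refl. Qed.
Lemma isomorphic_sym : symmetric isomorphic.
Proof. by move=> x y; rewrite /isomorphic orbit_sym. Qed.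
Lemma isomorphic_trans : transitive isomorphic.
Proof. by move=> y x z xy yz; apply: orbit_trans yz xy. Qed.
Canonical isomorphic_equiv :=
  EquivRel isomorphic isomorphic_refl isomorphic_sym isomorphic_trans.

Definition isoquot := {eq_quot isomorphic}.
Definition isoclass : finType := quot_type isoquot.
End Isomorphism_classes.

(* Isomorphism classes, graded by the number of vertices. *)
Definition isoclasses (X : species) : choiceType := {n : nat & isoclass X n}.
Definition size_of (X : species) (p : isoclasses X) : nat := tag p.
Definition rep (X : species) (p : isoclasses X) : structures X (size_of p) :=
  repr (tagged p : isoquot X (tag p)).
Definition class_of (X : species) n (x : structures X n) : isoclasses X :=
  existT _ n (\pi_(isoquot X n) x : isoclass X n).
Definition sigma (X : species) (p : isoclasses X) : nat :=
  #|'C[rep p | relabelling X (size_of p)]%g|.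

Section Families.
Variable D : finType.
Implicit Types U V W : finType.

Definition kact k n (g : kforest D k 'I_n) (s : {perm 'I_n}) : kforest D k 'I_n :=
  krelabel (Bijective (permK s^-1%g) (permKV s^-1%g)) g.
Lemma gpull_eq1 V (f : V -> V) (g : graph D V) : f =1 id -> gpull f g = g.
Proof.
move=> f1; case: g => [[e s] a]; congr (_, _, _).
- by apply/setP => -[v w]; rewrite inE /= !f1.
- by apply/setP => t; rewrite inE (eq_imset _ f1) imset_id.
- by apply/ffunP => v; rewrite ffunE f1.
Qed.
Lemma gpull_comp U V W (f : U -> V) (f' : V -> W) (f'' : U -> W) (g : graph D W) :
  f'' =1 f' \o f -> gpull f'' g = gpull f (gpull f' g).
Proof.
move=> fE; congr (_, _, _).
- by apply/setP => -[v w]; rewrite !inE /= !fE.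
- by apply/setP => t; rewrite !inE (eq_imset _ fE) imset_comp.
- by apply/ffunP => v; rewrite !ffunE fE.
Qed.

Lemma kact_total k n : is_action [set: {perm 'I_n}] (@kact k n).
Proof.
apply: is_total_action => [g|g s t]; apply: val_inj => /=.
  by apply: gpull_eq1 => v; rewrite invg1 perm1.
by apply: gpull_comp => v; rewrite invMg permM.
Qed.
Definition KF k : species := @Species (fun n => kforest D k 'I_n)
  (fun n => Action (kact_total k n)).

Definition cact n (g : cforest D 'I_n) (s : {perm 'I_n}) : cforest D 'I_n :=
  crelabel (permK s^-1%g) (permKV s^-1%g) g.
Lemma cact_total n : is_action [set: {perm 'I_n}] (@cact n).
Proof.
apply: is_total_action => [g|g s t]; apply: val_inj => /=.
  rewrite [RHS]surjective_pairing; congr pair.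
    by apply: gpull_eq1 => v; rewrite invg1 perm1.
  by apply/ffunP => v; rewrite ffunE invgK invg1 !perm1.
congr pair; first by apply: gpull_comp => v; rewrite invMg permM.
by apply/ffunP => v; rewrite /clump /= !ffunE !invgK invMg !permM.
Qed.
Definition CF : species := @Species (fun n => cforest D 'I_n)
  (fun n => Action (@cact_total n)).

(* Aromatic trees with a marked vertex v, standing for the endomorphism of AT_D
   that attaches the root of its argument to v. *)
Definition pact n (x : kforest D 1 'I_n * 'I_n) (s : {perm 'I_n}) : kforest D 1 'I_n * 'I_n :=
  (kact x.1 s, s x.2).
Lemma pact_total n : is_action [set: {perm 'I_n}] (@pact n).
Proof.
apply: is_total_action => [[g v]|[g v] s t]; congr pair.
- exact: (act1 (Action (kact_total 1 n)) g).
- exact: perm1.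
- exact: (actM (Action (kact_total 1 n)) g s t).
- exact: permM.
Qed.
Definition PT : species := @Species (fun n => (kforest D 1 'I_n * 'I_n)%type : finType)
  (fun n => Action (@pact_total n)).

Definition kclass k V (g : kforest D k V) : isoclasses (KF k) :=
  @class_of (KF k) #|V| (krelabel (Bijective (@enum_valK V) (@enum_rankK V)) g).
Definition pclass V (t : kforest D 1 V) (v : V) : isoclasses PT :=
  @class_of PT #|V| (krelabel (Bijective (@enum_valK V) (@enum_rankK V)) t, enum_rank v).
Definition cclass V (g : cforest D V) : isoclasses CF :=
  @class_of CF #|V| (crelabel (@enum_valK V) (@enum_rankK V) g).

(* Operations on basis elements; a list stands for the sum of its entries. *)
Definition kprod k j (p : isoclasses (KF k)) (q : isoclasses (KF j)) : seq (isoclasses (KF (k + j))) :=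
  [:: kclass (kunion (rep p) (rep q))].
Definition graft k (t : isoclasses (KF 1)) (p : isoclasses (KF k)) : seq (isoclasses (KF k)) :=
  [seq kclass (kgraft (rep t) (rep p) w) | w <- enum 'I_(size_of p)].
Definition mark (t : isoclasses (KF 1)) : seq (isoclasses PT) :=
  [seq pclass (rep t) v | v <- enum 'I_(size_of t)].
Definition compose (x y : isoclasses PT) : seq (isoclasses PT) :=
  [:: pclass (kgraft (rep y).1 (rep x).1 (rep x).2) (inl (rep y).2)].
Definition trace (x : isoclasses PT) : seq (isoclasses (KF 0)) :=
  [:: kclass (kdiv (rep x).1 (rep x).2)].
Definition stolon (t u : isoclasses (KF 1)) : seq (isoclasses (KF 0)) :=
  [:: kclass (kstolon (rep t) (rep u))].
Definition cprod (p q : isoclasses CF) : seq (isoclasses CF) :=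
  [:: cclass (cunion (rep p) (rep q))].
Definition tree (t : isoclasses (KF 1)) : seq (isoclasses CF) := [:: cclass (ctree (rep t))].

(* The basis of CF_D^{(x) D} (x) CF_D; the tensor (x)_d p_d iota_d is the
   function d |-> p_d. *)
Definition tensor : choiceType := {ffun D -> isoclasses CF}.

Definition coproduct (p : isoclasses CF) : seq (tensor * isoclasses CF) :=
  [seq ([ffun d => cclass (ccolor (tagged x) d)], cclass (cquot (tagged x)))
     | x <- enum {: {h : cpart (rep p) & coloring (val h)}}].

End Families.
Arguments KF D k%_nat_scope.
Arguments kprod D k%_nat_scope j%_nat_scope.
Arguments graft D k%_nat_scope.

From mathcomp Require Import all_classical all_reals all_analysis.
Import GRing.Theory Num.Theory numFieldNormedType.Exports.
Local Open Scope ring_scope.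

Section Formal_sums.
Variable R : realType.
Implicit Types X Y Z : species.

(* Formal sums of isomorphism classes: the completion of the span of the
   classes by the number of vertices (every degree is finite-dimensional). *)
Definition fsum X := isoclasses X -> R^o.

Definition basis X (p : isoclasses X) : fsum X := fun q => (q == p)%:R.

Definition delta_sigma X (a : isoclasses X -> R) : fsum X := fun p => a p / (sigma p)%:R.

Definition sum_upto X (n : nat) (F : isoclasses X -> R) : R :=
  \sum_(m < n.+1) \sum_(p : isoclass X m) F (existT _ (m : nat) p).

(* Extension to formal sums of operations for which the number of vertices of
   the result is the (sum of the) number(s) of vertices of the argument(s). *)
Definition lift1 X Y (op : isoclasses X -> seq (isoclasses Y)) (x : fsum X) : fsum Y :=
  fun q => sum_upto (size_of q) (fun p => x p * (count_mem q (op p))%:R).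
Definition lift2 X Y Z (op : isoclasses X -> isoclasses Y -> seq (isoclasses Z))
    (x : fsum X) (y : fsum Y) : fsum Z :=
  fun q => sum_upto (size_of q) (fun p => sum_upto (size_of q)
    (fun p' => x p * y p' * (count_mem q (op p p'))%:R)).

(* Continuity for the filtration by the number of vertices. *)
Definition fcontinuous X Y (A : fsum X -> fsum Y) : Prop :=
  forall n, exists m, forall x : fsum X,
    (forall p, (size_of p < m)%N -> x p = 0) ->
    forall q, (size_of q < n)%N -> A x q = 0.

Section Substitution_morphism.
Variable D : finType.
Let A_D := fsum (KF D 0).
Let AT_D := fsum (KF D 1).
Let CF_D := fsum (CF D).

(* d t_1 o ... o d t_k, where d t is the endomorphism u |-> (u grafted onto t). *)
Definition elementary (t : AT_D) (s : seq AT_D) : fsum (PT D) :=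
  foldl (fun e u => lift2 (@compose D) e (lift1 (@mark D) u)) (lift1 (@mark D) t) s.

(* (A0, A1) is an endomorphism of the tracial stolonic pre-Lie-Rinehart algebra
   (AT_D, A_D), and A an algebra morphism extending A1 to CF_D = S(AT_D).
   The trace is defined on the elementary endomorphisms d t_1 o ... o d t_k; its
   value on d t is the divergence of t.  Commutation with the divergence alone
   (s = [::] in sm_trace) would not determine the morphism: products, grafting,
   divergence and stolons do not generate all aromas. *)
Record substitution_morphism (phi : D -> AT_D)
    (A0 : A_D -> A_D) (A1 : AT_D -> AT_D) (A : CF_D -> CF_D) : Prop := {
  sm_linear0 : linear A0;
  sm_linear1 : linear A1;
  sm_linear : linear A;
  sm_continuous0 : fcontinuous A0;
  sm_continuous1 : fcontinuous A1;
  sm_continuous : fcontinuous A;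
  sm_vertex d : A1 (basis (kclass (kdot d))) = phi d;
  sm_one0 : A0 (basis (kclass (knil D))) = basis (kclass (knil D));
  sm_prod0 w w' : A0 (lift2 (@kprod D 0 0) w w') = lift2 (@kprod D 0 0) (A0 w) (A0 w');
  sm_prod1 w t : A1 (lift2 (@kprod D 0 1) w t) = lift2 (@kprod D 0 1) (A0 w) (A1 t);
  sm_graft0 t w : A0 (lift2 (@graft D 0) t w) = lift2 (@graft D 0) (A1 t) (A0 w);
  sm_graft1 t u : A1 (lift2 (@graft D 1) t u) = lift2 (@graft D 1) (A1 t) (A1 u);
  sm_trace t s : A0 (lift1 (@trace D) (elementary t s)) =
                 lift1 (@trace D) (elementary (A1 t) [seq A1 u | u <- s]);
  sm_stolon t u : A0 (lift2 (@stolon D) t u) = lift2 (@stolon D) (A1 t) (A1 u);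
  sm_one : A (basis (cclass (cnil D))) = basis (cclass (cnil D));
  sm_prod p q : A (lift2 (@cprod D) p q) = lift2 (@cprod D) (A p) (A q);
  sm_tree t : A (lift1 (@tree D) t) = lift1 (@tree D) (A1 t)
}.

(* The component on CF_D of the unique substitution morphism. *)
Definition A_phi (phi : D -> AT_D) : CF_D -> CF_D :=
  (xget (fun=> 0, fun=> 0, fun=> 0)
    [set M : (A_D -> A_D) * (AT_D -> AT_D) * (CF_D -> CF_D)
       | substitution_morphism phi M.1.1 M.1.2 M.2]%classic).2.

(* The character of CF_D extending b0: the product of the values of b0 over the
   aromatic trees (clumps) of a clumped forest. *)
Definition clump_character (b0 : isoclasses (KF D 1) -> R) (p : isoclasses (CF D)) : R :=
  \prod_(r : {r | r \in roots (forget (rep p))}) b0 (kclass (cclump r)).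

Definition tensor_form (b : D -> isoclasses (CF D) -> R) (p : tensor D) : R :=
  \prod_(d : D) b d (p d).

(* B * a = (B (x) a) o Delta_CEM *)
Definition star (B : tensor D -> R) (a : isoclasses (CF D) -> R) (p : isoclasses (CF D)) : R :=
  \sum_(x <- coproduct p) B x.1 * a x.2.

End Substitution_morphism.

Section S_series.
Variables (D : finType) (n : nat).
Implicit Types (f : D -> 'rV[R]_n -> 'rV[R]_n) (psi : 'rV[R]_n -> R).

Definition partials (s : seq 'I_n) psi : 'rV[R]_n -> R :=
  foldr (fun i g x => 'D_(delta_mx 0 i) g x) psi s.

Definition smooth psi : Prop :=
  forall (s : seq 'I_n) (x : 'rV[R]_n), differentiable (partials s psi) x.
Definition smooth_field (g : 'rV[R]_n -> 'rV[R]_n) : Prop :=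
  forall i : 'I_n, smooth (fun x => g x 0 i).

(* The order in which preds and roots are enumerated is irrelevant for smooth
   arguments. *)
Definition elementary_differential f (V : finType) (g : graph D V) psi (x : 'rV[R]_n) : R :=
  \sum_(i : {ffun V -> 'I_n} |
        [forall s in stolons g, [forall v in s, [forall w in s, i v == i w]]])
    (\prod_(v : V) partials [seq i w | w <- enum (preds g v)]
                     (fun y => f (deco g v) y 0 (i v)) x)
    * partials [seq i r | r <- enum (roots g)] psi x.

(* F_D of a formal sum, as a formal series of differential operators graded by
   the number of vertices. *)
Definition F_D f (x : fsum (CF D)) (N : nat) psi (y : 'rV[R]_n) : R :=
  \sum_(p : isoclass (CF D) N) x (existT _ N p)
    * elementary_differential f (forget (rep (existT _ N p : isoclasses (CF D)))) psi y.

Definition S_series f (a : isoclasses (CF D) -> R) := F_D f (delta_sigma a).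
Definition S_subst f (phi : D -> fsum (KF D 1)) (a : isoclasses (CF D) -> R) :=
  F_D f (A_phi phi (delta_sigma a)).

End S_series.
End Formal_sums.

(* Main.v *)
Require Import Defs.
From HB Require Import structures.
From mathcomp Require Import all_boot all_order all_algebra all_fingroup.
From mathcomp Require Import generic_quotient.
From mathcomp Require Import all_classical all_reals all_analysis.
From mathcomp Require Import fintype finset bigop.
From Stdlib Require Lists.List.
Require Import Defs.

(** Both sides of the theorem are images under F_D of formal sums, so the theorem
    follows from an identity of formal sums: for phi d = delta_sigma (b0 d),
    A_phi phi (delta_sigma a) = delta_sigma (star b a), where b is the tensor of the
    characters that extend the b0 d. To prove it, the morphism A_phi, which is only
    known through its properties, is identified with an explicit formula.

    The formula is found by duality. A formal sum x is paired with a part A (a set of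
    vertices) of a graph M: [ev x A M] adds up the coefficients of x, each multiplied
    by the number of embeddings of the class onto that part. Pairing with the
    representative of p gives x p * sigma p, so the pairings determine x, and
    delta_sigma a pairs to a. In this picture every operation on formal sums becomes
    a sum over the ways to undo it ([ev_kprod], [ev_graft], [ev_stolon], [ev_compose],
    [ev_trace], [ev_cprod], [ev_tree]): products, grafting and stolons become sums over
    the subsets W of A that are joined to the rest of A by nothing, by one arrow or by
    one stolon, and the trace becomes a sum over the arrows that can be removed. Substitution becomes a sum
    over the contractions of A, that is, over its partitions into coloured trees: the
    trees are paired with phi, the quotient with x ([subst]).

    Existence: contracting and cutting commute, because an arrow or stolon between two
    blocks starts at the root of its block and survives in the quotient, and because a
    contraction for which W is a union of blocks is a pair of contractions
    ([subst_cut]). Hence the formula defines a substitution morphism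
    ([substitution_exists]).

    Uniqueness: two substitution morphisms agree on all basis elements, by induction on
    the number of vertices ([good_tree], [good_aroma], [good_clumped]). Each basis
    element is the leading term of an operation applied to smaller ones, all the other
    terms being known already ([triangular]). The delicate case is a connected aroma
    whose vertices all flow into a cycle: opening the cycle at one arrow shows it as
    the trace of a marked tree, and marked trees of this kind are combinations of
    compositions of graftings ([marked_span]), on whose traces the morphisms agree.
    Linearity and continuity then give equality ([substitution_unique]).

    Finally, the contractions of a clumped forest that respect its clumps are exactly
    the coloured partitions over which the coproduct is summed ([contract_inj],
    [contract_onto]). The value of delta_sigma a on the quotient is the value of a, and
    the weight of a contraction is the product of the values of the characters
    ([ev_quotient], [weight_product]), which gives [substitute_delta]. *)

Set Implicit Arguments.
Unset Strict Implicit.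
Unset Printing Implicit Defensive.

Import GRing.Theory Num.Theory.

(** * Arrows, ties and restrictions of a graph *)

Section Relations.
Variable D : finType.
Implicit Types U V W : finType.

Definition arrow V (g : graph D V) : rel V := fun v w => (v, w) \in edges g.
Definition tied V (g : graph D V) : rel V :=
  fun v w => (v != w) && ([set v; w] \in stolons g).

Lemma tied_sym V (g : graph D V) : symmetric (tied g).
Proof. by move=> v w; rewrite /tied eq_sym setUC. Qed.

Lemma arrow_pull V W (f : W -> V) (g : graph D V) v w :
  arrow (gpull f g) v w = arrow g (f v) (f w).
Proof. by rewrite /arrow inE. Qed.

Lemma tied_pull V W (f : W -> V) (g : graph D V) v w : injective f ->
  tied (gpull f g) v w = tied g (f v) (f w).
Proof. by move=> fI; rewrite /tied inE imsetU !imset_set1 (inj_eq fI). Qed.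

Lemma arrow_fun V (g : graph D V) v w w' :
  aromatic g -> arrow g v w -> arrow g v w' -> w = w'.
Proof. by case/aromaticP=> h _ _ _; apply: h. Qed.

Lemma tied_fun V (g : graph D V) v w w' :
  aromatic g -> tied g v w -> tied g v w' -> w = w'.
Proof.
case/aromaticP=> _ _ _ h /andP[vw sw] /andP[vw' sw'].
have /setP/(_ w) := h _ _ v sw sw' (set21 _ _) (set21 _ _).
by rewrite !inE eqxx orbT eq_sym (negPf vw) => /esym/eqP.
Qed.

Lemma arrow_tied V (g : graph D V) v w w' :
  aromatic g -> arrow g v w -> tied g v w' -> False.
Proof.
case/aromaticP=> _ _ h _ e /andP[_ s].
by have /negP := h _ v w s (set21 _ _); apply.
Qed.

Lemma stolonP V (g : graph D V) s : aromatic g -> s \in stolons g ->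
  exists v w, s = [set v; w] /\ tied g v w.
Proof.
case/aromaticP=> _ h _ _ sS; have /eqP/cards2P[v [w [vw sE]]] := h _ sS.
by exists v, w; rewrite /tied vw -sE.
Qed.

Lemma graph_ext V (g h : graph D V) : aromatic g -> aromatic h ->
  arrow g =2 arrow h -> tied g =2 tied h -> deco g =1 deco h -> g = h.
Proof.
move=> ga ha eE tE dE.
have -> : g = (edges g, stolons g, deco g) by case: (g) => [[]].
have -> : h = (edges h, stolons h, deco h) by case: (h) => [[]].
congr (_, _, _); last exact/ffunP.
  by apply/setP => -[v w]; exact: eE.
apply/setP => s; apply/idP/idP => sS.
  have [v [w [-> t]]] := stolonP ga sS; by move: t; rewrite tE => /andP[].
have [v [w [-> t]]] := stolonP ha sS; by move: t; rewrite -tE => /andP[].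
Qed.

Lemma gpull_ext V W (f : W -> V) (h : graph D V) (g : graph D W) : injective f ->
  aromatic h -> aromatic g -> (forall x y, arrow h (f x) (f y) = arrow g x y) ->
  (forall x y, tied h (f x) (f y) = tied g x y) ->
  (forall x, deco h (f x) = deco g x) -> gpull f h = g.
Proof.
move=> fI ha ga e1 e2 e3; apply: graph_ext => //.
- exact: gpull_aromatic fI ha.
- by move=> x y; rewrite arrow_pull.
- by move=> x y; rewrite (tied_pull _ _ _ fI).
- by move=> x; rewrite /deco /= ffunE; apply: e3.
Qed.

Lemma sub_aromatic V (g h : graph D V) : edges h \subset edges g ->
  stolons h \subset stolons g -> aromatic g -> aromatic h.
Proof.
move=> /subsetP sE /subsetP sS /aromaticP[g1 g2 g3 g4]; apply/aromaticP; split.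
- by move=> v w w' /sE e /sE; apply: g1.
- by move=> s /sS /g2.
- by move=> s v w /sS sg vs; apply: contra (g3 s v w sg vs); apply: sE.
- by move=> s s' v /sS a /sS; apply: g4.
Qed.

Lemma root_rel V (g : graph D V) v : aromatic g ->
  (v \in roots g) = [forall w, ~~ arrow g v w && ~~ tied g v w].
Proof.
move=> ga; apply/rootsP/forallP => [[e s] w|h].
  rewrite (e w) /=; apply/andP => -[_ /s]; by rewrite set21.
split=> [w|s sS]; first by case/andP: (h w).
apply/negP => vs; have [x [y [sE t]]] := stolonP ga sS.
move: vs; rewrite sE !inE => /orP[] /eqP vE; subst v.
  by have := h y; rewrite t andbF.
by have := h x; rewrite tied_sym t andbF.
Qed.

(** The vertex set is kept, so that parts need no type of their own. *)
Definition grestr V (A : {set V}) (g : graph D V) : graph D V :=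
  ([set e in edges g | (e.1 \in A) && (e.2 \in A)],
   [set s in stolons g | s \subset A], deco g).

Lemma arrow_restr V (A : {set V}) (g : graph D V) v w :
  arrow (grestr A g) v w = [&& v \in A, w \in A & arrow g v w].
Proof. by rewrite /arrow inE /= andbC andbA. Qed.

Lemma tied_restr V (A : {set V}) (g : graph D V) v w :
  tied (grestr A g) v w = [&& v \in A, w \in A & tied g v w].
Proof.
rewrite /tied inE subUset !sub1set.
by case: (v == w); case: (v \in A); case: (w \in A); rewrite ?andbF //= andbT.
Qed.

Definition aromatic_on V (A : {set V}) (g : graph D V) := aromatic (grestr A g).

Lemma aromatic_onT V (g : graph D V) : aromatic g -> aromatic_on [set: V] g.
Proof.
by apply: sub_aromatic; apply/subsetP => x; rewrite inE => /andP[].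
Qed.

Lemma aromatic_on_sub V (A B : {set V}) (g : graph D V) : B \subset A ->
  aromatic_on A g -> aromatic_on B g.
Proof.
move=> /subsetP BA; apply: sub_aromatic; apply/subsetP => x.
  by rewrite !inE => /and3P[-> /BA -> /BA ->].
by rewrite !inE => /andP[-> /= /subset_trans-> //]; apply/subsetP.
Qed.

Lemma gpull_restr V W (f : W -> V) (A : {set V}) (g : graph D V) :
  (forall w, f w \in A) -> gpull f (grestr A g) = gpull f g.
Proof.
move=> fA; congr (_, _, _).
- by apply/setP => -[v w]; rewrite !inE /= !fA !andbT.
- apply/setP => s; rewrite !inE andb_idr // => _.
  by apply/subsetP => _ /imsetP[x _ ->].
Qed.

Lemma aromatic_on_pull V W (f : W -> V) (A : {set V}) (g : graph D V) :
  injective f -> (forall w, f w \in A) -> aromatic_on A g -> aromatic (gpull f g).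
Proof. by move=> fI fA ga; rewrite -(gpull_restr g fA); apply: gpull_aromatic. Qed.

Definition roots_on V (A : {set V}) (g : graph D V) : {set V} :=
  [set v in A | [forall w in A, ~~ arrow g v w && ~~ tied g v w]].

Lemma in_roots_on V (A : {set V}) (g : graph D V) u : (u \in roots_on A g) =
  (u \in A) && [forall w in A, ~~ arrow g u w && ~~ tied g u w].
Proof. by rewrite inE. Qed.

Lemma roots_onT V (g : graph D V) : aromatic g -> roots_on setT g = roots g.
Proof.
move=> ga; apply/setP => v; rewrite root_rel // inE in_setT /=.
by apply/forall_inP/forallP => h w; [apply: h; rewrite inE|move=> *; apply: h].
Qed.

Lemma roots_pull V W (f : W -> V) (A : {set V}) (g : graph D V) :
  injective f -> f @: [set: W] = A -> aromatic_on A g ->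
  f @: roots (gpull f g) = roots_on A g.
Proof.
move=> fI fA ga.
have fA' w : f w \in A by rewrite -fA imset_f.
have pa := aromatic_on_pull fI fA' ga.
apply/setP => v; apply/imsetP/idP => [[w wr ->]|].
  rewrite inE fA' /=; apply/forall_inP => u; rewrite -fA => /imsetP[x _ ->].
  move: wr; rewrite root_rel // => /forallP/(_ x).
  by rewrite arrow_pull tied_pull.
rewrite inE => /andP[]; rewrite -{1}fA => /imsetP[w _ ->] /forall_inP h.
exists w => //; rewrite root_rel //; apply/forallP => u.
by rewrite arrow_pull tied_pull //; apply: h.
Qed.
End Relations.

(** * Marked graphs and their embeddings *)

Section Marked.
Variable D : finType.
Implicit Types U V W : finType.

(** The partial map records the marked vertex of a marked tree (as a constant map)
    or the root of the clump of each vertex of a clumped forest. *)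
Definition mgraph V : finType := (graph D V * {ffun V -> option V})%type.

Definition mpull V W (f : W -> V) (M : mgraph V) : mgraph W :=
  (gpull f M.1, [ffun w => [pick u | M.2 (f w) == Some (f u)]]).

Lemma eq_gpull V W (f f' : W -> V) (g : graph D V) : f =1 f' -> gpull f g = gpull f' g.
Proof.
move=> e; congr (_, _, _).
- by apply/setP => -[v w]; rewrite !inE /= !e.
- by apply/setP => s; rewrite !inE (eq_imset _ e).
- by apply/ffunP => w; rewrite !ffunE e.
Qed.

Lemma eq_mpull V W (f f' : W -> V) (M : mgraph V) : f =1 f' -> mpull f M = mpull f' M.
Proof.
move=> e; congr (_, _); first exact: eq_gpull.
by apply/ffunP => w; rewrite !ffunE e; apply: eq_pick => u; rewrite e.
Qed.

Lemma pickSome (T : finType) (P : pred T) u :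
  (forall x, P x -> x = u) -> ([pick x | P x] == Some u) = P u.
Proof.
move=> h; case: pickP => [x Px|->]; last by [].
have xu := h x Px; by rewrite -xu Px; apply/eqP.
Qed.

Lemma mpull_mark V W (f : W -> V) (M : mgraph V) w u : injective f ->
  ((mpull f M).2 w == Some u) = (M.2 (f w) == Some (f u)).
Proof.
move=> fI; rewrite ffunE; case: pickP => [x /eqP e|h]; last by rewrite h.
by rewrite e; apply/eqP/eqP => [[->]|[/fI->]].
Qed.

Lemma mpull_comp U V W (f : U -> V) (f' : V -> W) (M : mgraph W) : injective f' ->
  mpull (f' \o f) M = mpull f (mpull f' M).
Proof.
move=> f'I; congr (_, _); first exact: gpull_comp.
by apply/ffunP => w; rewrite [LHS]ffunE [RHS]ffunE; apply: eq_pick => u; rewrite mpull_mark.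
Qed.

Lemma mpull_id V (f : V -> V) (M : mgraph V) : f =1 id -> mpull f M = M.
Proof.
move=> f1; case: M => g m; congr (_, _); first exact: gpull_eq1.
apply/ffunP => v; rewrite ffunE /=; rewrite f1; case: (m v) => [u|].
  by apply/eqP; rewrite pickSome ?f1 // => x; rewrite f1 => /eqP[].
by case: pickP.
Qed.

(** What the embeddings onto A can see of a marked graph. *)
Definition agree V (A : {set V}) (M M' : mgraph V) :=
  [/\ forall v w, v \in A -> w \in A -> arrow M.1 v w = arrow M'.1 v w,
      forall s : {set V}, s \subset A -> (s \in stolons M.1) = (s \in stolons M'.1),
      forall v, v \in A -> deco M.1 v = deco M'.1 v
    & forall v w, v \in A -> w \in A -> (M.2 v == Some w) = (M'.2 v == Some w)].

Lemma agree_pull V W (A : {set V}) (M M' : mgraph V) (f : W -> V) :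
  agree A M M' -> (forall w, f w \in A) -> mpull f M = mpull f M'.
Proof.
move=> [h1 h2 h3 h4] fA; congr (_, _).
  congr (_, _, _).
  - by apply/setP => -[v w]; rewrite !inE; apply: h1.
  - apply/setP => s; rewrite !inE; apply: h2.
    by apply/subsetP => _ /imsetP[x _ ->].
  - by apply/ffunP => w; rewrite !ffunE; apply: h3.
by apply/ffunP => w; rewrite !ffunE; apply: eq_pick => u; apply: h4.
Qed.

(** The number of these embeddings pairs N with the part A of M; for A = setT and
    M = N it is the symmetry factor of N. *)
Definition occs V U (N : mgraph V) (A : {set U}) (M : mgraph U) : {set {ffun V -> U}} :=
  [set psi : {ffun V -> U} | [&& injectiveb psi, psi @: [set: V] == A & mpull psi M == N]].

Lemma occsP V U (N : mgraph V) (A : {set U}) (M : mgraph U) (psi : {ffun V -> U}) :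
  reflect [/\ injective psi, psi @: [set: V] = A & mpull psi M = N]
          (psi \in occs N A M).
Proof.
rewrite inE; apply: (iffP and3P) => [[/injectiveP a /eqP b /eqP c]|[a b c]]; split=> //.
- exact/injectiveP.
- exact/eqP.
- exact/eqP.
Qed.

Lemma occs_card V U (N : mgraph V) (A : {set U}) (M : mgraph U) (psi : {ffun V -> U}) :
  psi \in occs N A M -> #|A| = #|V|.
Proof. by case/occsP => h <- _; rewrite card_imset // cardsT. Qed.

Lemma occs_agree V U (N : mgraph V) (A : {set U}) (M M' : mgraph U) :
  agree A M M' -> occs N A M = occs N A M'.
Proof.
move=> h; apply/setP => psi.
have e : psi @: setT = A -> mpull psi M = mpull psi M'.
  by move=> pA; apply: (agree_pull h) => w; rewrite -pA imset_f.
by apply/occsP/occsP => -[a b c]; split=> //; rewrite -c e.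
Qed.

Lemma occs_source V W U (f : W -> V) (N : mgraph V) (A : {set U}) (M : mgraph U) :
  bijective f -> #|occs (mpull f N) A M| = #|occs N A M|.
Proof.
case=> f' fK f'K.
pose h (psi : {ffun V -> U}) := [ffun w => psi (f w)].
have hI : injective h.
  by move=> a b /ffunP e; apply/ffunP => v; have := e (f' v); rewrite !ffunE f'K.
have him (psi : {ffun V -> U}) : h psi @: setT = psi @: setT.
  apply/setP => u; apply/imsetP/imsetP => -[v _ ->].
    by exists (f v); rewrite ?ffunE.
  by exists (f' v); rewrite ?ffunE ?f'K.
rewrite -(card_imset _ hI); apply: eq_card => phi.
apply/occsP/imsetP => [[a b c]|[psi /occsP[a b c] ->]].
  exists [ffun v => phi (f' v)]; last by apply/ffunP => w; rewrite !ffunE fK.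
  apply/occsP; split.
  - by move=> x y; rewrite !ffunE => /a /(can_inj f'K).
  - rewrite -him -b; apply: eq_imset => w; by rewrite !ffunE fK.
  - rewrite (eq_mpull (f' := phi \o f')) => [|v]; last by rewrite ffunE.
    by rewrite mpull_comp // c -mpull_comp; [apply: mpull_id|exact: can_inj fK].
split.
- by move=> x y; rewrite !ffunE => /a /(can_inj fK).
- by rewrite him.
- rewrite (eq_mpull (f' := psi \o f)) => [|v]; last by rewrite ffunE.
  by rewrite mpull_comp // c.
Qed.

Lemma occs_target V U U' (N : mgraph V) (j : U -> U') (A : {set U}) (M : mgraph U') :
  injective j -> #|occs N (j @: A) M| = #|occs N A (mpull j M)|.
Proof.
move=> jI; pose h (psi : {ffun V -> U}) := [ffun v => j (psi v)].
have hI : injective h.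
  by move=> a b /ffunP e; apply/ffunP => v; have := e v; rewrite !ffunE => /jI.
have him (psi : {ffun V -> U}) : h psi @: setT = j @: (psi @: setT).
  by rewrite -imset_comp; apply: eq_imset => v; rewrite ffunE.
have hM (psi : {ffun V -> U}) : mpull (h psi) M = mpull psi (mpull j M).
  by rewrite -mpull_comp //; apply: eq_mpull => v; rewrite ffunE.
rewrite -(card_imset _ hI); apply: eq_card => phi.
apply/occsP/imsetP => [[a b c]|[psi /occsP[a b c] ->]].
  have h1 v : exists u, phi v == j u.
    have : phi v \in j @: A by rewrite -b imset_f.
    by case/imsetP => u _ ->; exists u.
  pose psi := [ffun v => xchoose (h1 v)].
  have phiE : phi = h psi.
    by apply/ffunP => v; rewrite !ffunE; apply/eqP/(xchooseP (h1 v)).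
  exists psi => //; apply/occsP; split.
  - by move=> x y e; apply: a; rewrite phiE [LHS]ffunE [RHS]ffunE e.
  - by apply: (imset_inj jI); rewrite -him -phiE.
  - by rewrite -hM -phiE.
split.
- by move=> x y; rewrite !ffunE => /jI /a.
- by rewrite him b.
- by rewrite hM.
Qed.

Lemma injective_sum V1 V2 U (A : {set U}) (p : {ffun V1 -> U} * {ffun V2 -> U})
    (h : {ffun V1 + V2 -> U}) :
  h =1 (fun x => match x with inl v => p.1 v | inr v => p.2 v end) ->
  injectiveb h && (h @: setT == A) =
  [&& injectiveb p.1, injectiveb p.2, p.1 @: setT \subset A & p.2 @: setT == A :\: p.1 @: setT].
Proof.
move=> hE.
have him : h @: setT = (p.1 @: setT) :|: (p.2 @: setT).
  apply/setP => u; rewrite inE; apply/imsetP/orP => [[[v|v] _ ->]|[] /imsetP[v _ ->]].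
  - by left; rewrite hE imset_f.
  - by right; rewrite hE imset_f.
  - by exists (inl v); rewrite ?hE.
  - by exists (inr v); rewrite ?hE.
apply/andP/and4P => [[/injectiveP hI /eqP hA]|[/injectiveP i1 /injectiveP i2 sA /eqP e2]].
    have dis u : u \in p.1 @: setT -> u \in p.2 @: setT -> False.
      move=> /imsetP[v _ ->] /imsetP[w _ e]; have : h (inl v) = h (inr w) by rewrite !hE.
      by move/hI.
    split.
    - by apply/injectiveP => x y e; have : h (inl x) = h (inl y) by [rewrite !hE]; move/hI=> [].
    - by apply/injectiveP => x y e; have : h (inr x) = h (inr y) by [rewrite !hE]; move/hI=> [].
    - by rewrite -hA him subsetUl.
    - apply/eqP/setP => u; rewrite -hA him !inE.
      case: (boolP (u \in p.1 @: setT)) => [/dis|] //=; by case: (u \in _) => // /(_ isT).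
  split; last first.
    by rewrite him e2 setUC -{2}(setID A (p.1 @: setT)) (setIidPr sA) setUC.
  have dis v w : p.1 v = p.2 w -> False.
    move=> e; have : p.2 w \in p.2 @: setT by rewrite imset_f.
    by rewrite e2 -e inE imset_f.
  apply/injectiveP => -[x|x] [y|y]; rewrite !hE.
  - by move/i1 ->.
  - by move/dis.
  - by move/esym/dis.
  - by move/i2 ->.
Qed.

Section Sum.
Variables (V1 V2 U : finType) (N1 : mgraph V1) (N2 : mgraph V2).
Variables (A : {set U}) (cond : pred {set U}) (M1 M2 : {set U} -> mgraph U).

Definition glue (p : {ffun V1 -> U} * {ffun V2 -> U}) : {ffun V1 + V2 -> U} :=
  [ffun x => match x with inl v => p.1 v | inr v => p.2 v end].
Definition unglue (psi : {ffun V1 + V2 -> U}) : {ffun V1 -> U} * {ffun V2 -> U} :=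
  ([ffun v => psi (inl v)], [ffun v => psi (inr v)]).

Lemma glueE p : glue p =1 (fun x => match x with inl v => p.1 v | inr v => p.2 v end).
Proof. by move=> x; rewrite ffunE. Qed.
Lemma glueK : cancel glue unglue.
Proof. by move=> [a b]; congr (_, _); apply/ffunP => v; rewrite !ffunE. Qed.
Lemma unglueK : cancel unglue glue.
Proof. by move=> a; apply/ffunP => -[v|v]; rewrite !ffunE. Qed.

(* The only subset W that contributes is the image of p.1. *)
Lemma occs_glue (p : {ffun V1 -> U} * {ffun V2 -> U}) : let W0 := p.1 @: setT in
  (\sum_(W : {set U} | (W \subset A) && cond W)
     ((p.1 \in occs N1 W (M1 W)) && (p.2 \in occs N2 (A :\: W) (M2 W))))%N
  = (injectiveb (glue p) && (glue p @: setT == A)) &&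
    [&& cond W0, mpull p.1 (M1 W0) == N1 & mpull p.2 (M2 W0) == N2].
Proof.
move=> W0; rewrite (injective_sum A (glueE p)) -/W0.
have only (W : {set U}) : p.1 \in occs N1 W (M1 W) -> W = W0 by case/occsP.
rewrite big_mkcond (bigD1 W0) //= big1 ?addn0 => [|W /negbTE WW0]; last first.
  case: ifP => // _; apply/eqP; rewrite eqb0; apply/negP => /andP[/only e _].
  by rewrite e eqxx in WW0.
case: ifP => [/andP[sA cW]|no].
  congr nat_of_bool; rewrite sA cW.
  apply/andP/andP => [[/occsP[i1 _ m1] /occsP[i2 e2 m2]]|].
    by rewrite m1 m2 e2 !eqxx; split=> //; apply/and4P; split=> //; apply/injectiveP.
  case=> /and4P[/injectiveP i1 /injectiveP i2 _ /eqP e2] /and3P[_ /eqP m1 /eqP m2].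
  by split; apply/occsP.
apply/esym/eqP; rewrite eqb0; apply: contraFN no.
by move=> /andP[/and4P[_ _ -> _] /and3P[-> _ _]].
Qed.
End Sum.

(** An embedding of a sum of two graphs onto A consists of a subset W of A, an
    embedding of the first graph onto W and one of the second onto the rest. The
    index c leaves room for operations with several terms, such as grafting. *)
Lemma occs_sum (C V1 V2 U : finType) (N : C -> mgraph (V1 + V2)%type)
    (N1 : mgraph V1) (N2 : mgraph V2) (A : {set U}) (M : mgraph U)
    (cond : pred {set U}) (M1 M2 : {set U} -> mgraph U) :
  (forall (f1 : V1 -> U) (f2 : V2 -> U) (f : V1 + V2 -> U),
     f =1 (fun x => match x with inl v => f1 v | inr v => f2 v end) ->
     injective f -> f @: setT = A -> let W := f1 @: setT in
     \sum_c (mpull f M == N c) =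
     [&& cond W, mpull f1 (M1 W) == N1 & mpull f2 (M2 W) == N2] :> nat) ->
  (\sum_c #|occs (N c) A M| =
   \sum_(W : {set U} | (W \subset A) && cond W)
      #|occs N1 W (M1 W)| * #|occs N2 (A :\: W) (M2 W)|)%N.
Proof.
move=> H.
transitivity (\sum_(psi : {ffun V1 + V2 -> U} | injectiveb psi && (psi @: setT == A))
    \sum_c (mpull psi M == N c))%N.
  rewrite exchange_big /=; apply: eq_bigr => c _.
  rewrite -sum1dep_card big_mkcond [RHS]big_mkcond; apply: eq_bigr => psi _.
  by case: (injectiveb psi); case: (_ == A); case: (_ == N c).
rewrite (reindex (@glue V1 V2 U)) /=; last first.
  by exists (@unglue V1 V2 U) => x _; [exact: glueK|exact: unglueK].
transitivity (\sum_p \sum_(W : {set U} | (W \subset A) && cond W)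
    ((p.1 \in occs N1 W (M1 W)) && (p.2 \in occs N2 (A :\: W) (M2 W))))%N.
  rewrite big_mkcond; apply: eq_bigr => p _; rewrite occs_glue.
  case: ifP => [/andP[/injectiveP gI /eqP gA]|//]; rewrite andTb.
  exact: H (glueE p) gI gA.
rewrite exchange_big; apply: eq_bigr => W _.
rewrite -cardsX -sum1_card [RHS]big_mkcond; apply: eq_bigr => -[p1 p2] _.
by rewrite in_setX; case: (_ && _).
Qed.
End Marked.

(** * Cuts of a graph *)

Section Cuts.
Variable D : finType.
Implicit Types U V W : finType.

Definition crossing V (A B : {set V}) (g : graph D V) : {set V} :=
  [set v in A | [exists w in B, arrow g v w]].
Definition bonded V (A B : {set V}) (g : graph D V) : {set V} :=
  [set v in A | [exists w in B, tied g v w]].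
Definition target V (A B : {set V}) (g : graph D V) : option V :=
  [pick w in B | [exists v in A, arrow g v w]].
(** In an aromatic graph: i arrows leave A for B, j stolons join A to B, and no
    arrow goes from B to A. *)
Definition cut_type (i j : nat) V (A B : {set V}) (g : graph D V) : bool :=
  [&& crossing B A g == set0, #|crossing A B g| == i & #|bonded A B g| == j].

Lemma in_crossing V (A B : {set V}) (g : graph D V) u :
  (u \in crossing A B g) = (u \in A) && [exists w in B, arrow g u w].
Proof. by rewrite inE. Qed.
Lemma in_bonded V (A B : {set V}) (g : graph D V) u :
  (u \in bonded A B g) = (u \in A) && [exists w in B, tied g u w].
Proof. by rewrite inE. Qed.

Lemma crossing_imset V W (f : W -> V) (A B : {set W}) (g : graph D V) : injective f ->
  crossing (f @: A) (f @: B) g = f @: crossing A B (gpull f g).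
Proof.
move=> fI; apply/setP => u; rewrite inE; apply/andP/imsetP.
  case=> /imsetP[v vA ->] /exists_inP[_ /imsetP[w wB ->] e].
  by exists v; rewrite // inE vA; apply/exists_inP; exists w; rewrite // arrow_pull.
case=> v; rewrite inE => /andP[vA /exists_inP[w wB e]] ->; split; first exact: imset_f.
by apply/exists_inP; exists (f w); [exact: imset_f|rewrite -arrow_pull].
Qed.

Lemma bonded_imset V W (f : W -> V) (A B : {set W}) (g : graph D V) : injective f ->
  bonded (f @: A) (f @: B) g = f @: bonded A B (gpull f g).
Proof.
move=> fI; apply/setP => u; rewrite inE; apply/andP/imsetP.
  case=> /imsetP[v vA ->] /exists_inP[_ /imsetP[w wB ->] e].
  by exists v; rewrite // inE vA; apply/exists_inP; exists w; rewrite // tied_pull.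
case=> v; rewrite inE => /andP[vA /exists_inP[w wB e]] ->; split; first exact: imset_f.
by apply/exists_inP; exists (f w); [exact: imset_f|rewrite -tied_pull].
Qed.

Lemma cut_type_imset i j V W (f : W -> V) (A B : {set W}) (g : graph D V) : injective f ->
  cut_type i j (f @: A) (f @: B) g = cut_type i j A B (gpull f g).
Proof.
move=> fI; rewrite /cut_type !crossing_imset // bonded_imset // !card_imset //.
by rewrite -!cards_eq0 card_imset.
Qed.

Lemma targetP V (A B : {set V}) (g : graph D V) w :
  aromatic_on (A :|: B) g -> #|crossing A B g| = 1%N ->
  reflect (w \in B /\ exists2 v, v \in A & arrow g v w) (target A B g == Some w).
Proof.
move=> ga c1.
have uniq w1 w2 v1 v2 : w1 \in B -> w2 \in B -> v1 \in A -> v2 \in A ->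
    arrow g v1 w1 -> arrow g v2 w2 -> w1 = w2.
  move=> w1B w2B v1A v2A e1 e2.
  have /eqP/cards1P[r rE] := c1.
  have v1r : v1 \in [set r] by rewrite -rE inE v1A; apply/exists_inP; exists w1.
  have v2r : v2 \in [set r] by rewrite -rE inE v2A; apply/exists_inP; exists w2.
  move: v1r v2r e1 e2 v1A; rewrite !inE => /eqP-> /eqP-> e1 e2 rA.
  by apply: (arrow_fun ga (v := r)); rewrite arrow_restr !inE rA ?w1B ?w2B ?orbT.
rewrite /target; case: pickP => [x /andP[xB /exists_inP xP]|no].
  apply: (iffP eqP) => [[<-]|[wB [v' v'A e']]]; first by case: xP => v; split=> //; exists v.
  by case: xP => v vA e; congr Some; apply: (uniq _ _ v v').
constructor=> -[wB [v vA e]]; have /negP := negbT (no w); apply; rewrite /= wB /=.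
by apply/exists_inP; exists v.
Qed.

Lemma arrow_union V W (g : graph D V) (h : graph D W) x y :
  arrow (gunion g h) x y = match x, y with
    | inl v, inl w => arrow g v w | inr v, inr w => arrow h v w | _, _ => false end.
Proof. by rewrite /arrow; case: x => x; case: y => y; rewrite gunionE. Qed.

Lemma set2_imset (T T' : finType) (f : T -> T') (t : {set T}) z1 z2 : injective f ->
  [set z1; z2] = f @: t -> exists v1 v2, [/\ z1 = f v1, z2 = f v2 & t = [set v1; v2]].
Proof.
move=> fI e; have : z1 \in f @: t by rewrite -e set21.
have : z2 \in f @: t by rewrite -e set22.
move=> /imsetP[v2 _ z2E] /imsetP[v1 _ z1E]; exists v1, v2; split=> //.
by apply: (imset_inj fI); rewrite -e imsetU !imset_set1 z1E z2E.
Qed.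

Lemma tied_union V W (g : graph D V) (h : graph D W) x y :
  tied (gunion g h) x y = match x, y with
    | inl v, inl w => tied g v w | inr v, inr w => tied h v w | _, _ => false end.
Proof.
have inlI : injective (@inl V W) by move=> ? ? [].
have inrI : injective (@inr V W) by move=> ? ? [].
rewrite /tied; apply/andP/idP.
  case=> ne /gunion_stolonP[] [t tS] => [/(set2_imset inlI)|/(set2_imset inrI)] [v1 [v2 [e1 e2 tE]]]; subst x y t.
    by rewrite tS andbT; apply: contraNneq ne => ->.
  by rewrite tS andbT; apply: contraNneq ne => ->.
case: x => x; case: y => y // /andP[ne s]; split.
- by apply: contraNneq ne => -[->].
- by apply/gunion_stolonP; left; exists [set x; y]; rewrite // imsetU !imset_set1.
- by apply: contraNneq ne => -[->].
- by apply/gunion_stolonP; right; exists [set x; y]; rewrite // imsetU !imset_set1.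
Qed.

Lemma arrow_link V (A : {set V}) v (g : graph D V) x y :
  arrow (glink A v g) x y = arrow g x y || ((x \in A) && (y == v)).
Proof.
rewrite /arrow inE; congr orb; apply/imsetP/andP => [[r rA [-> ->]]|[xA /eqP->]] //.
by exists x.
Qed.

Lemma tied_link V (A : {set V}) v (g : graph D V) : tied (glink A v g) =2 tied g.
Proof. by []. Qed.

Lemma arrow_tie V (A B : {set V}) (g : graph D V) : arrow (gtie A B g) =2 arrow g.
Proof. by []. Qed.

Lemma set2_eq (V : finType) (a b c d : V) : a != b ->
  ([set a; b] == [set c; d]) = ((a == c) && (b == d)) || ((a == d) && (b == c)).
Proof.
move=> ab; apply/eqP/idP => [e|/orP[] /andP[/eqP-> /eqP->] //]; last exact: setUC.
have : a \in [set c; d] by rewrite -e set21.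
have : b \in [set c; d] by rewrite -e set22.
rewrite !inE => /orP[] bE /orP[] aE; rewrite ?aE ?bE ?orbT //.
  by move: ab; rewrite (eqP aE) (eqP bE) eqxx.
by move: ab; rewrite (eqP aE) (eqP bE) eqxx.
Qed.

Lemma tied_tie V r s (g : graph D V) x y : r != s ->
  tied (gtie [set r] [set s] g) x y =
  tied g x y || ((x == r) && (y == s)) || ((x == s) && (y == r)).
Proof.
move=> rs; rewrite /tied.
have -> : ([set x; y] \in stolons (gtie [set r] [set s] g)) =
   ([set x; y] \in stolons g) || ([set x; y] == [set r; s]).
  rewrite [LHS]inE; congr orb; apply/imset2P/eqP => [[a b]|->].
    by rewrite !inE => /eqP-> /eqP-> ->.
  by exists r s; rewrite ?inE.
have [->|xy] := eqVneq x y; last by rewrite /= set2_eq // orbA.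
by have [->|yr] /= := eqVneq y r; rewrite ?(negPf rs) ?andbF.
Qed.
End Cuts.

(** * Recognizing unions, graftings and stolon products *)

Section SumGraphs.
Variables (D V1 V2 : finType).
Implicit Types (h : graph D (V1 + V2)%type).
Notation lefts := (inl @: [set: V1] : {set V1 + V2}).
Notation rights := (inr @: [set: V2] : {set V1 + V2}).

Lemma inl_inj : injective (@inl V1 V2). Proof. by move=> ? ? []. Qed.
Lemma inr_inj : injective (@inr V1 V2). Proof. by move=> ? ? []. Qed.

Lemma crossing_left h v :
  (inl v \in crossing lefts rights h) = [exists w, arrow h (inl v) (inr w)].
Proof.
rewrite inE mem_inl inE /=; apply/exists_inP/existsP => [[_ /imsetP[w _ ->] e]|[w e]].
  by exists w.
by exists (inr w) => //; apply: imset_f.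
Qed.
Lemma crossing_right h v : (inr v \in crossing lefts rights h) = false.
Proof. by rewrite inE mem_inlr. Qed.
Lemma bonded_left h v :
  (inl v \in bonded lefts rights h) = [exists w, tied h (inl v) (inr w)].
Proof.
rewrite inE mem_inl inE /=; apply/exists_inP/existsP => [[_ /imsetP[w _ ->] e]|[w e]].
  by exists w.
by exists (inr w) => //; apply: imset_f.
Qed.
Lemma bonded_right h v : (inr v \in bonded lefts rights h) = false.
Proof. by rewrite inE mem_inlr. Qed.
Lemma backcrossing0 h :
  reflect (forall v w, arrow h (inr v) (inl w) = false) (crossing rights lefts h == set0).
Proof.
apply: (iffP eqP) => [/setP h0 v w|h0].
  have := h0 (inr v); rewrite !inE mem_inr inE /= => /negbT/exists_inPn/(_ (inl w)).
  by rewrite mem_inl inE => /(_ isT)/negbTE.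
apply/setP => -[v|v]; rewrite !inE ?mem_inrl //= mem_inr inE /=.
by apply/negbTE/exists_inPn => _ /imsetP[w _ ->]; rewrite h0.
Qed.

Lemma sum_graph_ext h h' : aromatic h -> aromatic h' ->
  gpull inl h = gpull inl h' -> gpull inr h = gpull inr h' ->
  (forall v w, arrow h (inl v) (inr w) = arrow h' (inl v) (inr w)) ->
  (forall v w, arrow h (inr v) (inl w) = arrow h' (inr v) (inl w)) ->
  (forall v w, tied h (inl v) (inr w) = tied h' (inl v) (inr w)) -> h = h'.
Proof.
move=> ha ha' el er e1 e2 e3; apply: graph_ext => //.
- move=> [x|x] [y|y] //.
    by rewrite -(arrow_pull inl) el arrow_pull.
  by rewrite -(arrow_pull inr) er arrow_pull.
- move=> [x|x] [y|y] //.
  + by rewrite -(tied_pull _ _ _ inl_inj) el (tied_pull _ _ _ inl_inj).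
  + by rewrite tied_sym e3 tied_sym.
  + by rewrite -(tied_pull _ _ _ inr_inj) er (tied_pull _ _ _ inr_inj).
- move=> [x|x].
    by have := congr1 (fun g => deco g x) el; rewrite /deco /= !ffunE.
  by have := congr1 (fun g => deco g x) er; rewrite /deco /= !ffunE.
Qed.

Section Pulls.
Variables (g1 : graph D V1) (g2 : graph D V2).
Hypotheses (a1 : aromatic g1) (a2 : aromatic g2).

(** A graph on a sum type is determined by its two halves and by the arrows and
    stolons between them, which the type of the cut prescribes. *)
Lemma eq_gunion h : aromatic h ->
  (h == gunion g1 g2) =
  [&& cut_type 0 0 lefts rights h, gpull inl h == g1 & gpull inr h == g2].
Proof.
move=> ha; apply/eqP/and3P => [->|[/and3P[/backcrossing0 c1 c2 c3] /eqP e1 /eqP e2]].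
  have ua := gunion_aromatic a1 a2.
  split.
  - apply/and3P; split.
    + by apply/backcrossing0 => v w; rewrite arrow_union.
    + rewrite cards_eq0; apply/eqP/setP => -[v|v]; rewrite ?crossing_right in_set0 // crossing_left.
      by apply/existsP => -[w]; rewrite arrow_union.
    + rewrite cards_eq0; apply/eqP/setP => -[v|v]; rewrite ?bonded_right in_set0 // bonded_left.
      by apply/existsP => -[w]; rewrite tied_union.
  - by apply/eqP/(gpull_ext inl_inj) => // [x y|x y|x]; rewrite ?arrow_union ?tied_union // /deco /= ffunE.
  - by apply/eqP/(gpull_ext inr_inj) => // [x y|x y|x]; rewrite ?arrow_union ?tied_union // /deco /= ffunE.
have ua := gunion_aromatic a1 a2.
move: c2 c3; rewrite !cards_eq0 => /eqP/setP c2 /eqP/setP c3.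
apply: sum_graph_ext => //.
- rewrite e1; apply/esym/(gpull_ext inl_inj) => // [x y|x y|x].
  + by rewrite arrow_union. + by rewrite tied_union. + by rewrite /deco /= ffunE.
- rewrite e2; apply/esym/(gpull_ext inr_inj) => // [x y|x y|x].
  + by rewrite arrow_union. + by rewrite tied_union. + by rewrite /deco /= ffunE.
- move=> v w; rewrite arrow_union; have := c2 (inl v); rewrite crossing_left in_set0.
  by move=> /existsPn/(_ w)/negbTE.
- by move=> v w; rewrite arrow_union.
- move=> v w; rewrite tied_union; have := c3 (inl v); rewrite bonded_left in_set0.
  by move=> /existsPn/(_ w)/negbTE.
Qed.

(** The only arrow of a cut of type (1, 0) leaves from a vertex that is a root of the
    left half, hence from r. *)
Lemma eq_graft h r w : aromatic h -> roots g1 = [set r] ->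
  (h == glink (inl @: roots g1) (inr w) (gunion g1 g2)) =
  [&& cut_type 1 0 lefts rights h, gpull inl h == g1, gpull inr h == g2
    & target lefts rights h == Some (inr w)].
Proof.
move=> ha r1; have ua := gunion_aromatic a1 a2.
have la : aromatic (glink (inl @: roots g1) (inr w) (gunion g1 g2)).
  by apply: glink_aromatic => //; rewrite gunion_roots subsetUl.
have haon : aromatic_on (lefts :|: rights) h.
  by apply: aromatic_on_sub (aromatic_onT ha); apply: subsetT.
set k := glink _ _ _ in la *.
have kE x y : arrow k x y = arrow (gunion g1 g2) x y || ((x == inl r) && (y == inr w)).
  by rewrite arrow_link r1 imset_set1 inE.
have kl : gpull inl k = g1.
  apply: (gpull_ext inl_inj) => // [x y|x y|x].
  + by rewrite kE arrow_union /= andbF orbF.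
  + by rewrite tied_link tied_union.
  + by rewrite /deco /= ffunE.
have kr : gpull inr k = g2.
  apply: (gpull_ext inr_inj) => // [x y|x y|x].
  + by rewrite kE arrow_union /= orbF.
  + by rewrite tied_link tied_union.
  + by rewrite /deco /= ffunE.
apply/eqP/and4P => [hk|[/and3P[/backcrossing0 c1 c2 c3] /eqP e1 /eqP e2 t]].
  have cr : crossing lefts rights k = [set inl r].
    apply/setP => -[v|v]; rewrite ?crossing_right ?crossing_left in_set1 //.
    apply/existsP/eqP => [[u]|[->]].
      by rewrite kE arrow_union /= => /andP[/eqP->].
    by exists w; rewrite kE !eqxx orbT.
  rewrite hk kl kr !eqxx; split=> //.
  - apply/and3P; split.
    + by apply/backcrossing0 => v u; rewrite kE arrow_union.
    + by rewrite cr cards1.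
    + rewrite cards_eq0; apply/eqP/setP => -[v|v]; rewrite ?bonded_right in_set0 // bonded_left.
      by apply/existsP => -[u]; rewrite tied_link tied_union.
  - apply/targetP; rewrite ?cr ?cards1 -?hk //.
    split; first by rewrite mem_inr.
    by exists (inl r); rewrite ?mem_inl // hk kE !eqxx orbT.
move: t => /(targetP _ haon (eqP c2)) [_ [x]] /imsetP[v _ ->] vw {x}.
have /cards1P[x xE] := c2.
have {x xE} cE : crossing lefts rights h = [set inl v].
  have : inl v \in crossing lefts rights h by rewrite crossing_left; apply/existsP; exists w.
  by rewrite xE in_set1 => /eqP ->.
have vr : v = r.
  have : v \in roots g1.
    rewrite -e1 root_rel; last exact: gpull_aromatic inl_inj ha.
    apply/forallP => u; rewrite arrow_pull (tied_pull _ _ _ inl_inj); apply/andP; split.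
      by apply/negP => /(arrow_fun ha vw).
    by apply/negP => /(arrow_tied ha vw).
  by rewrite r1 inE => /eqP.
move: c3; rewrite !cards_eq0 => /eqP/setP c3.
apply: sum_graph_ext => //; rewrite ?kl ?kr //.
- move=> x y; rewrite kE arrow_union /=.
  apply/idP/andP => [xy|[/eqP[->] /eqP[->]]]; last by rewrite -vr.
  have : inl x \in crossing lefts rights h by rewrite crossing_left; apply/existsP; exists y.
  rewrite cE in_set1 => /eqP[xv]; rewrite xv vr eqxx; split=> //.
  by rewrite xv in xy; rewrite (arrow_fun ha xy vw).
- by move=> x y; rewrite kE arrow_union /= c1.
- move=> x y; rewrite tied_link tied_union; have := c3 (inl x); rewrite bonded_left in_set0.
  by move=> /existsPn/(_ y)/negbTE.
Qed.

Lemma eq_stolon h r s : aromatic h -> roots g1 = [set r] -> roots g2 = [set s] ->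
  (h == gtie (inl @: roots g1) (inr @: roots g2) (gunion g1 g2)) =
  [&& cut_type 0 1 lefts rights h, gpull inl h == g1 & gpull inr h == g2].
Proof.
move=> ha r1 r2; have ua := gunion_aromatic a1 a2.
rewrite r1 r2 !imset_set1; set k := gtie _ _ _.
have la : aromatic k.
  apply: gtie_aromatic; rewrite ?gunion_roots ?inE //.
    by rewrite mem_inl r1 inE eqxx.
  by rewrite mem_inr r2 inE eqxx orbT.
have kE x y : tied k x y = tied (gunion g1 g2) x y ||
   ((x == inl r) && (y == inr s)) || ((x == inr s) && (y == inl r)) by apply: tied_tie.
have kl : gpull inl k = g1.
  apply: (gpull_ext inl_inj) => // [x y|x y|x].
  + by rewrite arrow_tie arrow_union.
  + by rewrite kE tied_union /= andbF !orbF.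
  + by rewrite /deco /= ffunE.
have kr : gpull inr k = g2.
  apply: (gpull_ext inr_inj) => // [x y|x y|x].
  + by rewrite arrow_tie arrow_union.
  + by rewrite kE tied_union /= andbF !orbF.
  + by rewrite /deco /= ffunE.
apply/eqP/and3P => [->|[/and3P[/backcrossing0 c1 c2 c3] /eqP e1 /eqP e2]].
  have bo : bonded lefts rights k = [set inl r].
    apply/setP => -[v|v]; rewrite ?bonded_right ?bonded_left in_set1 //.
    apply/existsP/eqP => [[u]|[->]].
      by rewrite kE tied_union /= orbF => /andP[/eqP->].
    by exists s; rewrite kE !eqxx orbT.
  rewrite kl kr !eqxx; split=> //; apply/and3P; split.
  - by apply/backcrossing0 => v u; rewrite arrow_tie arrow_union.
  - rewrite cards_eq0; apply/eqP/setP => -[v|v]; rewrite ?crossing_right in_set0 // crossing_left.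
    by apply/existsP => -[u]; rewrite arrow_tie arrow_union.
  - by rewrite bo cards1.
have /cards1P[x xE] := c3.
have [v xv] : exists v, x = inl v.
  have : x \in bonded lefts rights h by rewrite xE in_set1.
  by rewrite inE => /andP[/imsetP[v _ ->] _]; exists v.
rewrite {}xv in xE.
have : inl v \in bonded lefts rights h by rewrite xE in_set1.
rewrite bonded_left => /existsP[w vw].
have wv : tied h (inr w) (inl v) by rewrite tied_sym.
have vr : v = r.
  have : v \in roots g1.
    rewrite -e1 root_rel; last exact: gpull_aromatic inl_inj ha.
    apply/forallP => u; rewrite arrow_pull (tied_pull _ _ _ inl_inj); apply/andP; split.
      by apply/negP => /(arrow_tied ha)/(_ vw).
    by apply/negP => /(tied_fun ha vw).
  by rewrite r1 inE => /eqP.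
have ws : w = s.
  have : w \in roots g2.
    rewrite -e2 root_rel; last exact: gpull_aromatic inr_inj ha.
    apply/forallP => u; rewrite arrow_pull (tied_pull _ _ _ inr_inj); apply/andP; split.
      by apply/negP => /(arrow_tied ha)/(_ wv).
    by apply/negP => /(tied_fun ha wv).
  by rewrite r2 inE => /eqP.
move: c2; rewrite !cards_eq0 => /eqP/setP c2.
apply: sum_graph_ext => //; rewrite ?kl ?kr //.
- move=> x' y; rewrite arrow_tie arrow_union; have := c2 (inl x'); rewrite crossing_left in_set0.
  by move=> /existsPn/(_ y)/negbTE.
- by move=> x' y; rewrite arrow_tie arrow_union /= c1.
- move=> x' y; rewrite kE tied_union /= orbF.
  apply/idP/andP => [xy|[/eqP[->] /eqP[->]]]; last by rewrite -vr -ws.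
  have : inl x' \in bonded lefts rights h by rewrite bonded_left; apply/existsP; exists y.
  rewrite xE in_set1 => /eqP[xv]; rewrite xv vr eqxx; split=> //.
  by rewrite xv in xy; rewrite (tied_fun ha xy vw) ws.
Qed.
End Pulls.
End SumGraphs.

Local Open Scope ring_scope.

(** * Isomorphism classes as marked graphs *)

Local Open Scope quotient_scope.

Section MarkedSpecies.
Variable D : finType.

(** Embedding the structures into marked graphs compatibly with relabelling makes a
    single theory of embeddings serve trees, aromas, marked trees and clumped
    forests. *)
Record mspecies := MSpecies {
  sp :> species;
  emb : forall n, structures sp n -> mgraph D 'I_n;
  emb_inj : forall n, injective (@emb n);
  emb_act : forall n (g : structures sp n) (s : {perm 'I_n}),
    emb (relabelling sp n g s) = mpull (s^-1)%g (emb g) }.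

Definition mg_k k V (g : kforest D k V) : mgraph D V := (val g, [ffun=> None]).
Definition mg_p V (g : kforest D 1 V) (v : V) : mgraph D V := (val g, [ffun=> Some v]).
Definition mg_c V (g : cforest D V) : mgraph D V :=
  (forget g, [ffun v => Some (clump g v)]).

Lemma mpull_k (V W : finType) k (f : W -> V) (g : kforest D k V) (h : kforest D k W) :
  val h = gpull f (val g) -> mg_k h = mpull f (mg_k g).
Proof.
move=> e; rewrite /mg_k e; congr (_, _); apply/ffunP => w.
by rewrite !ffunE; case: pickP => // x; rewrite ffunE.
Qed.

Lemma mpull_p (V W : finType) (f : W -> V) (g : kforest D 1 V) (h : kforest D 1 W) v w :
  injective f -> val h = gpull f (val g) -> v = f w -> mg_p h w = mpull f (mg_p g v).
Proof.
move=> fI e ->; rewrite /mg_p e; congr (_, _); apply/ffunP => u.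
rewrite !ffunE; apply/esym/eqP; rewrite pickSome ?ffunE //.
by move=> x /eqP[] /fI.
Qed.

Lemma mpull_c (V W : finType) (f : W -> V) (g : cforest D V) (h : cforest D W) :
  injective f -> forget h = gpull f (forget g) ->
  (forall w, clump g (f w) = f (clump h w)) -> mg_c h = mpull f (mg_c g).
Proof.
move=> fI e ec; rewrite /mg_c e; congr (_, _); apply/ffunP => u.
rewrite !ffunE; apply/esym/eqP; rewrite pickSome ?ec //.
by move=> x /eqP[] /fI.
Qed.

Lemma mg_k_inj k V : injective (@mg_k k V).
Proof. by move=> g h [] e; apply: val_inj. Qed.
Lemma mg_c_inj V : injective (@mg_c V).
Proof.
move=> g h [] e /ffunP c; apply: val_inj.
rewrite [LHS]surjective_pairing [RHS]surjective_pairing; congr (_, _) => //.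
by apply/ffunP => v; have := c v; rewrite !ffunE => -[].
Qed.

Lemma emb_p_inj n : injective (fun x : structures (PT D) n => mg_p x.1 x.2).
Proof.
move=> [g v] [h w] [] /= e /ffunP/(_ v); rewrite !ffunE => -[->].
by congr (_, _); apply: val_inj.
Qed.

Lemma emb_k_act k n (g : structures (KF D k) n) (s : {perm 'I_n}) :
  mg_k (relabelling (KF D k) n g s) = mpull (s^-1)%g (mg_k g).
Proof. exact: mpull_k. Qed.
Lemma emb_p_act n (g : structures (PT D) n) (s : {perm 'I_n}) :
  mg_p (relabelling (PT D) n g s).1 (relabelling (PT D) n g s).2
  = mpull (s^-1)%g (mg_p g.1 g.2).
Proof. by apply: mpull_p; rewrite ?permK //; apply: perm_inj. Qed.
Lemma emb_c_act n (g : structures (CF D) n) (s : {perm 'I_n}) :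
  mg_c (relabelling (CF D) n g s) = mpull (s^-1)%g (mg_c g).
Proof.
apply: mpull_c => [||w] //; first exact: perm_inj.
by rewrite /clump /= ffunE invgK permK.
Qed.

Canonical mKF (k : nat) := @MSpecies (KF D k) (fun n => @mg_k k 'I_n) (fun n => @mg_k_inj k 'I_n) (@emb_k_act k).
Canonical mPT := @MSpecies (PT D) (fun n x => mg_p x.1 x.2) emb_p_inj emb_p_act.
Canonical mCF := @MSpecies (CF D) (fun n => @mg_c 'I_n) (fun n => @mg_c_inj 'I_n) emb_c_act.

Variable X : mspecies.
Implicit Types U V W : finType.

Definition pemb (p : isoclasses X) : mgraph D 'I_(size_of p) := emb (rep p).

Lemma class_of_act n (g : structures X n) s :
  class_of (relabelling X n g s) = class_of g.
Proof.
congr (existT _ _ _); apply/eqmodP; rewrite /= /isomorphic orbit_sym.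
by apply/orbitP; exists s; rewrite ?inE.
Qed.

Lemma class_rep (p : isoclasses X) : class_of (rep p) = p.
Proof. by case: p => n p; congr (existT _ _ _); apply: reprK. Qed.

Lemma rep_class n (g : structures X n) :
  exists s, rep (class_of g) = relabelling X n g s.
Proof.
have : (repr (\pi_(isoquot X n) g) = g %[mod isoquot X n]) by rewrite reprK.
move/eqmodP; rewrite /= /isomorphic orbit_sym => /orbitP[s _ e].
by exists s.
Qed.

Lemma emb_class n n' (g : structures X n) (g' : structures X n') (f : 'I_n -> 'I_n') :
  bijective f -> mpull f (emb g') = emb g -> class_of g = class_of g'.
Proof.
move=> fB e; have nn : n = n' by rewrite -(card_ord n) -(card_ord n'); apply: bij_eq_card fB.
subst n'; pose s := perm (bij_inj fB).
rewrite -(class_of_act g' (s^-1)%g); congr class_of; apply: emb_inj.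
by rewrite emb_act invgK -e; apply: eq_mpull => v; rewrite permE.
Qed.

Lemma occs_class n (g : structures X n) U (A : {set U}) (M : mgraph D U) :
  #|occs (pemb (class_of g)) A M| = #|occs (emb g) A M|.
Proof.
have gen (h : structures X n) : (exists s, h = relabelling X n g s) ->
    #|occs (emb h) A M| = #|occs (emb g) A M|.
  move=> [s ->]; rewrite emb_act; apply: occs_source.
  by exists s; [apply: permKV|apply: permK].
exact: gen (rep_class g).
Qed.

(** Both classes are isomorphic to the part A of M. *)
Lemma occs_two n n' (g : structures X n) (g' : structures X n') U (A : {set U}) M psi psi' :
  psi \in occs (emb g) A M -> psi' \in occs (emb g') A M -> class_of g = class_of g'.
Proof.
move=> h h'; have nn : n = n'.
  by rewrite -(card_ord n) -(card_ord n') -(occs_card h) -(occs_card h').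
subst n'; move: h h' => /occsP[a b c] /occsP[a' b' c'].
have ex v : exists u, psi v == psi' u.
  have : psi v \in psi' @: setT by rewrite b' -b imset_f.
  by case/imsetP => u _ ->; exists u.
pose f v := xchoose (ex v); have fE v : psi v = psi' (f v).
  by apply/eqP/(xchooseP (ex v)).
have fI : injective f by move=> x y e; apply: a; rewrite !fE e.
apply: (@emb_class _ _ _ _ f); first exact: injF_bij.
rewrite -c -c' -mpull_comp //; exact: eq_mpull.
Qed.

Lemma occs_sigma (p : isoclasses X) : #|occs (pemb p) setT (pemb p)| = sigma p.
Proof.
pose h (s : {perm 'I_(size_of p)}) : {ffun 'I_(size_of p) -> 'I_(size_of p)} :=
  [ffun v => (s^-1)%g v].
have hI : injective h.
  move=> s t /ffunP e; apply: invg_inj; apply/permP => v; have := e v.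
  by rewrite !ffunE.
have hM s : (mpull (h s) (pemb p) == pemb p) = (s \in 'C[rep p | relabelling X (size_of p)]%g).
  rewrite (eq_mpull (f' := (s^-1)%g)) => [|v]; last by rewrite ffunE.
  rewrite -emb_act (inj_eq (@emb_inj _ _)).
  by apply/eqP/astab1P => [e|]; rewrite ?e.
rewrite /sigma -(card_imset _ hI); apply: eq_card => psi.
apply/occsP/imsetP => [[a b c]|[s sS ->]].
  have e : psi = h (perm a)^-1%g by apply/ffunP => v; rewrite ffunE invgK permE.
  by exists (perm a)^-1%g => //; rewrite -hM -e c.
split; last by apply/eqP; rewrite hM.
- by move=> x y; rewrite !ffunE => /perm_inj.
- by apply/setP => u; rewrite inE; apply/imsetP; exists (s u); rewrite // ffunE permK.
Qed.
End MarkedSpecies.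

(** * Pairing formal sums with parts of a graph *)

Lemma big_single (R : nmodType) (T : eqType) (s : seq T) q (F : T -> R) :
  uniq s -> q \in s -> (forall p, p != q -> F p = 0) -> \sum_(p <- s) F p = F q.
Proof.
move=> us qs F0; rewrite (big_rem q qs) /= big1_seq ?addr0 // => p /= pr.
apply: F0; apply: contraTneq pr => ->.
by rewrite mem_rem_uniq // inE eqxx.
Qed.

Lemma big_vanish (R : nmodType) (T : eqType) (s : seq T) (F : T -> R) :
  (forall p, p \in s -> F p = 0) -> \sum_(p <- s) F p = 0.
Proof. by move=> h; apply: big1_seq => p; exact: h. Qed.

Section Classes.
Variables (R : realType) (X : species).

Definition classes_upto n : seq (isoclasses X) :=
  [seq existT (fun m => isoclass X m : Type) (m : nat) p | m : 'I_n.+1 <- index_enum 'I_n.+1, p <- index_enum (isoclass X m)].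

Lemma sum_uptoE n (F : isoclasses X -> R) :
  sum_upto n F = \sum_(p <- classes_upto n) F p.
Proof. by rewrite /classes_upto big_allpairs_dep. Qed.

Lemma classes_uptoP n (p : isoclasses X) : (p \in classes_upto n) = (size_of p <= n)%N.
Proof.
apply/allpairsPdep/idP => [[m [q [_ _ ->]]]|]; first exact: leq_ord.
case: p => m p le; exists (Ordinal (n := n.+1) (m := m) le), p.
by rewrite !mem_index_enum.
Qed.

Lemma classes_upto_uniq n : uniq (classes_upto n).
Proof.
apply: allpairs_uniq_dep => [|m _|]; [exact: index_enum_uniq..|].
move=> [m p] [m' p'] _ _ /= e.
have mm : m = m' by apply: val_inj; case: e.
by subst m'; move/eqP: e; rewrite eq_Tagged /= => /eqP ->.
Qed.

Lemma sum_upto_eq n m (F : isoclasses X -> R) : (n <= m)%N ->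
  (forall p, (n < size_of p)%N -> F p = 0) -> sum_upto m F = sum_upto n F.
Proof.
move=> nm F0; rewrite !sum_uptoE.
rewrite (bigID (fun p => size_of p <= n)%N) /= [X in _ + X]big1 ?addr0 => [|p]; last first.
  by rewrite -ltnNge; apply: F0.
have e : perm_eq [seq p <- classes_upto m | (size_of p <= n)%N] (classes_upto n).
  apply: uniq_perm.
  - exact/filter_uniq/classes_upto_uniq.
  - exact: classes_upto_uniq.
  - move=> p; rewrite mem_filter !classes_uptoP andb_idr // => h; exact: leq_trans h nm.
by rewrite -big_filter (perm_big _ e).
Qed.

Lemma sum_upto1 n q (F : isoclasses X -> R) : (size_of q <= n)%N ->
  (forall p, p != q -> F p = 0) -> sum_upto n F = F q.
Proof.
move=> h F0; rewrite sum_uptoE.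
by apply: (@big_single _ (isoclasses X)); rewrite ?classes_upto_uniq ?classes_uptoP.
Qed.

Lemma sum_count n (L : seq (isoclasses X)) (F : isoclasses X -> R) :
  (forall p, (n < size_of p)%N -> F p = 0) ->
  \sum_(q <- classes_upto n) (count_mem q L)%:R * F q = \sum_(z <- L) F z.
Proof.
move=> F0; elim: L => [|z L IH].
  by rewrite big_nil big1 // => q _; rewrite /= mul0r.
rewrite big_cons -IH /=.
under eq_bigr do rewrite natrD mulrDl.
rewrite big_split /=; congr (_ + _).
rewrite -sum_uptoE; have [zn|nz] := leqP (size_of z) n.
  by rewrite (sum_upto1 (q := z)) ?eqxx ?mul1r // => p pz; rewrite eq_sym (negPf pz) mul0r.
rewrite F0 // sum_uptoE; apply: (@big_vanish _ (isoclasses X)) => p; rewrite classes_uptoP => pn.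
by case: eqP => [e|_]; [rewrite -e leqNgt nz in pn|rewrite mul0r].
Qed.
End Classes.

Section Evaluation.
Variables (R : realType) (D : finType).
Implicit Types U V W : finType.
Implicit Types X Y Z : mspecies D.

(** The pairing of a formal sum with the part A of M. Only classes with #|A| vertices
    have embeddings onto A, which makes the sum finite. *)
Definition ev X (x : fsum R X) U (A : {set U}) (M : mgraph D U) : R :=
  sum_upto #|A| (fun p : isoclasses X => x p * #|occs (pemb p) A M|%:R).

Lemma occs_neq0 V U (N : mgraph D V) (A : {set U}) (M : mgraph D U) :
  #|A| <> #|V| -> #|occs N A M| = 0%N.
Proof.
move=> h; apply: eq_card0 => psi; apply/negP => /occs_card; exact: h.
Qed.

Lemma evE X (x : fsum R X) U (A : {set U}) (M : mgraph D U) n : (#|A| <= n)%N ->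
  ev x A M = \sum_(p <- classes_upto X n) x p * #|occs (pemb p) A M|%:R.
Proof.
move=> h; rewrite -sum_uptoE (sum_upto_eq h) // => p hp.
rewrite occs_neq0 ?mulr0 //; rewrite card_ord => e; by rewrite e ltnn in hp.
Qed.

Lemma ev_class X (x : fsum R X) U (A : {set U}) M n (g : structures X n) psi :
  psi \in occs (emb g) A M -> ev x A M = x (class_of g) * (sigma (class_of g))%:R.
Proof.
move=> h; have An : #|A| = n by rewrite (occs_card h) card_ord.
rewrite /ev (sum_upto1 (q := class_of g)) ?An // => [|p pg]; last first.
  apply/eqP; rewrite mulf_eq0 pnatr_eq0 orbC; apply/orP; left; apply/eqP/eq_card0 => phi.
  by apply/negP => /(occs_two h) e; rewrite e class_rep eqxx in pg.
congr (_ * _%:R).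
have {h An} [q [psi' [<- h]]] : exists q (psi' : {ffun 'I_(size_of q) -> U}),
    q = class_of g /\ psi' \in occs (pemb q) A M.
  exists (class_of g).
  have : (0 < #|occs (pemb (class_of g)) A M|)%N.
    by rewrite occs_class; apply/card_gt0P; exists psi.
  by case/card_gt0P => psi' h'; exists psi'.
rewrite -occs_sigma; case/occsP: h => i <- m.
rewrite occs_target; last exact: i.
by rewrite m.
Qed.

Lemma ev_rep X (x : fsum R X) (p : isoclasses X) :
  ev x [set: 'I_(size_of p)] (pemb p) = x p * (sigma p)%:R.
Proof.
have h : finfun id \in occs (pemb p) setT (pemb p); last first.
  by rewrite (ev_class x h) class_rep.
apply/occsP; split => [x' y|| ]; rewrite ?ffunE //.
- by apply/setP => u; rewrite inE; apply/imsetP; exists u; rewrite ?ffunE.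
- by apply: mpull_id => v; rewrite ffunE.
Qed.

Lemma sigma_gt0 X (p : isoclasses X) : (sigma p)%:R != 0 :> R.
Proof. by rewrite pnatr_eq0 -lt0n; apply: cardG_gt0. Qed.

(** These pairings separate formal sums, because pairing with the representative of
    a class gives its coefficient up to the symmetry factor. *)
Lemma ev_ext X (x y : fsum R X) :
  (forall p : isoclasses X, ev x [set: 'I_(size_of p)] (pemb p) = ev y setT (pemb p)) -> x = y.
Proof.
move=> h; apply/funext => p; have := h p; rewrite !ev_rep.
exact/mulIf/sigma_gt0.
Qed.

Lemma ev_agree X (x : fsum R X) U (A : {set U}) (M M' : mgraph D U) :
  agree A M M' -> ev x A M = ev x A M'.
Proof.
move=> h; rewrite /ev [LHS]sum_uptoE [RHS]sum_uptoE; apply: eq_bigr => p _.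
by rewrite (occs_agree (pemb p) h).
Qed.

Lemma ev_target X (x : fsum R X) U U' (j : U -> U') (A : {set U}) (M : mgraph D U') :
  injective j -> ev x (j @: A) M = ev x A (mpull j M).
Proof.
move=> jI; rewrite /ev card_imset; last exact: jI.
by rewrite !sum_uptoE; apply: eq_bigr => p _; rewrite occs_target.
Qed.

Definition present X U (A : {set U}) (M : mgraph D U) : Prop :=
  exists p : isoclasses X, exists psi, psi \in occs (pemb p) A M.

Lemma ev_neq0 X (x : fsum R X) U (A : {set U}) (M : mgraph D U) :
  ev x A M != 0 -> present X A M.
Proof.
move=> h; have [p _] : exists2 p, p \in classes_upto X #|A| & #|occs (pemb p) A M| != 0%N.
  apply/hasP; apply: contraNT h => /hasPn h.
  rewrite /ev sum_uptoE; apply/eqP/(@big_vanish _ (isoclasses X)) => p pA.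
  by have := h p pA; rewrite negbK => /eqP->; rewrite mulr0.
by rewrite -lt0n => /card_gt0P[psi h']; exists p, psi.
Qed.

Lemma evD X (x y : fsum R X) c U (A : {set U}) (M : mgraph D U) :
  ev (c *: x + y) A M = c * ev x A M + ev y A M.
Proof.
rewrite /ev !sum_uptoE mulr_sumr -big_split; apply: eq_bigr => p _ /=.
by rewrite !fctE mulrDl mulrA.
Qed.

Lemma ev_lift1 X Y (op : isoclasses X -> seq (isoclasses Y)) (x : fsum R X)
    (I : finType) U (A : {set U}) (M : mgraph D U) (P : pred I) (B : I -> {set U}) (M1 : I -> mgraph D U) :
  (forall i, P i -> (#|B i| <= #|A|)%N) ->
  (forall p, (size_of p <= #|A|)%N -> \sum_(z <- op p) #|occs (pemb z) A M| =
     \sum_(i | P i) #|occs (pemb p) (B i) (M1 i)|)%N ->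
  ev (lift1 op x) A M = \sum_(i | P i) ev x (B i) (M1 i).
Proof.
move=> hB H; set n := #|A| in hB H *.
transitivity (\sum_(p <- classes_upto X n) x p * (\sum_(z <- op p) #|occs (pemb z) A M|)%N%:R).
  transitivity (\sum_(q <- classes_upto Y n) \sum_(p <- classes_upto X n)
     x p * ((count_mem q (op p))%:R * #|occs (pemb q) A M|%:R)).
    rewrite /ev sum_uptoE -/n; apply: eq_bigr => q _.
    have [e|e] := eqVneq #|A| #|'I_(size_of q)|; last first.
      by rewrite (occs_neq0 _ _ (elimN eqP e)) mulr0 big1 // => p _; rewrite !mulr0.
    rewrite card_ord in e.
    have -> : lift1 op x q = sum_upto n (fun p => x p * (count_mem q (op p))%:R).
      by rewrite /lift1 -e.
    rewrite sum_uptoE mulr_suml.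
    by apply: eq_bigr => p _; rewrite mulrA.
  rewrite exchange_big /=; apply: eq_bigr => p _.
  rewrite -mulr_sumr sum_count ?natr_sum // => q hq.
  by rewrite occs_neq0 // card_ord => e; rewrite /n e ltnn in hq.
transitivity (\sum_(i | P i) \sum_(p <- classes_upto X n) x p * #|occs (pemb p) (B i) (M1 i)|%:R).
  rewrite exchange_big /=; apply: (@eq_big_seq _ _ _ (isoclasses X)) => p.
  by rewrite classes_uptoP => /H ->; rewrite natr_sum mulr_sumr.
by apply: eq_bigr => i /hB Bn; rewrite -evE.
Qed.

(** An operation on formal sums is dual to a sum over cuts as soon as the embeddings
    of its terms are counted by cuts. *)
Lemma ev_lift2 X Y Z (op : isoclasses X -> isoclasses Y -> seq (isoclasses Z))
    (x : fsum R X) (y : fsum R Y) U (A : {set U}) (M : mgraph D U)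
    (cond : pred {set U}) (M1 M2 : {set U} -> mgraph D U) :
  (forall p q, \sum_(z <- op p q) #|occs (pemb z) A M| =
     \sum_(W : {set U} | (W \subset A) && cond W)
       #|occs (pemb p) W (M1 W)| * #|occs (pemb q) (A :\: W) (M2 W)|)%N ->
  ev (lift2 op x y) A M =
  \sum_(W : {set U} | (W \subset A) && cond W) ev x W (M1 W) * ev y (A :\: W) (M2 W).
Proof.
move=> H; set n := #|A|.
transitivity (\sum_(p <- classes_upto X n) \sum_(p' <- classes_upto Y n)
   x p * y p' * (\sum_(z <- op p p') #|occs (pemb z) A M|)%N%:R).
  transitivity (\sum_(q <- classes_upto Z n) \sum_(p <- classes_upto X n) \sum_(p' <- classes_upto Y n)
     x p * y p' * ((count_mem q (op p p'))%:R * #|occs (pemb q) A M|%:R)).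
    rewrite /ev sum_uptoE -/n; apply: eq_bigr => q _.
    have [e|e] := eqVneq #|A| #|'I_(size_of q)|; last first.
      rewrite (occs_neq0 _ _ (elimN eqP e)) mulr0 big1 // => p _.
      by rewrite big1 // => p' _; rewrite !mulr0.
    rewrite card_ord in e.
    have -> : lift2 op x y q = sum_upto n (fun p => sum_upto n (fun p' =>
        x p * y p' * (count_mem q (op p p'))%:R)) by rewrite /lift2 -e.
    rewrite sum_uptoE mulr_suml.
    apply: eq_bigr => p _; rewrite sum_uptoE mulr_suml.
    by apply: eq_bigr => p' _; rewrite mulrA.
  rewrite exchange_big /=; apply: eq_bigr => p _.
  rewrite exchange_big /=; apply: eq_bigr => p' _.
  rewrite -mulr_sumr sum_count ?natr_sum // => q hq.
  by rewrite occs_neq0 // card_ord => e; rewrite /n e ltnn in hq.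
transitivity (\sum_(p <- classes_upto X n) \sum_(p' <- classes_upto Y n)
   \sum_(W : {set U} | (W \subset A) && cond W)
     (x p * #|occs (pemb p) W (M1 W)|%:R) * (y p' * #|occs (pemb p') (A :\: W) (M2 W)|%:R)).
  apply: eq_bigr => p _; apply: eq_bigr => p' _.
  rewrite H natr_sum mulr_sumr; apply: eq_bigr => W _.
  by rewrite natrM mulrACA.
under eq_bigr do rewrite exchange_big /=.
rewrite exchange_big /=; apply: eq_bigr => W /andP[WA _].
rewrite (evE x (M1 W) (subset_leq_card WA)) (evE y (M2 W) (subset_leq_card (subsetDl A W))).
by rewrite mulr_suml; apply: eq_bigr => p _; rewrite mulr_sumr.
Qed.
End Evaluation.

Section Occurrences_of_classes.
Variable D : finType.
Implicit Types U V W : finType.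

Lemma occs_kclass k V (g : kforest D k V) U (A : {set U}) M :
  #|occs (@pemb _ (mKF D k) (kclass g)) A M| = #|occs (mg_k g) A M|.
Proof.
rewrite (occs_class) /=.
rewrite (mpull_k (f := enum_val) (g := g)) // occs_source //; exact: enum_val_bij.
Qed.

Lemma occs_pclass V (g : kforest D 1 V) v U (A : {set U}) M :
  #|occs (@pemb _ (mPT D) (pclass g v)) A M| = #|occs (mg_p g v) A M|.
Proof.
rewrite (occs_class) /=.
rewrite (mpull_p (f := enum_val) (g := g) (v := v)); first last.
- by rewrite enum_rankK.
- by [].
- exact: enum_val_inj.
rewrite occs_source; last exact: enum_val_bij.
by [].
Qed.

Lemma occs_cclass V (g : cforest D V) U (A : {set U}) M :
  #|occs (@pemb _ (mCF D) (cclass g)) A M| = #|occs (mg_c g) A M|.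
Proof.
rewrite (occs_class) /=.
rewrite (mpull_c (f := enum_val) (g := g)); first last.
- by move=> w; rewrite /clump /= ffunE enum_rankK.
- by [].
- exact: enum_val_inj.
rewrite occs_source; last exact: enum_val_bij.
by [].
Qed.

End Occurrences_of_classes.

(** * The operations in dual form *)

Section Duals.
Variables (R : realType) (D : finType).
Implicit Types U V W : finType.

Definition cmark U (o : option U) : {ffun U -> option U} := [ffun=> o].
Definition plain U (g : graph D U) : mgraph D U := (g, cmark None).

Lemma eq_mg_k k V U (f : V -> U) (g : graph D U) (h : kforest D k V) :
  (mpull f (plain g) == mg_k h) = (gpull f g == val h).
Proof.
apply/eqP/eqP => [[]//|e]; rewrite /mg_k /mpull -e; congr (_, _).
by apply/ffunP => w; rewrite !ffunE; case: pickP => // x; rewrite ffunE.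
Qed.

Lemma eq_mg_p V U (f : V -> U) (g : graph D U) o (t : kforest D 1 V) v : injective f ->
  (mpull f (g, cmark o) == mg_p t v) = (gpull f g == val t) && (o == Some (f v)).
Proof.
move=> fI; apply/eqP/andP => [e|[/eqP e /eqP oE]].
  split; first by rewrite -[val t]/(mg_p t v).1 -e.
  have : (mpull f (g, cmark o)).2 v == Some v by rewrite e ffunE.
  by rewrite mpull_mark // ffunE.
rewrite /mg_p /mpull -e; congr (_, _); apply/ffunP => w.
by apply/eqP; rewrite [X in _ == X]ffunE mpull_mark // ffunE oE.
Qed.

Section Split.
Variables (V1 V2 U : finType) (g : graph D U) (A : {set U}).
Variables (f1 : V1 -> U) (f2 : V2 -> U) (f : V1 + V2 -> U).
Hypothesis fE : f =1 (fun x => match x with inl v => f1 v | inr v => f2 v end).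
Hypothesis fI : injective f.
Hypothesis fA : f @: [set: (V1 + V2)%type] = A.
Hypothesis ga : aromatic_on A g.
Let W := f1 @: [set: V1].
Notation lefts := (inl @: [set: V1] : {set V1 + V2}).
Notation rights := (inr @: [set: V2] : {set V1 + V2}).

Lemma split_inj1 : injective f1.
Proof. by move=> x y e; have : f (inl x) = f (inl y) by [rewrite !fE]; move/fI => []. Qed.
Lemma split_inj2 : injective f2.
Proof. by move=> x y e; have : f (inr x) = f (inr y) by [rewrite !fE]; move/fI => []. Qed.
Lemma split_lefts : f @: lefts = W.
Proof. by rewrite -imset_comp; apply: eq_imset => v /=; rewrite fE. Qed.
Lemma split_rights : f @: rights = A :\: W.
Proof.
apply/setP => u; rewrite in_setD -fA -split_lefts.
apply/imsetP/andP => [[_ /imsetP[v _ ->] ->]|[nl /imsetP[[v|v] _ e]]].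
- by split; [apply/imsetP => -[_ /imsetP[w _ ->] /fI]|rewrite imset_f].
- by case/negP: nl; rewrite e imset_f // mem_inl.
- by exists (inr v); rewrite // mem_inr.
Qed.
Lemma split_rights2 : f2 @: [set: V2] = A :\: W.
Proof. by rewrite -split_rights -imset_comp; apply: eq_imset => v /=; rewrite fE. Qed.
Lemma split_pull1 : gpull f1 g = gpull inl (gpull f g).
Proof. by apply: gpull_comp => v /=; rewrite fE. Qed.
Lemma split_pull2 : gpull f2 g = gpull inr (gpull f g).
Proof. by apply: gpull_comp => v /=; rewrite fE. Qed.
Lemma split_cut i j : cut_type i j lefts rights (gpull f g) = cut_type i j W (A :\: W) g.
Proof. by rewrite -split_rights -split_lefts cut_type_imset. Qed.
Lemma split_sub v : f v \in A. Proof. by rewrite -fA imset_f. Qed.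
Lemma split_aromatic : aromatic (gpull f g).
Proof. exact: aromatic_on_pull split_sub ga. Qed.
Lemma split_target w : cut_type 1 0 W (A :\: W) g ->
  (target lefts rights (gpull f g) == Some (inr w)) = (target W (A :\: W) g == Some (f2 w)).
Proof.
move=> c; have c' := c; rewrite -split_cut in c'.
case/and3P: c => _ /eqP c _; case/and3P: c' => _ /eqP c' _.
have WA : W \subset A by rewrite -fA -split_lefts imsetS ?subsetT.
have H1 : aromatic_on (lefts :|: rights) (gpull f g).
  by apply: aromatic_on_sub (aromatic_onT split_aromatic); apply: subsetT.
have H2 : aromatic_on (W :|: (A :\: W)) g.
  by apply: aromatic_on_sub ga; rewrite subUset WA subsetDl.
apply/(targetP _ H1 c')/(targetP _ H2 c).
- case=> _ [x /imsetP[v _ ->]]; rewrite arrow_pull !fE => e.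
  split; first by rewrite -split_rights2 imset_f.
  by exists (f1 v); rewrite ?imset_f.
- case=> _ [x /imsetP[v _ ->]] e; split; first by rewrite mem_inr.
  by exists (inl v); rewrite ?mem_inl // arrow_pull !fE.
Qed.

Variables (g1 : graph D V1) (g2 : graph D V2).
Hypotheses (a1 : aromatic g1) (a2 : aromatic g2).

Lemma split_union : (gpull f g == gunion g1 g2) =
  [&& cut_type 0 0 W (A :\: W) g, gpull f1 g == g1 & gpull f2 g == g2].
Proof. by rewrite (eq_gunion a1 a2 split_aromatic) split_cut -split_pull1 -split_pull2. Qed.

Lemma split_graft r w : roots g1 = [set r] ->
  (gpull f g == glink (inl @: roots g1) (inr w) (gunion g1 g2)) =
  [&& cut_type 1 0 W (A :\: W) g, gpull f1 g == g1, gpull f2 g == g2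
    & target W (A :\: W) g == Some (f2 w)].
Proof.
move=> rE; rewrite (eq_graft a1 a2 w split_aromatic rE) split_cut -split_pull1 -split_pull2.
by have [c|//] := boolP (cut_type 1 0 W (A :\: W) g); rewrite split_target.
Qed.

Lemma split_stolon r s : roots g1 = [set r] -> roots g2 = [set s] ->
  (gpull f g == gtie (inl @: roots g1) (inr @: roots g2) (gunion g1 g2)) =
  [&& cut_type 0 1 W (A :\: W) g, gpull f1 g == g1 & gpull f2 g == g2].
Proof.
by move=> rE sE; rewrite (eq_stolon a1 a2 split_aromatic rE sE) split_cut -split_pull1 -split_pull2.
Qed.
End Split.

Lemma occs_sum1 (V1 V2 U : finType) (N : mgraph D (V1 + V2)%type)
    (N1 : mgraph D V1) (N2 : mgraph D V2) (A : {set U}) (M : mgraph D U)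
    (cond : pred {set U}) (M1 M2 : {set U} -> mgraph D U) :
  (forall (f1 : V1 -> U) (f2 : V2 -> U) (f : V1 + V2 -> U),
     f =1 (fun x => match x with inl v => f1 v | inr v => f2 v end) ->
     injective f -> f @: [set: (V1 + V2)%type] = A -> let W := f1 @: [set: V1] in
     (mpull f M == N) =
     [&& cond W, mpull f1 (M1 W) == N1 & mpull f2 (M2 W) == N2]) ->
  (#|occs N A M| =
   \sum_(W : {set U} | (W \subset A) && cond W)
      #|occs N1 W (M1 W)| * #|occs N2 (A :\: W) (M2 W)|)%N.
Proof.
move=> H; rewrite -(@occs_sum D unit V1 V2 U (fun=> N) N1 N2 A M cond M1 M2).
  by rewrite (big_pred1 tt) //; case.
move=> f1 f2 f fE fI fA W; rewrite (big_pred1 tt); last by case.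
by rewrite (H f1 f2 f fE fI fA).
Qed.

Lemma kroot V (t : kforest D 1 V) : exists r, roots (val t) = [set r].
Proof. by have /eqP/cards1P := kforest_roots t. Qed.

Lemma ev_kprod k j (x : fsum R (KF D k)) (y : fsum R (KF D j)) U (A : {set U}) g :
  aromatic_on A g ->
  ev (lift2 (@kprod D k j) x y) A (plain g) =
  \sum_(W : {set U} | (W \subset A) && cut_type 0 0 W (A :\: W) g)
    ev x W (plain g) * ev y (A :\: W) (plain g).
Proof.
move=> ga; apply: (@ev_lift2 R D (mKF D k) (mKF D j) (mKF D (k + j)) (@kprod D k j) x y U A _ (fun W : {set U} => cut_type 0 0 W (A :\: W) g) (fun=> plain g) (fun=> plain g)).
move=> p q; rewrite big_seq1 occs_kclass; apply: occs_sum1 => f1 f2 f fE fI fA W.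
by rewrite !eq_mg_k; apply: (split_union fE fI fA ga); apply: kforest_aromatic.
Qed.

Lemma ev_stolon (x y : fsum R (KF D 1)) U (A : {set U}) g :
  aromatic_on A g ->
  ev (lift2 (@stolon D) x y) A (plain g) =
  \sum_(W : {set U} | (W \subset A) && cut_type 0 1 W (A :\: W) g)
    ev x W (plain g) * ev y (A :\: W) (plain g).
Proof.
move=> ga; apply: (@ev_lift2 R D (mKF D 1) (mKF D 1) (mKF D 0) (@stolon D) x y U A _ (fun W : {set U} => cut_type 0 1 W (A :\: W) g) (fun=> plain g) (fun=> plain g)).
move=> p q; rewrite big_seq1 occs_kclass; apply: occs_sum1 => f1 f2 f fE fI fA W.
have [r rE] := kroot (rep p : kforest _ _ _); have [s sE] := kroot (rep q : kforest _ _ _).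
rewrite !eq_mg_k; apply: (split_stolon fE fI fA ga _ _ rE sE); exact: kforest_aromatic.
Qed.

Lemma val_kgraft k V W (t : kforest D 1 V) (u : kforest D k W) w :
  val (kgraft t u w) = glink (inl @: roots (val t)) (inr w) (gunion (val t) (val u)).
Proof. by []. Qed.

(** Grafting sums over the vertex that receives the arrow; in a given part, that
    vertex is recovered as the target of the cut. *)
Lemma ev_graft k (x : fsum R (KF D 1)) (y : fsum R (KF D k)) U (A : {set U}) g :
  aromatic_on A g ->
  ev (lift2 (@graft D k) x y) A (plain g) =
  \sum_(W : {set U} | (W \subset A) && cut_type 1 0 W (A :\: W) g)
    ev x W (plain g) * ev y (A :\: W) (plain g).
Proof.
move=> ga; apply: (@ev_lift2 R D (mKF D 1) (mKF D k) (mKF D k) (@graft D k) x y U A _ (fun W : {set U} => cut_type 1 0 W (A :\: W) g) (fun=> plain g) (fun=> plain g)).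
move=> p q; rewrite big_map big_enum /=.
under eq_bigr do rewrite occs_kclass.
apply: occs_sum => f1 f2 f fE fI fA W.
have [r rE] := kroot (rep p : kforest _ _ _).
transitivity (\sum_(w < size_of q) ([&& cut_type 1 0 W (A :\: W) g,
   gpull f1 g == val (rep p : kforest D 1 _) & gpull f2 g == val (rep q : kforest D k _)]
   && (target W (A :\: W) g == Some (f2 w))))%N.
  apply: eq_bigr => w _; rewrite eq_mg_k val_kgraft.
  rewrite (split_graft fE fI fA ga _ _ _ rE); [|exact: kforest_aromatic..].
  by rewrite !andbA.
rewrite !eq_mg_k; case: (boolP [&& _, _ & _]) => /= [h|_]; last by rewrite big1.
have c : cut_type 1 0 W (A :\: W) g by case/and3P: h.
have /and3P[_ c1 _] := c; have /cards1P[v vE] := c1.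
have : v \in crossing W (A :\: W) g by rewrite vE inE.
rewrite inE => /andP[vW /exists_inP[u uB vu]].
have [w wE] : exists w, u = f2 w.
  by move: uB; rewrite -(split_rights2 fE fI fA) => /imsetP[w _ ->]; exists w.
have WA : W \subset A by rewrite -fA /W -(split_lefts fE) imsetS ?subsetT.
have tE : target W (A :\: W) g = Some (f2 w).
  apply/eqP/targetP; [|exact/eqP|by rewrite -wE; split=> //; exists v].
  by apply: aromatic_on_sub ga; rewrite subUset WA subsetDl.
rewrite (bigD1 w) //= tE eqxx big1 // => w' ww'.
by case: eqP => // -[/(split_inj2 fE fI)] e; rewrite e eqxx in ww'.
Qed.

Lemma lift2_flip (X Y Z : species) (op : isoclasses X -> isoclasses Y -> seq (isoclasses Z))
    (x : fsum R X) (y : fsum R Y) : lift2 op x y = lift2 (fun q p => op p q) y x.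
Proof.
apply/funext => z; rewrite /lift2 !sum_uptoE.
under eq_bigr do rewrite sum_uptoE.
rewrite exchange_big; apply: eq_bigr => q _; rewrite sum_uptoE.
by apply: eq_bigr => p _; rewrite [x p * _]mulrC.
Qed.

(** The copy W of the second tree is grafted onto the marked vertex of the first one,
    so the mark of the rest has to be the target of the cut. *)
Lemma ev_compose (x y : fsum R (PT D)) U (A : {set U}) g v :
  aromatic_on A g ->
  ev (lift2 (@compose D) x y) A (g, cmark (Some v)) =
  \sum_(W : {set U} | (W \subset A) && (cut_type 1 0 W (A :\: W) g && (v \in W)))
    ev y W (g, cmark (Some v))
    * ev x (A :\: W) (g, cmark (target W (A :\: W) g)).
Proof.
move=> ga; rewrite lift2_flip; apply: (@ev_lift2 R D (mPT D) (mPT D) (mPT D) (fun q p => @compose D p q) y x U A _ (fun W : {set U} => cut_type 1 0 W (A :\: W) g && (v \in W))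
  (fun=> (g, cmark (Some v))) (fun W : {set U} => (g, cmark (target W (A :\: W) g)))).
move=> q p; rewrite big_seq1 occs_pclass; apply: occs_sum1 => f1 f2 f fE fI fA W.
have [r rE] := kroot (rep q : kforest _ _ _ * _)%type.1.
have pE (z : isoclasses (PT D)) : pemb z = mg_p (rep z).1 (rep z).2 by [].
rewrite !pE !eq_mg_p //; [|exact: split_inj2 fE fI|exact: split_inj1 fE fI].
rewrite val_kgraft (split_graft fE fI fA ga _ _ _ rE) ?fE; [|exact: kforest_aromatic..].
case: (cut_type _ _ _ _ _) => //=.
case: (gpull f1 g == _) => /=; rewrite ?andbF //.
case: (gpull f2 g == _) => /=; rewrite ?andbF //.
case: (boolP (_ == Some (f1 _))) => [/eqP[->]|]; rewrite ?andbF ?andbT //.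
by rewrite imset_f.
Qed.

(** For every embedding exactly one choice of the mark is sent to v. *)
Lemma ev_mark (x : fsum R (KF D 1)) U (A : {set U}) g v : v \in A ->
  ev (lift1 (@mark D) x) A (g, cmark (Some v)) =
  ev x A (plain g).
Proof.
move=> vA; rewrite (@ev_lift1 R D (mKF D 1) (mPT D) (@mark D) x unit U A _ xpredT (fun=> A) (fun=> plain g)) //.
  by rewrite (big_pred1 tt) //; case.
move=> p _; rewrite (big_pred1 tt); last by case.
rewrite big_map big_enum /=; under eq_bigr do rewrite occs_pclass.
rewrite -sum1_card.
transitivity (\sum_w \sum_(psi : {ffun 'I_(size_of p) -> U}) (psi \in occs (mg_p (rep p : kforest D 1 _) w) A (g, cmark (Some v))))%N.
  by apply: eq_bigr => w _; rewrite -sum1_card big_mkcond.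
rewrite exchange_big [RHS]big_mkcond; apply: eq_bigr => psi _.
have [h|h] := boolP (psi \in _); last first.
  rewrite big1 // => w _; apply/eqP; rewrite eqb0; apply: contra h => /occsP[a b /eqP].
  rewrite eq_mg_p // => /andP[c _]; apply/occsP; split=> //; apply/eqP.
  by rewrite eq_mg_k.
case/occsP: h => a b /eqP; rewrite eq_mg_k => c.
have [w wE] : exists w, v = psi w by move: vA; rewrite -b => /imsetP[w _ ->]; exists w.
rewrite (bigD1 w) //= big1 => [|w' ww'].
  rewrite addn0; apply/eqP; rewrite eqb1; apply/occsP; split=> //; apply/eqP.
  by rewrite eq_mg_p // c wE eqxx.
apply/eqP; rewrite eqb0; apply/negP => /occsP[_ _ /eqP].
by rewrite eq_mg_p // wE => /andP[_ /eqP[/a e]]; rewrite e eqxx in ww'.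
Qed.
End Duals.

(** * The trace, clumped products and trees in dual form *)

Section Cutting.
Variable D : finType.
Implicit Types U V : finType.

(** The graph in which r has become a root. *)
Definition cut V (r : V) (g : graph D V) : graph D V :=
  ([set e in edges g | e.1 != r], [set s in stolons g | r \notin s], deco g).

Lemma arrow_cut V (r : V) g x y : arrow (cut r g) x y = (x != r) && arrow g x y.
Proof. by rewrite /arrow inE andbC. Qed.

Lemma tied_cut V (r : V) g x y : tied (cut r g) x y = [&& x != r, y != r & tied g x y].
Proof.
rewrite /tied !inE negb_or (eq_sym r x) (eq_sym r y).
by case: (x == r); case: (y == r); rewrite ?andbF ?andbT.
Qed.

Lemma cut_aromatic V (r : V) g : aromatic g -> aromatic (cut r g).
Proof. by apply: sub_aromatic; apply/subsetP => x; rewrite inE => /andP[]. Qed.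

Lemma gpull_cut V U (f : V -> U) (r : V) (g : graph D U) : injective f ->
  gpull f (cut (f r) g) = cut r (gpull f g).
Proof.
move=> fI; congr (_, _, _).
- by apply/setP => -[x y]; rewrite !inE (inj_eq fI).
- apply/setP => s; rewrite !inE; congr (_ && ~~ _); exact: mem_imset.
Qed.

Lemma cut_root V (r : V) g : aromatic g -> r \in roots (cut r g).
Proof.
move=> ga; rewrite root_rel ?cut_aromatic //; apply/forallP => w.
by rewrite arrow_cut tied_cut eqxx.
Qed.

Lemma eq_div V (h : graph D V) (t : kforest D 1 V) r v : aromatic h ->
  roots (val t) = [set r] ->
  (h == glink (roots (val t)) v (val t)) = arrow h r v && (cut r h == val t).
Proof.
move=> ha rE; have ta := kforest_aromatic t.
have /rootsP[r1 _] : r \in roots (val t) by rewrite rE inE.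
have rr : r \in roots (val t) by rewrite rE inE.
have la : aromatic (glink (roots (val t)) v (val t)) by apply: glink_aromatic.
move: rr; rewrite root_rel // => /forallP rr.
apply/eqP/andP => [->|[rv /eqP e]].
  split; first by rewrite arrow_link rE inE !eqxx orbT.
  apply/eqP/graph_ext => // [|x y|x y]; first exact: cut_aromatic.
    rewrite arrow_cut arrow_link rE inE; have [->|] := eqVneq x r => /=; last by rewrite orbF.
    by have /andP[/negbTE->] := rr y.
  rewrite tied_cut tied_link; have [->|] := eqVneq x r => /=.
    by have /andP[_ /negbTE->] := rr y.
  have [->|//] := eqVneq y r => /= _.
  by have /andP[_ /negbTE] := rr x; rewrite tied_sym => ->.
apply: graph_ext => // [x y|x y|x].
- rewrite arrow_link rE inE -e arrow_cut; have [->|xr] /= := eqVneq x r; last by rewrite orbF.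
  by apply/idP/eqP => [/(arrow_fun ha rv)|->].
- rewrite tied_link -e tied_cut; have [->|xr] /= := eqVneq x r.
    by apply/negP => /(arrow_tied ha rv).
  have [->|//] := eqVneq y r => /=.
  by apply/negP; rewrite tied_sym => /(arrow_tied ha rv).
- by rewrite [RHS](_ : _ = deco (val t) x) // -e.
Qed.
End Cutting.

Lemma sum_bool1 (I : finType) (P T : pred I) (i0 : I) :
  (forall i, P i -> T i -> i = i0) -> (\sum_(i | P i) T i)%N = P i0 && T i0.
Proof.
move=> h; have [/andP[p t]|n] := boolP (P i0 && T i0).
  rewrite (bigD1 i0) //= t big1 // => i /andP[Pi ne].
  by apply/eqP; rewrite eqb0; apply: contra ne => /(h i Pi) ->.
rewrite big1 // => i Pi; apply/eqP; rewrite eqb0; apply: contra n => Ti.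
by rewrite -(h i Pi Ti) Pi.
Qed.

Section Duals.
Variables (R : realType) (D : finType).
Implicit Types U V : finType.

Definition arrows_in U (A : {set U}) (g : graph D U) : pred (U * U) :=
  fun e => [&& e.1 \in A, e.2 \in A & arrow g e.1 e.2].

(** The trace adds an arrow from the root to the mark; conversely, removing an arrow
    e makes its source the root, and its target has to be the mark. *)
Lemma ev_trace (x : fsum R (PT D)) U (A : {set U}) g : aromatic_on A g ->
  ev (lift1 (@trace D) x) A (plain g) =
  \sum_(e | arrows_in A g e) ev x A (cut e.1 g, cmark (Some e.2)).
Proof.
move=> ga; apply: (@ev_lift1 R D (mPT D) (mKF D 0) (@trace D) x _ U A (plain g)
  (arrows_in A g) (fun=> A) (fun e => (cut e.1 g, cmark (Some e.2)))) => // p _.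
rewrite big_seq1 occs_kclass -sum1_card.
transitivity (\sum_(psi : {ffun 'I_(size_of p) -> U}) \sum_(e | arrows_in A g e)
   (psi \in occs (pemb p) A (cut e.1 g, cmark (Some e.2))))%N; last first.
  rewrite exchange_big; apply: eq_bigr => e _; rewrite -sum1_card [RHS]big_mkcond.
  by apply: eq_bigr => psi _; case: (psi \in _).
rewrite big_mkcond; apply: eq_bigr => psi _.
set t : kforest D 1 'I_(size_of p) := (rep p).1; set v : 'I_(size_of p) := (rep p).2.
have [r rE] := kroot t.
have [/andP[/injectiveP fI /eqP fA]|nf] := boolP (injectiveb psi && (psi @: setT == A)); last first.
  rewrite ifN; last by apply: contra nf => /occsP[a b _]; rewrite b eqxx andbT; apply/injectiveP.
  rewrite big1 // => e _; apply/eqP; rewrite eqb0.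
  by apply: contra nf => /occsP[a b _]; rewrite b eqxx andbT; apply/injectiveP.
have ha : aromatic (gpull psi g).
  by apply: aromatic_on_pull ga => // w; rewrite -fA imset_f.
have inA w : psi w \in A by rewrite -fA imset_f.
have mE e : (psi \in occs (pemb p) A (cut e.1 g, cmark (Some e.2)))
    = (gpull psi (cut e.1 g) == val t) && (e.2 == psi v).
  have -> : (e.2 == psi v) = (Some e.2 == Some (psi v)) by [].
  rewrite -(eq_mg_p _ _ _ _ fI); apply/occsP/eqP => [[]|] //.
have -> : (psi \in occs (mg_k (kdiv t v)) A (plain g)) = arrow (gpull psi g) r v && (cut r (gpull psi g) == val t).
  rewrite -(eq_div _ ha rE); apply/occsP/eqP => [[_ _ /eqP]|/eqP e].
    by rewrite eq_mg_k => /eqP.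
  by split=> //; apply/eqP; rewrite eq_mg_k.
have only e : arrows_in A g e -> psi \in occs (pemb p) A (cut e.1 g, cmark (Some e.2)) -> e = (psi r, psi v).
  case: e => e1 e2; rewrite mE => /and3P[/= e1A _ _] /andP[/eqP c /eqP/= ->].
  have {}c : gpull psi (cut e1 g) = val t := c.
  move: e1A; rewrite -fA => /imsetP[x' _ e1E]; rewrite e1E in c *.
  have : x' \in roots (val t) by rewrite -c gpull_cut // cut_root.
  by rewrite rE inE => /eqP ->.
symmetry; rewrite (sum_bool1 only) mE gpull_cut // eqxx andbT.
rewrite /arrows_in /= !inA arrow_pull; by case: (_ && _).
Qed.

Lemma eq_mg_c V U (f : V -> U) (g : graph D U) m (c : cforest D V) : injective f ->
  (mpull f (g, m) == mg_c c) =
  (gpull f g == forget c) && [forall w, m (f w) == Some (f (clump c w))].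
Proof.
move=> fI; apply/eqP/andP => [e|[/eqP e /forallP mE]].
  split; first by rewrite -[forget c]/(mg_c c).1 -e.
  apply/forallP => w; have : (mpull f (g, m)).2 w == Some (clump c w) by rewrite e ffunE.
  by rewrite mpull_mark.
rewrite /mg_c /mpull -e; congr (_, _); apply/ffunP => w.
by apply/eqP; rewrite [X in _ == X]ffunE mpull_mark //; apply: mE.
Qed.

(** W is a union of clumps. *)
Definition saturated U (A W : {set U}) (m : {ffun U -> option U}) : bool :=
  [forall v in A, forall w in A, (m v == Some w) ==> ((v \in W) == (w \in W))].

Lemma ev_cprod (x y : fsum R (CF D)) U (A : {set U}) g m :
  aromatic_on A g ->
  ev (lift2 (@cprod D) x y) A (g, m) =
  \sum_(W : {set U} | (W \subset A) && (cut_type 0 0 W (A :\: W) g && saturated A W m))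
    ev x W (g, m) * ev y (A :\: W) (g, m).
Proof.
move=> ga; apply: (@ev_lift2 R D (mCF D) (mCF D) (mCF D) (@cprod D) x y U A (g, m)
  (fun W : {set U} => cut_type 0 0 W (A :\: W) g && saturated A W m) (fun=> (g, m)) (fun=> (g, m))).
move=> p q; rewrite big_seq1 occs_cclass; apply: occs_sum1 => f1 f2 f fE fI fA W.
have f1I := split_inj1 fE fI; have f2I := split_inj2 fE fI.
rewrite /pemb /= !eq_mg_c // [forget _]/=.
rewrite [gpull f g == _](split_union fE fI fA ga) ?cforest_aromatic // -/W.
case: (cut_type _ _ _ _ _) => //=.
case: (gpull f1 g == _) => //=; rewrite ?andbF //.
case: (gpull f2 g == _) => //=; rewrite ?andbF //.
have B2 := split_rights2 fE fI fA; rewrite -/W in B2.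
apply/forallP/and3P => [h|[_ /forallP h1 /forallP h2] [w|w]]; last first.
- by rewrite fE /clump /= ffunE fE; apply: h2.
- by rewrite fE /clump /= ffunE fE; apply: h1.
have h1 w : m (f1 w) == Some (f1 (clump (rep p : cforest _ _) w)).
  by have := h (inl w); rewrite fE /clump /= ffunE fE.
have h2 w : m (f2 w) == Some (f2 (clump (rep q : cforest _ _) w)).
  by have := h (inr w); rewrite fE /clump /= ffunE fE.
split; [|exact/forallP..].
have in1 w : f1 w \in W by rewrite imset_f.
have in2 w : (f2 w \in W) = false.
  by have : f2 w \in f2 @: setT by [rewrite imset_f]; rewrite B2 inE => /andP[/negbTE].
apply/forall_inP => v; rewrite -fA => /imsetP[[v'|v'] _ ->]; apply/forall_inP => w _; apply/implyP; rewrite fE.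
  by rewrite (eqP (h1 v')) => /eqP[<-]; rewrite !in1.
by rewrite (eqP (h2 v')) => /eqP[<-]; rewrite !in2.
Qed.

(** The marks send each vertex of A to the root of its clump, computed inside A. *)
Definition clumping_on U (A : {set U}) (g : graph D U) (m : {ffun U -> option U}) : Prop :=
  exists cl : U -> U, [/\ forall v, v \in A -> m v = Some (cl v),
    forall v, v \in A -> cl v \in roots_on A g,
    forall v, v \in roots_on A g -> cl v = v,
    forall v w, v \in A -> w \in A -> arrow g v w -> cl v = cl w
  & forall v w, v \in A -> w \in A -> tied g v w -> cl v = cl w].

Lemma root_clumpingE V (t : kforest D 1 V) r v :
  roots (val t) = [set r] -> root_clumping (val t) v = r.
Proof.
move=> rE; rewrite ffunE; case: pickP => [x|/(_ r)]; rewrite rE !inE ?eqxx //.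
by move/eqP.
Qed.

(** A part with a single root has a single clumping. *)
Lemma ev_tree (x : fsum R (KF D 1)) U (A : {set U}) g m :
  aromatic_on A g -> clumping_on A g m ->
  ev (lift1 (@tree D) x) A (g, m) = ev x A (plain g).
Proof.
move=> ga [cl [c1 c2 c3 c4 c5]].
rewrite (@ev_lift1 R D (mKF D 1) (mCF D) (@tree D) x unit U A (g, m) xpredT (fun=> A) (fun=> plain g)) //.
  by rewrite (big_pred1 tt) //; case.
move=> p _; rewrite (big_pred1 tt); last by case.
rewrite big_seq1 occs_cclass; apply: eq_card => psi.
have [r rE] := kroot (rep p : kforest D 1 _).
apply/occsP/occsP => -[a b /eqP]; rewrite ?eq_mg_k ?eq_mg_c // => e; split=> //; apply/eqP;
  rewrite ?eq_mg_k ?eq_mg_c //; first by case/andP: e.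
rewrite e /=; apply/forallP => w; rewrite /clump /= (root_clumpingE _ rE).
have wA : psi w \in A by rewrite -b imset_f.
rewrite c1 //; apply/eqP; congr Some.
have := c2 _ wA; rewrite -(roots_pull a b ga) (eqP e) rE imset_set1 inE.
by move/eqP.
Qed.
End Duals.

(** * Contractions and quotients *)

Section Contractions.
Variable D : finType.
Implicit Types (V U : finType).

Definition heads V (A : {set V}) (s : {ffun V -> V * D}) : {set V} :=
  [set v in A | (s v).1 == v].

(** The block of v contains every vertex that v points to or is tied to, and there is
    one; a stolon inside a block does not touch the root of the block. *)
Definition attached V (A : {set V}) (g : graph D V) (s : {ffun V -> V * D}) (v : V) : bool :=
  [&& [forall w in A, arrow g v w ==> ((s w).1 == (s v).1)],
      [forall w in A, tied g v w ==> ((s w).1 != w) && ((s w).1 == (s v).1)]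
    & [exists w in A, arrow g v w || tied g v w]].

(** The encoding of a partition of A into coloured aromatic trees: the block of v has
    root (s v).1 and colour (s v).2. A vertex that is not the root of its block keeps
    its arrow or stolon in the block, a root loses it. The value outside A is fixed
    so that a partition is encoded only once. *)
Definition contraction V (A : {set V}) (g : graph D V) (s : {ffun V -> V * D}) : bool :=
  [forall v, if v \in A then [&& (s v).1 \in A, s (s v).1 == s v
                               & ((s v).1 != v) ==> attached A g s v]
             else s v == (v, deco g v)].

(** Blocks lie within clumps. *)
Definition compatible V (A : {set V}) (m : {ffun V -> option V}) (s : {ffun V -> V * D}) : bool :=
  [forall v in A, m (s v).1 == m v].

(** The quotient is carried by the roots of the blocks, inside the same vertex type. *)
Definition quot V (A : {set V}) (M : mgraph D V) (s : {ffun V -> V * D}) : mgraph D V :=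
  (([set e | [exists w in A, ((s w).1 == e.2) && arrow M.1 e.1 w]],
    [set t in stolons M.1 | t \subset heads A s], [ffun v => (s v).2]),
   [ffun v => omap (fun u => (s u).1) (M.2 v)]).

Lemma attachedP V (A : {set V}) g (s : {ffun V -> V * D}) v :
  reflect [/\ forall w, w \in A -> arrow g v w -> (s w).1 = (s v).1,
     forall w, w \in A -> tied g v w -> (s w).1 <> w /\ (s w).1 = (s v).1
   & exists2 w, w \in A & arrow g v w || tied g v w] (@attached V A g s v).
Proof.
apply: (iffP and3P) => [[/forall_inP a /forall_inP b /exists_inP c]|[a b c]]; split=> //.
- by move=> w wA e; apply/eqP; have := a w wA; rewrite e.
- by move=> w wA e; have := b w wA; rewrite e => /andP[/eqP ? /eqP ?].
- by apply/forall_inP => w wA; apply/implyP => e; apply/eqP/a.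
- by apply/forall_inP => w wA; apply/implyP => /(b w wA)[/eqP-> ->] /=.
- exact/exists_inP.
Qed.

Lemma contractionP V (A : {set V}) g (s : {ffun V -> V * D}) :
  reflect [/\ forall v, v \in A -> (s v).1 \in A, forall v, v \in A -> s (s v).1 = s v,
     forall v, v \in A -> (s v).1 <> v -> attached A g s v
   & forall v, v \notin A -> s v = (v, deco g v)] (@contraction V A g s).
Proof.
apply: (iffP forallP) => [h|[a b c d] v].
  split=> v vA; have := h v; rewrite ?vA ?(negbTE vA).
  - by case/and3P.
  - by case/and3P => _ /eqP.
  - by case/and3P => _ _ /implyP h' /eqP/h'.
  - by move/eqP.
case: ifPn => vA; last by rewrite d.
by rewrite a // b // eqxx /=; apply/implyP => /eqP; apply: c.
Qed.

Lemma arrow_quot V (A : {set V}) M (s : {ffun V -> V * D}) v w :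
  arrow (quot A M s).1 v w = [exists u in A, ((s u).1 == w) && arrow M.1 v u].
Proof. by rewrite /arrow inE. Qed.

Lemma tied_quot V (A : {set V}) M (s : {ffun V -> V * D}) v w :
  tied (quot A M s).1 v w = [&& v \in heads A s, w \in heads A s & tied M.1 v w].
Proof.
rewrite /tied inE subUset !sub1set.
by case: (_ != _); case: (v \in _); case: (w \in _); rewrite ?andbF ?andbT.
Qed.

Section Quotient.
Variables (V : finType) (A : {set V}) (M : mgraph D V) (s : {ffun V -> V * D}).
Hypotheses (ga : aromatic_on A M.1) (sc : contraction A M.1 s).

Lemma heads_sub : heads A s \subset A.
Proof. by apply/subsetP => v; rewrite inE => /andP[]. Qed.

Lemma head_in v : v \in A -> (s v).1 \in heads A s.
Proof. by case/contractionP: sc => a b _ _ vA; rewrite inE a // b ?eqxx. Qed.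

Lemma headsP v : reflect (v \in A /\ (s v).1 = v) (v \in heads A s).
Proof. by rewrite inE; apply: (iffP andP) => -[a /eqP b]; split=> //; apply/eqP. Qed.

Lemma roots_heads v : v \in roots_on A M.1 -> v \in heads A s.
Proof.
rewrite !inE => /andP[vA /forall_inP h]; rewrite vA /=; apply/negPn/negP => /eqP ne.
case/contractionP: sc => _ _ /(_ v vA ne)/attachedP[_ _ [w wA e]] _.
by have := h w wA; rewrite -negb_or e.
Qed.

(** A vertex that is not a head has an arrow or a stolon, and the arrow or stolon of a
    head survives in the quotient. *)
Lemma roots_quot : roots_on (heads A s) (quot A M s).1 = roots_on A M.1.
Proof.
case/contractionP: (sc) => c1 c2 c3 c4.
apply/setP => v; apply/idP/idP => vr; last first.
  have vh := roots_heads vr; rewrite inE vh /=; apply/forall_inP => w wh.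
  rewrite arrow_quot tied_quot; move: vr; rewrite inE => /andP[vA /forall_inP h].
  apply/andP; split.
    by apply/exists_inPn => u uA; rewrite negb_and; have /andP[-> _] := h u uA; rewrite orbT.
  by apply/negP => /and3P[_ _]; apply/negP; have /andP[_] := h w (subsetP heads_sub w wh).
move: vr; rewrite inE => /andP[vh /forall_inP h]; have vA := subsetP heads_sub v vh.
rewrite inE vA; apply/forall_inP => w wA; apply/andP; split.
  have /andP[+ _] := h _ (head_in wA); apply: contra; rewrite arrow_quot => e.
  by apply/exists_inP; exists w; rewrite // eqxx.
apply/negP => vw; have wh : w \in heads A s.
  apply/headsP; split=> //; apply/eqP/negPn/negP => /eqP ne.
  have /attachedP[_ h2 _] := c3 w wA ne.
  have [] := h2 v vA; first by rewrite tied_sym.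
  by move/headsP: vh => [_ ->].
by have /andP[_] := h w wh; rewrite tied_quot vh wh vw.
Qed.

Lemma quot_aromatic : aromatic_on (heads A s) (quot A M s).1.
Proof.
case/contractionP: (sc) => c1 c2 c3 c4.
case/aromaticP: (ga) => g1 g2 g3 g4.
have hA : forall t : {set V}, t \subset heads A s -> t \subset A.
  by move=> t th; apply: subset_trans th heads_sub.
have S t : t \in stolons (grestr (heads A s) (quot A M s).1) ->
    t \in stolons (grestr A M.1) /\ t \subset heads A s.
  by rewrite !inE /= => /andP[/andP[-> th] _]; rewrite th hA.
apply/aromaticP; split.
- move=> v w w'; rewrite -![_ \in edges _]/(arrow _ _ _) !arrow_restr !arrow_quot.
  move=> /and3P[vh wh /exists_inP[u uA /andP[/eqP <- e]]].
  move=> /and3P[_ wh' /exists_inP[u' uA' /andP[/eqP <- e']]].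
  have vA := subsetP heads_sub v vh.
  congr (s _).1; apply: (g1 v); rewrite -![_ \in edges _]/(arrow _ _ _) arrow_restr.
    by rewrite vA uA e.
  by rewrite vA uA' e'.
- by move=> t /S[/g2].
- move=> t v w /S[tS th] vt; have vh := subsetP th v vt; have vA := subsetP heads_sub v vh.
  rewrite -[_ \in edges _]/(arrow _ _ _) arrow_restr arrow_quot vh /= negb_and; apply/orP; right.
  apply/exists_inPn => u uA; rewrite negb_and; apply/orP; right.
  have := g3 t v u tS vt; by rewrite -[_ \in edges _]/(arrow _ _ _) arrow_restr vA uA.
- by move=> t t' v /S[tS _] /S[tS' _]; apply: g4.
Qed.
End Quotient.
End Contractions.

Section Realize.
Variable D : finType.
Implicit Types (V U : finType).

Lemma mpull_plain V U (f : V -> U) (g : graph D U) : mpull f (plain g) = plain (gpull f g).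
Proof.
congr (_, _); apply/ffunP => v; rewrite !ffunE.
by case: pickP => // x; rewrite ffunE.
Qed.

Definition listing U (A : {set U}) : 'I_#|A| -> U := enum_val.
Lemma listing_inj U (A : {set U}) : injective (@listing U A).
Proof. exact: enum_val_inj. Qed.
Lemma listing_image U (A : {set U}) : @listing U A @: [set: _] = A.
Proof.
apply/setP => u; apply/imsetP/idP => [[i _ ->]|uA]; first exact: enum_valP.
by exists (enum_rank_in uA u); rewrite /listing ?enum_rankK_in.
Qed.
Lemma listing_in U (A : {set U}) i : @listing U A i \in A.
Proof. exact: enum_valP. Qed.

Lemma present_listing (X : mspecies D) U (A : {set U}) (M : mgraph D U)
    (t : structures X #|A|) :
  emb t = mpull (@listing U A) M -> present X A M.
Proof.
move=> e; have : (0 < #|occs (pemb (class_of t)) A M|)%N.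
  rewrite occs_class; apply/card_gt0P; exists (finfun (@listing U A)).
  apply/occsP; split.
  - by move=> x y; rewrite !ffunE => /listing_inj.
  - by rewrite -[RHS]listing_image; apply: eq_imset => i; rewrite ffunE.
  - by rewrite e; apply: eq_mpull => i; rewrite ffunE.
by case/card_gt0P => psi h; exists (class_of t), psi.
Qed.

Lemma listing_aromatic U (A : {set U}) (g : graph D U) :
  aromatic_on A g -> aromatic (gpull (@listing U A) g).
Proof. by apply: aromatic_on_pull; [exact: listing_inj|exact: listing_in]. Qed.

Lemma listing_roots U (A : {set U}) (g : graph D U) : aromatic_on A g ->
  #|roots (gpull (@listing U A) g)| = #|roots_on A g|.
Proof.
move=> ga; rewrite -(roots_pull (@listing_inj U A) (@listing_image U A) ga).
by rewrite card_imset //; exact: listing_inj.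
Qed.

Definition listed_forest k U (A : {set U}) (g : graph D U) (ga : aromatic_on A g)
    (rk : #|roots_on A g| == k) : kforest D k 'I_#|A| :=
  exist (fun h : graph D 'I_#|A| => aromatic h && (#|roots h| == k)) _
    (introT andP (conj (listing_aromatic ga) (etrans (congr1 (eq_op^~ k) (listing_roots ga)) rk))).

Lemma present_k k U (A : {set U}) (g : graph D U) : aromatic_on A g ->
  present (mKF D k) A (plain g) <-> #|roots_on A g| = k.
Proof.
move=> ga; split=> [[p [psi /occsP[a b c]]]|/eqP rk].
  rewrite -(roots_pull a b ga) card_imset //.
  rewrite -[RHS](kforest_roots (rep p : kforest D k _)).
  congr #|(_ : {set _})|; congr roots; by rewrite -[LHS]/(mpull psi (plain g)).1 c.
by apply: (@present_listing (mKF D k) _ _ _ (listed_forest ga rk)); rewrite mpull_plain.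
Qed.

Lemma present_p U (A : {set U}) (g : graph D U) v : aromatic_on A g -> v \in A ->
  present (mPT D) A (g, cmark (Some v)) <-> #|roots_on A g| = 1%N.
Proof.
move=> ga vA; split=> [[p [psi /occsP[a b c]]]|/eqP rk].
  rewrite -(roots_pull a b ga) card_imset //.
  rewrite -[RHS](kforest_roots (rep p : kforest D 1 _ * _)%type.1).
  congr #|(_ : {set _})|; congr roots.
  by rewrite -[LHS]/(mpull psi (g, cmark (Some v))).1 c.
apply: (@present_listing (mPT D) _ _ _ (listed_forest ga rk, enum_rank_in vA v)).
apply/esym/eqP; rewrite [_ == _]eq_mg_p; last exact: listing_inj.
by rewrite eqxx /listing enum_rankK_in // eqxx.
Qed.

Lemma present_c U (A : {set U}) (g : graph D U) m : aromatic_on A g ->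
  clumping_on A g m -> present (mCF D) A (g, m).
Proof.
move=> ga [cl [c1 c2 c3 c4 c5]].
have rA v : v \in roots_on A g -> v \in A by rewrite inE => /andP[].
have pa := listing_aromatic ga.
pose l := @listing U A; have lI : injective l := @listing_inj U A.
have lA i : l i \in A := listing_in i.
have rE i : (i \in roots (gpull l g)) = (l i \in roots_on A g).
  by rewrite -(roots_pull lI (@listing_image U A) ga) mem_imset.
pose c : {ffun 'I_#|A| -> 'I_#|A|} := [ffun i => enum_rank_in (rA _ (c2 _ (lA i))) (cl (l i))].
have lc i : l (c i) = cl (l i).
  by rewrite ffunE /l /listing enum_rankK_in //; apply/rA/c2/lA.
have cC : clumping (gpull l g) c.
  apply/clumpingP; split.
  - by move=> i; rewrite rE lc c2.
  - by move=> i; rewrite rE => h; apply: lI; rewrite lc c3.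
  - move=> i k; rewrite -[_ \in edges _]/(arrow _ _ _) arrow_pull => e.
    by apply: lI; rewrite !lc; apply: c4.
  - move=> s i k sS is_ ks; apply: lI; rewrite !lc.
    have [x [y [sE t]]] := stolonP pa sS; move: t; rewrite (tied_pull _ _ _ (@listing_inj U A)) => t.
    have e := c5 _ _ (lA x) (lA y) t.
    by move: is_ ks; rewrite sE !inE => /orP[] /eqP-> /orP[] /eqP->.
apply: (@present_listing (mCF D) _ _ _ (mk_cforest pa cC)).
apply/esym/eqP; rewrite [_ == _]eq_mg_c // eqxx /=; apply/forallP => i.
by apply/eqP; rewrite (c1 _ (lA i)); congr Some; exact: esym (lc i).
Qed.
End Realize.

(** * The substitution formula *)

Section Substitution.
Variables (R : realType) (D : finType) (phi : D -> fsum R (KF D 1)).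
Implicit Types (V U : finType).

(** A head has lost its arrow or stolon in its block, whence the cut. *)
Definition weight V (A : {set V}) (g : graph D V) (s : {ffun V -> V * D}) : R :=
  \prod_(r in heads A s)
    ev (phi (s r).2) [set v in A | (s v).1 == r] (plain (cut r g)).

(** The substitution morphism in dual form: contract A in all possible ways, then pair
    the blocks with phi and the quotient with x. *)
Definition subst (X : mspecies D) (x : fsum R X) V (A : {set V}) (M : mgraph D V) : R :=
  \sum_(s : {ffun V -> V * D} | contraction A M.1 s && compatible A M.2 s)
     weight A M.1 s * ev x (heads A s) (quot A M s).

Definition marks_in V (A : {set V}) (m : {ffun V -> option V}) : Prop :=
  forall v u, v \in A -> m v = Some u -> u \in A.

Section Transport.
Variables (V U : finType) (j : V -> U) (M : mgraph D U).
Hypotheses (jI : injective j) (mI : marks_in (j @: [set: V]) M.2).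
Let A : {set U} := j @: [set: V].

(** Contractions are transported along j, with the prescribed values outside its
    image. *)
Definition push (s : {ffun V -> V * D}) : {ffun U -> U * D} :=
  [ffun u => if [pick v | j v == u] is Some v then (j (s v).1, (s v).2)
             else (u, deco M.1 u)].
Definition pull (t : {ffun U -> U * D}) : {ffun V -> V * D} :=
  [ffun v => (odflt v [pick w | j w == (t (j v)).1], (t (j v)).2)].

Lemma pick_j v : [pick w | j w == j v] = Some v.
Proof. by apply/eqP; rewrite pickSome ?eqxx // => x /eqP/jI. Qed.
Lemma pushE s v : push s (j v) = (j (s v).1, (s v).2).
Proof. by rewrite ffunE pick_j. Qed.
Lemma pushN s u : u \notin A -> push s u = (u, deco M.1 u).
Proof. by rewrite ffunE; case: pickP => // v /eqP <-; rewrite imset_f. Qed.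
Lemma pushK : cancel push pull.
Proof.
move=> s; apply/ffunP => v; rewrite ffunE pushE /= pick_j /=; by case: (s v).
Qed.
Lemma inj_A v : j v \in A. Proof. by rewrite imset_f. Qed.

Lemma heads_push s : heads A (push s) = j @: heads setT s.
Proof.
apply/setP => u; rewrite inE; apply/andP/imsetP => [[/imsetP[v _ ->]]|[v]].
  by rewrite pushE (inj_eq jI) => vE; exists v; rewrite // !inE.
by rewrite !inE /= => vE ->; rewrite inj_A pushE (inj_eq jI).
Qed.

Lemma attached_push s v : attached A M.1 (push s) (j v) = attached setT (gpull j M.1) s v.
Proof.
apply/attachedP/attachedP => -[a b c]; split.
- by move=> w _; rewrite arrow_pull => /(a _ (inj_A w)); rewrite !pushE => /jI.
- move=> w _; rewrite tied_pull // => /(b _ (inj_A w)); rewrite !pushE => -[n /jI e].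
  by split=> // we; apply: n; rewrite /= we.
- by case: c => _ /imsetP[w _ ->] e; exists w; rewrite // arrow_pull tied_pull.
- by move=> _ /imsetP[w _ ->] e; rewrite !pushE /= (a w) // arrow_pull.
- move=> _ /imsetP[w _ ->] e; have e' : tied (gpull j M.1) v w by rewrite tied_pull.
  by have [n nE] := b w (in_setT w) e'; rewrite !pushE nE; split=> // /jI; rewrite -nE.
- by case: c => w _; rewrite arrow_pull tied_pull // => e; exists (j w); rewrite ?inj_A.
Qed.

Lemma contraction_push s : contraction A M.1 (push s) = contraction setT (gpull j M.1) s.
Proof.
apply/contractionP/contractionP => -[a b c d]; split.
- by move=> v _; rewrite inE.
- move=> v _; have := b _ (inj_A v); rewrite !pushE => -[/jI e1 e2].
  by case: (s v) e1 e2 => x y /=; case: (s x) => x' y' /= -> ->.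
- move=> v _ ne; rewrite -attached_push; apply: c; first exact: inj_A.
  by rewrite pushE => /jI.
- by move=> v; rewrite inE.
- by move=> _ /imsetP[v _ ->]; rewrite pushE inj_A.
- by move=> _ /imsetP[v _ ->]; rewrite !pushE /= b.
- move=> _ /imsetP[v _ ->]; rewrite pushE /= attached_push => ne; apply: c => //.
  by move=> e; apply: ne; rewrite e.
- by move=> u uA; rewrite pushN.
Qed.

Lemma compatible_push s : compatible A M.2 (push s) = compatible setT (mpull j M).2 s.
Proof.
have jE v w : (M.2 (j v) = M.2 (j w)) <-> (mpull j M).2 v = (mpull j M).2 w.
  split=> [e|e]; first by rewrite !ffunE e.
  have E x : M.2 (j x) = omap j ((mpull j M).2 x).
    case mx: (M.2 (j x)) => [y|].
      have := mI (inj_A x) mx; case/imsetP => z _ yz; subst y.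
      have : (mpull j M).2 x == Some z by rewrite mpull_mark // mx.
      by move/eqP->.
    by rewrite ffunE mx; case: pickP.
  by rewrite !E e.
apply/forall_inP/forall_inP => [h v _|h _ /imsetP[v _ ->]].
  by apply/eqP/jE/eqP; have := h _ (inj_A v); rewrite pushE.
by rewrite pushE; apply/eqP/jE/eqP/h; rewrite inE.
Qed.

Lemma weight_push s : weight A M.1 (push s) = weight setT (gpull j M.1) s.
Proof.
rewrite /weight heads_push big_imset /=; last by move=> x y _ _; apply: jI.
apply: eq_bigr => r _; rewrite pushE /= -gpull_cut // -mpull_plain -ev_target //.
congr (ev _ _ _); apply/setP => u; rewrite inE.
apply/andP/imsetP => [[/imsetP[v _ ->]]|[v]].
  by rewrite pushE (inj_eq jI) => e; exists v; rewrite // !inE.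
by rewrite !inE /= => e ->; rewrite inj_A pushE (inj_eq jI).
Qed.

Lemma quot_push s : mpull j (quot A M (push s)) = quot setT (mpull j M) s.
Proof.
congr (_, _); first congr (_, _, _).
- apply/setP => -[v w]; rewrite !inE /=.
  apply/exists_inP/exists_inP => [[_ /imsetP[u _ ->]]|[u _]].
    by rewrite pushE (inj_eq jI) => e; exists u; rewrite // arrow_pull.
  by rewrite arrow_pull => e; exists (j u); rewrite ?inj_A // pushE (inj_eq jI).
- apply/setP => t; rewrite !inE heads_push; congr andb.
  apply/subsetP/subsetP => h x xt.
    have : j x \in j @: heads setT s by apply: h; apply: imset_f.
    by rewrite mem_imset.
  by case/imsetP: xt => y yt ->; apply/imset_f/h.
- by apply/ffunP => v; rewrite !ffunE pick_j.
- apply/ffunP => v; rewrite [RHS]ffunE [LHS]ffunE.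
  case mv: (M.2 (j v)) => [u|].
    have := mI (inj_A v) mv; case/imsetP => z _ uz; subst u.
    have : (mpull j M).2 v == Some z by rewrite mpull_mark // mv.
    move=> /eqP->; apply/eqP; rewrite pickSome; first by rewrite ffunE mv /= pushE.
    move=> x; rewrite ffunE mv /= pushE => /eqP[] /jI e; by rewrite e.
  rewrite [in RHS]ffunE mv; case: pickP => [x|_]; first by rewrite ffunE mv.
  by case: pickP => // x; rewrite mv.
Qed.

(** The sum over contractions depends on the part A only up to isomorphism, so it may
    be computed on the vertex set of a representative. *)
Lemma subst_target (X : mspecies D) (x : fsum R X) : subst x A M = subst x setT (mpull j M).
Proof.
rewrite /subst (reindex_onto push pull) /=.
  apply: eq_big => [s|s _].
    by rewrite pushK eqxx andbT contraction_push compatible_push.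
  rewrite weight_push heads_push ev_target; last exact: jI.
  by rewrite quot_push.
move=> t /andP[/contractionP[a b c d] _]; apply/ffunP => u.
have [/imsetP[v _ ->]|uA] := boolP (u \in A); last by rewrite pushN // d.
rewrite pushE ffunE /=; have := a _ (inj_A v); case/imsetP => w _ wE.
by rewrite wE pick_j /= -wE; case: (t (j v)).
Qed.
End Transport.

(** Dividing by the symmetry factor makes the pairings of this sum equal to the values
    of subst. *)
Definition substitute (X : mspecies D) (x : fsum R X) : fsum R X :=
  fun q : isoclasses X => subst x setT (pemb q) / (sigma q)%:R.

Lemma ev_substitute_occ (X : mspecies D) (x : fsum R X) U (A : {set U}) M (p : isoclasses X) psi :
  psi \in occs (pemb p) A M -> marks_in A M.2 -> ev (substitute x) A M = subst x A M.
Proof.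
move=> h mA; rewrite (ev_class _ h) class_rep /substitute divfK; last exact: (@sigma_gt0 R D X).
case/occsP: h => psiI psiA psiM.
have mA' : marks_in (psi @: [set: _]) M.2 by rewrite psiA.
have T := subst_target psiI mA' x; rewrite psiA psiM in T.
exact: esym T.
Qed.

(** If A is not isomorphic to a structure of the species then neither is any of its
    quotients, and both sides vanish. *)
Lemma ev_substitute (X : mspecies D) (x : fsum R X) U (A : {set U}) M :
  marks_in A M.2 ->
  (forall s, contraction A M.1 s ->
     present X (heads A s) (quot A M s) -> present X A M) ->
  ev (substitute x) A M = subst x A M.
Proof.
move=> mA h; have [e|ne] := eqVneq (subst x A M) 0; last first.
  have [s /andP[sc _] ne'] : exists2 s, contraction A M.1 s && compatible A M.2 s
      & weight A M.1 s * ev x (heads A s) (quot A M s) != 0.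
    apply/exists_inP; apply: contraNT ne => /exists_inPn no; apply/eqP/big1 => s /no.
    by rewrite negbK => /eqP.
  rewrite mulf_eq0 negb_or in ne'; case/andP: ne' => _ /ev_neq0 /(h s sc)[p [psi hp]].
  exact: ev_substitute_occ hp mA.
apply/eqP; rewrite e; apply/negPn/negP => /[dup] ne /ev_neq0[p [psi hp]].
by rewrite (ev_substitute_occ _ hp mA) e eqxx in ne.
Qed.

End Substitution.

Section SubstitutionOnParts.
Variables (R : realType) (D : finType) (phi : D -> fsum R (KF D 1)).
Implicit Types (V U : finType).

Definition qgraph V (A : {set V}) (g : graph D V) (s : {ffun V -> V * D}) : graph D V :=
  (quot A (plain g) s).1.

Lemma quot_plain V (A : {set V}) (g : graph D V) (s : {ffun V -> V * D}) :
  quot A (plain g) s = plain (qgraph A g s).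
Proof. by congr (_, _); apply/ffunP => v; rewrite !ffunE. Qed.

Lemma quot_cmark V (A : {set V}) (g : graph D V) (s : {ffun V -> V * D}) v :
  quot A (g, cmark (Some v)) s = (qgraph A g s, cmark (Some (s v).1)).
Proof. by congr (_, _); apply/ffunP => u; rewrite !ffunE. Qed.

Lemma ev_substitute_k k (x : fsum R (mKF D k)) U (A : {set U}) (g : graph D U) :
  aromatic_on A g ->
  ev (substitute phi x) A (plain g) = subst phi x A (plain g).
Proof.
move=> ga; apply: ev_substitute => [v u _|s sc]; first by rewrite ffunE.
rewrite quot_plain => h; apply/(present_k k ga).
rewrite -(@roots_quot _ _ A (plain g) s) //; apply/present_k => //.
exact: (@quot_aromatic _ _ A (plain g) s).
Qed.

Lemma ev_substitute_p (x : fsum R (mPT D)) U (A : {set U}) (g : graph D U) v :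
  aromatic_on A g -> v \in A ->
  ev (substitute phi x) A (g, cmark (Some v)) = subst phi x A (g, cmark (Some v)).
Proof.
move=> ga vA; apply: ev_substitute => [w u _|s sc]; first by rewrite ffunE => -[<-].
rewrite quot_cmark => h; apply/(present_p ga vA).
rewrite -(@roots_quot _ _ A (plain g) s) //; apply/(@present_p _ _ _ _ (s v).1) => //.
- exact: (@quot_aromatic _ _ A (plain g) s).
- exact: (@head_in _ _ A (plain g) s).
Qed.

Lemma ev_substitute_c (x : fsum R (mCF D)) U (A : {set U}) (g : graph D U) m :
  aromatic_on A g -> clumping_on A g m ->
  ev (substitute phi x) A (g, m) = subst phi x A (g, m).
Proof.
move=> ga mc; apply: ev_substitute => [v u vA|s sc _]; last exact: present_c.
case: mc => cl [c1 c2 _ _ _]; rewrite c1 // => -[<-].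
by have := c2 v vA; rewrite inE => /andP[].
Qed.
End SubstitutionOnParts.

(** * Contractions along a cut *)

Section Splitting.
Variables (R : realType) (D : finType) (phi : D -> fsum R (KF D 1)).
Variables (V : finType) (g : graph D V).
Implicit Types (A W : {set V}) (s : {ffun V -> V * D}) (m : {ffun V -> option V}).

(** W is a union of blocks. *)
Definition stable A W s : bool := [forall v in A, ((s v).1 \in W) == (v \in W)].
Definition srestr W s : {ffun V -> V * D} :=
  [ffun v => if v \in W then s v else (v, deco g v)].

Lemma stableP A W s :
  reflect (forall v, v \in A -> ((s v).1 \in W) = (v \in W)) (stable A W s).
Proof. by apply: (iffP forall_inP) => h v /h => [/eqP|->]. Qed.

Lemma srestr_in W s v : v \in W -> srestr W s v = s v.
Proof. by rewrite ffunE => ->. Qed.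

Lemma heads_restr A W s : W \subset A -> heads W (srestr W s) = W :&: heads A s.
Proof.
move=> /subsetP WA; apply/setP => v; rewrite !inE.
by have [vW|] //= := boolP (v \in W); rewrite srestr_in // WA.
Qed.

(** An attached vertex has its only arrow or stolon in its block, hence in W. *)
Lemma attached_restr A W s v : aromatic_on A g -> W \subset A -> stable A W s ->
  v \in W -> attached W g (srestr W s) v = attached A g s v.
Proof.
move=> ga /subsetP WA /stableP st vW; have vA := WA v vW.
have inR w w' : w \in A -> arrow (grestr A g) v w = arrow g v w /\ tied (grestr A g) v w = tied g v w.
  by move=> wA; rewrite arrow_restr tied_restr vA wA.
apply/attachedP/attachedP => -[a b c]; split.
- move=> w wA vw; case: c => u uW /orP[] vu.
    have <- : u = w.
      by apply: (arrow_fun ga (v := v)); rewrite arrow_restr vA ?wA ?WA.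
    by have := a u uW vu; rewrite !srestr_in.
  by case: (@arrow_tied _ _ _ v w u ga); rewrite ?arrow_restr ?tied_restr vA ?wA ?WA.
- move=> w wA vw; case: c => u uW /orP[] vu.
    by case: (@arrow_tied _ _ _ v u w ga); rewrite ?arrow_restr ?tied_restr vA ?wA ?WA.
  have <- : u = w.
    by apply: (tied_fun ga (v := v)); rewrite tied_restr vA ?wA ?WA.
  by have := b u uW vu; rewrite !srestr_in.
- by case: c => w wW e; exists w; rewrite ?WA.
- by move=> w wW vw; rewrite !srestr_in //; apply: a => //; apply: WA.
- by move=> w wW vw; rewrite !srestr_in //; apply: b => //; apply: WA.
- case: c => w wA e; exists w => //; rewrite -st //.
  suff -> : (s w).1 = (s v).1 by rewrite st.
  by case/orP: e => [/(a _ wA)|/(b _ wA)[]].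
Qed.

Lemma stable_compl A W s : contraction A g s -> stable A W s -> stable A (A :\: W) s.
Proof.
case/contractionP => a _ _ _ /stableP st; apply/stableP => v vA.
by rewrite !inE a // vA st.
Qed.

Lemma contraction_restr A W s : aromatic_on A g -> W \subset A -> contraction A g s ->
  stable A W s -> contraction W g (srestr W s).
Proof.
move=> ga WA sc st; have st' := stableP _ _ _ st; case/contractionP: sc => a b c d.
have WA' := subsetP WA.
apply/contractionP; split.
- by move=> v vW; rewrite srestr_in // st' // WA'.
- by move=> v vW; rewrite !srestr_in ?b ?st' // WA'.
- move=> v vW; rewrite srestr_in // => ne.
  by rewrite (attached_restr ga WA st vW); apply: c => //; apply: WA'.
- by move=> v vW; rewrite ffunE (negbTE vW).
Qed.

Lemma contraction_glue A W s : aromatic_on A g -> W \subset A ->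
  (forall v, v \notin A -> s v = (v, deco g v)) ->
  contraction W g (srestr W s) -> contraction (A :\: W) g (srestr (A :\: W) s) ->
  contraction A g s /\ stable A W s.
Proof.
move=> ga WA dA /contractionP[a1 b1 c1 _] /contractionP[a2 b2 c2 _].
have WA' := subsetP WA.
have inB v : v \in A -> v \notin W -> v \in A :\: W by rewrite inE => -> ->.
have st : stable A W s.
  apply/stableP => v vA; have [vW|vW] := boolP (v \in W).
    by have := a1 v vW; rewrite srestr_in.
  have := a2 v (inB v vA vW); rewrite (srestr_in s (inB v vA vW)) inE => /andP[h _].
  exact: negbTE.
have st' := stableP _ _ _ st.
have aA v : v \in A -> (s v).1 \in A.
  move=> vA; have [vW|vW] := boolP (v \in W).
    by have := a1 v vW; rewrite srestr_in // => /WA'.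
  by have := a2 v (inB v vA vW); rewrite (srestr_in s (inB v vA vW)) inE => /andP[].
have stB : stable A (A :\: W) s.
  by apply/stableP => v vA; rewrite !inE aA // vA st'.
split=> //; apply/contractionP; split=> // v vA.
  have [vW|vW] := boolP (v \in W).
    by have := b1 v vW; rewrite !srestr_in // st'.
  have vB := inB v vA vW; have cB : (s v).1 \in A :\: W by apply: inB; rewrite ?aA ?st'.
  by have := b2 v vB; rewrite (srestr_in s vB) (srestr_in s cB).
move=> ne; have [vW|vW] := boolP (v \in W).
  by rewrite -(attached_restr ga WA st vW); apply: c1 => //; rewrite srestr_in.
rewrite -(attached_restr ga (subsetDl A W) stB (inB v vA vW)).
by apply: c2; rewrite ?(srestr_in s (inB v vA vW)) ?inB.
Qed.

Lemma block_restr A W s r : W \subset A -> stable A W s -> r \in W ->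
  [set v in W | (srestr W s v).1 == r] = [set v in A | (s v).1 == r].
Proof.
move=> /subsetP WA /stableP st rW; apply/setP => v; rewrite !inE.
have [vW|vW] /= := boolP (v \in W); first by rewrite srestr_in // WA.
apply/esym/negbTE/negP => /andP[vA /eqP e].
by move: (st v vA); rewrite e rW (negbTE vW).
Qed.

Lemma weight_restr A W s : W \subset A -> stable A W s ->
  weight phi W g (srestr W s) = \prod_(r in W :&: heads A s)
    ev (phi (s r).2) [set v in A | (s v).1 == r] (plain (cut r g)).
Proof.
move=> WA st; rewrite /weight (heads_restr s WA); apply: eq_bigr => r.
rewrite inE => /andP[rW _]; rewrite (block_restr WA st rW).
by rewrite srestr_in.
Qed.

Lemma weight_split A W s : W \subset A -> contraction A g s -> stable A W s ->
  weight phi A g s =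
  weight phi W g (srestr W s) * weight phi (A :\: W) g (srestr (A :\: W) s).
Proof.
move=> WA sc st; rewrite (weight_restr WA st).
rewrite (weight_restr (subsetDl A W) (stable_compl sc st)).
rewrite /weight (bigID (mem W)) /=; congr (_ * _); apply: eq_bigl => r.
  by rewrite in_setI andbC.
by rewrite !inE; case: (r \in A); case: (r \in W); case: (_ == r).
Qed.

Lemma agree_restr A W s (mu mu' : {ffun V -> option V}) :
  W \subset A -> contraction A g s -> stable A W s ->
  (forall v u, v \in W :&: heads A s -> u \in W :&: heads A s ->
     (mu v == Some u) = (mu' v == Some u)) ->
  agree (W :&: heads A s) (qgraph A g s, mu) (qgraph W g (srestr W s), mu').
Proof.
move=> WA sc /stableP st h; have WA' := subsetP WA; split=> //.
- move=> v w; rewrite !inE => /andP[vW _] /andP[wW _]; rewrite !arrow_quot.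
  apply/exists_inP/exists_inP => -[u uA /andP[/eqP e1 e2]].
    have uW : u \in W by rewrite -st // e1.
    by exists u; rewrite // srestr_in // e1 eqxx.
  by exists u; [exact: WA'|rewrite srestr_in // in e1; rewrite e1 eqxx].
- move=> t tS; rewrite !inE; congr andb; rewrite (heads_restr s WA) tS.
  by apply: subset_trans tS _; apply: subsetIr.
- by move=> v; rewrite inE => /andP[vW _]; rewrite /deco /= !ffunE vW.
Qed.

Variables (X Y : mspecies D) (x : fsum R X) (y : fsum R Y).
Variables (A : {set V}) (m : {ffun V -> option V}).
Variables (P : pred {set V}) (P' : {ffun V -> V * D} -> pred {set V}).
Variables (m1 m2 : {set V} -> {ffun V -> option V}).
Variables (m1' m2' : {ffun V -> V * D} -> {set V} -> {ffun V -> option V}).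
Hypothesis ga : aromatic_on A g.
Hypothesis HP : forall s W, contraction A g s -> compatible A m s -> W \subset A ->
  stable A W s -> P' s (W :&: heads A s) = P W.
Hypothesis Hm : forall s W, contraction A g s -> W \subset A -> stable A W s -> P W ->
  compatible A m s =
  compatible W (m1 W) (srestr W s) && compatible (A :\: W) (m2 W) (srestr (A :\: W) s).
Hypothesis H1 : forall s W, contraction A g s -> compatible A m s -> W \subset A ->
  stable A W s -> P W -> forall v u, v \in W :&: heads A s -> u \in W :&: heads A s ->
  (m1' s (W :&: heads A s) v == Some u) = (omap (fun z => (s z).1) (m1 W v) == Some u).
Hypothesis H2 : forall s W, contraction A g s -> compatible A m s -> W \subset A ->
  stable A W s -> P W ->
  forall v u, v \in (A :\: W) :&: heads A s -> u \in (A :\: W) :&: heads A s ->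
  (m2' s (W :&: heads A s) v == Some u) = (omap (fun z => (s z).1) (m2 W v) == Some u).
Hypothesis M1 : forall W, W \subset A -> P W -> marks_in W (m1 W).
Hypothesis M2 : forall W, W \subset A -> P W -> marks_in (A :\: W) (m2 W).

(** The heart of the existence proof. A subset of the quotient is the same thing as a
    union of blocks W, and a contraction for which W is a union of blocks is a pair
    of contractions of W and of the rest; hence contracting and then cutting is the
    same as cutting and then contracting both sides. The hypotheses express that
    the conditions P' and marks m1', m2' used after contraction come from the
    conditions P and marks m1, m2 used before. *)
Lemma subst_cut :
  \sum_(s : {ffun V -> V * D} | contraction A g s && compatible A m s)
     weight phi A g s * \sum_(W : {set V} | (W \subset heads A s) && P' s W)
        ev x W (qgraph A g s, m1' s W) * ev y (heads A s :\: W) (qgraph A g s, m2' s W)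
  = \sum_(W : {set V} | (W \subset A) && P W)
        subst phi x W (g, m1 W) * subst phi y (A :\: W) (g, m2 W).
Proof.
pose F s W : R := weight phi A g s *
   (ev x (W :&: heads A s) (qgraph A g s, m1' s (W :&: heads A s))
    * ev y (heads A s :\: (W :&: heads A s)) (qgraph A g s, m2' s (W :&: heads A s))).
transitivity (\sum_(s : {ffun V -> V * D} | contraction A g s && compatible A m s)
   \sum_(W : {set V} | (W \subset A) && P W && stable A W s) F s W).
  apply: eq_bigr => s /andP[sc smc]; rewrite mulr_sumr.
  have /contractionP[c1 c2 c3 c4] := sc.
  pose k (W' : {set V}) := [set v in A | (s v).1 \in W'].
  rewrite (reindex_onto (fun W : {set V} => W :&: heads A s) k) /=; last first.
    move=> W' /andP[/subsetP W'h _]; apply/setP => v; rewrite !inE.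
    apply/andP/idP => [[/andP[_ h] /andP[_ /eqP e]]|vW']; first by rewrite -e.
    by have := W'h v vW'; rewrite inE => /andP[vA /eqP e]; rewrite vA e vW' eqxx.
  apply: eq_bigl => W; rewrite subsetIr /=.
  have [/andP[WA st]|no] := boolP ((W \subset A) && stable A W s).
    rewrite HP // WA st /= andbT andb_idr // => _.
    apply/eqP/setP => v; rewrite !inE; have [vA|vA] /= := boolP (v \in A).
      by rewrite c1 // c2 // eqxx !andbT (stableP _ _ _ st v vA).
    by apply/esym/negbTE; apply: contra vA => /(subsetP WA).
  transitivity false.
    apply/negbTE; apply: contra no => /andP[_ /eqP kE].
    have inW v : (v \in W) = (v \in A) && ((s v).1 \in W).
      rewrite -{1}kE !inE; have [vA|] //= := boolP (v \in A).
      by rewrite c1 // c2 // eqxx !andbT.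
    apply/andP; split; first by apply/subsetP => v; rewrite inW => /andP[].
    by apply/stableP => v vA; rewrite [RHS]inW vA.
  by apply/esym/negbTE; apply: contra no => /andP[/andP[-> _] ->].
rewrite (exchange_big_dep (fun W : {set V} => (W \subset A) && P W)) /=; last first.
  by move=> s W _ /andP[].
apply: eq_bigr => W /andP[WA PW]; rewrite /subst /= big_distrlr /= pair_big /=.
pose split s := (srestr W s, srestr (A :\: W) s).
pose merge (t : {ffun V -> V * D} * {ffun V -> V * D}) : {ffun V -> V * D} :=
  [ffun v => if v \in W then t.1 v else t.2 v].
rewrite (reindex_onto split merge) /=; last first.
  move=> [s1 s2] /andP[/andP[/contractionP[_ _ _ d1] _] /andP[/contractionP[_ _ _ d2] _]].
  congr (_, _); apply/ffunP => v; rewrite !ffunE.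
    by have [vW|vW] /= := boolP (v \in W); last by rewrite d1.
  have [vB|vB] := boolP (v \in A :\: W); last by rewrite d2.
  by move: vB; rewrite inE => /andP[/negbTE-> _].
apply: eq_big => [s|s /andP[/andP[sc smc] /andP[_ st]]].
  rewrite WA PW /=; apply/idP/idP.
    case/andP=> /andP[sc smc] st.
    rewrite (contraction_restr ga WA sc st).
    rewrite (contraction_restr ga (subsetDl A W) sc (stable_compl sc st)).
    rewrite /= -(Hm sc WA st PW) smc /=; apply/eqP/ffunP => v; rewrite !ffunE.
    case: (boolP (v \in W)) => vW //=; rewrite inE vW /=.
    by case: ifPn => // vA; case/contractionP: sc => _ _ _ ->.
  case/andP=> /andP[/andP[c1 m1c] /andP[c2 m2c]] /eqP sE.
  have dA v : v \notin A -> s v = (v, deco g v).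
    move=> vA; have vW : v \notin W by apply: contra vA; apply: (subsetP WA).
    by rewrite -sE !ffunE (negbTE vW) inE (negbTE vA) andbF.
  have [sc st] := contraction_glue ga WA dA c1 c2.
  by rewrite sc st (Hm sc WA st PW) m1c m2c.
have stB := stable_compl sc st.
rewrite /F (weight_split WA sc st) mulrACA; congr (_ * _ * (_ * _)).
  rewrite (heads_restr s WA); apply: ev_agree.
  have h := agree_restr (mu := m1' s (W :&: heads A s))
     (mu' := (quot W (g, m1 W) (srestr W s)).2) WA sc st.
  apply: h => v u vW uW; rewrite (H1 sc smc WA st PW vW uW) [in RHS]ffunE /=.
  case mv: (m1 W v) => [z|] //=; rewrite srestr_in //.
  by apply: (M1 WA PW) mv; move: vW; rewrite inE => /andP[].
have hE : heads A s :\: (W :&: heads A s) = (A :\: W) :&: heads A s.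
  by apply/setP => v; rewrite !inE; case: (v \in A); case: (v \in W); case: (_ == v).
rewrite (heads_restr s (subsetDl A W)) hE; apply: ev_agree.
have h := agree_restr (mu := m2' s (W :&: heads A s))
     (mu' := (quot (A :\: W) (g, m2 W) (srestr (A :\: W) s)).2) (subsetDl A W) sc stB.
apply: h => v u vW uW; rewrite (H2 sc smc WA st PW vW uW) [in RHS]ffunE /=.
case mv: (m2 W v) => [z|] //=; rewrite srestr_in //.
by apply: (M2 WA PW) mv; move: vW; rewrite inE => /andP[].
Qed.
End Splitting.

(** * Substitution commutes with cuts *)

Section QuotientCuts.
Variables (D V : finType) (g : graph D V) (A : {set V}) (s : {ffun V -> V * D}).
Hypotheses (ga : aromatic_on A g) (sc : contraction A g s).
Implicit Types W : {set V}.
Let Q := qgraph A g s.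
Let sc' : contraction A (plain g).1 s := sc.

(** An arrow between two unions of blocks leaves its block, so it starts at a head and
    survives in the quotient. *)
Lemma crossing_quot W1 W2 : W1 \subset A -> W2 \subset A -> stable A W1 s -> stable A W2 s ->
  [disjoint W1 & W2] -> crossing (W1 :&: heads A s) (W2 :&: heads A s) Q = crossing W1 W2 g.
Proof.
move=> /subsetP s1 /subsetP s2 /stableP t1 /stableP t2 dis.
have /contractionP[c1 c2 c3 c4] := sc.
have dis' v : v \in W1 -> v \in W2 -> False.
  by move=> v1 v2; have /pred0P/(_ v) := dis; rewrite /= v1 v2.
apply/setP => v; rewrite !inE; apply/andP/andP.
  case=> /andP[vW /andP[vA vh]] /exists_inP[w]; rewrite inE => /andP[wW wh].
  rewrite arrow_quot => /exists_inP[u uA /andP[/eqP uw e]]; split=> //.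
  by apply/exists_inP; exists u => //; rewrite -t2 // uw.
case=> vW /exists_inP[u uW e]; have vA := s1 v vW; have uA := s2 u uW.
have vh : (s v).1 == v.
  apply/negPn/negP => /eqP ne; have /attachedP[h _ _] := c3 v vA ne.
  by apply: (dis' (s v).1); [rewrite t1|rewrite -(h u uA e) t2].
split; first by rewrite vW vA.
apply/exists_inP; exists (s u).1.
  by rewrite in_setI t2 // uW; apply: (head_in sc').
by rewrite arrow_quot; apply/exists_inP; exists u; rewrite // eqxx.
Qed.

(** A stolon between two blocks joins their roots. *)
Lemma bonded_quot W1 W2 : W1 \subset A -> W2 \subset A -> stable A W1 s -> stable A W2 s ->
  [disjoint W1 & W2] -> bonded (W1 :&: heads A s) (W2 :&: heads A s) Q = bonded W1 W2 g.
Proof.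
move=> /subsetP s1 /subsetP s2 /stableP t1 /stableP t2 dis.
have /contractionP[c1 c2 c3 c4] := sc.
have dis' v : v \in W1 -> v \in W2 -> False.
  by move=> v1 v2; have /pred0P/(_ v) := dis; rewrite /= v1 v2.
apply/setP => v; rewrite !inE; apply/andP/andP.
  case=> /andP[vW _] /exists_inP[w]; rewrite inE => /andP[wW _].
  by rewrite tied_quot => /and3P[_ _ e]; split=> //; apply/exists_inP; exists w.
case=> vW /exists_inP[u uW e]; have vA := s1 v vW; have uA := s2 u uW.
have vh : (s v).1 == v.
  apply/negPn/negP => /eqP ne; have /attachedP[_ h _] := c3 v vA ne.
  have [_ h'] := h u uA e.
  by apply: (dis' (s v).1); [rewrite t1|rewrite -h' t2].
have uh : (s u).1 == u.
  apply/negPn/negP => /eqP ne; have /attachedP[_ h _] := c3 u uA ne.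
  rewrite tied_sym in e; have [_ h'] := h v vA e.
  by apply: (dis' (s u).1); [rewrite -h' t1|rewrite t2].
split; first by rewrite vW vA.
apply/exists_inP; exists u; first by rewrite !inE uW uA.
by rewrite tied_quot !inE vA vh uA uh.
Qed.

Lemma headsD W : heads A s :\: (W :&: heads A s) = (A :\: W) :&: heads A s.
Proof. by apply/setP => v; rewrite !inE; case: (v \in A); case: (v \in W); case: (_ == v). Qed.

Lemma disjointD W : [disjoint W & A :\: W].
Proof. by apply/pred0P => v /=; rewrite inE; case: (v \in W). Qed.

Lemma cut_type_quot i j W : W \subset A -> stable A W s ->
  cut_type i j (W :&: heads A s) (heads A s :\: (W :&: heads A s)) Q
  = cut_type i j W (A :\: W) g.
Proof.
move=> WA st; have stB := stable_compl sc st; have BA := subsetDl A W.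
rewrite /cut_type headsD !crossing_quot ?bonded_quot //; try exact: disjointD.
by rewrite disjoint_sym; apply: disjointD.
Qed.

Lemma target_quot W : W \subset A -> stable A W s -> cut_type 1 0 W (A :\: W) g ->
  target (W :&: heads A s) (heads A s :\: (W :&: heads A s)) Q
  = omap (fun z => (s z).1) (target W (A :\: W) g).
Proof.
move=> WA st ct; have stB := stable_compl sc st; have BA := subsetDl A W.
have ct' := ct; rewrite -(cut_type_quot _ _ WA st) in ct'.
have /and3P[_ c1 _] := ct; have /and3P[_ c1' _] := ct'.
have /cards1P[v vE] := c1.
have : v \in crossing W (A :\: W) g by rewrite vE inE.
rewrite inE => /andP[vW /exists_inP[w wB vw]].
have vh : v \in heads A s.
  have : v \in crossing (W :&: heads A s) ((A :\: W) :&: heads A s) Q.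
    by rewrite crossing_quot ?disjointD // vE inE.
  by rewrite inE => /andP[]; rewrite inE => /andP[].
have wA : w \in A := subsetP BA w wB.
have -> : target W (A :\: W) g = Some w.
  apply/eqP/targetP; [|exact/eqP|by split=> //; exists v].
  by apply: aromatic_on_sub ga; rewrite subUset WA.
apply/eqP/targetP; [|exact/eqP|].
  apply: aromatic_on_sub (quot_aromatic (M := plain g) ga sc).
  by rewrite subUset subsetIr subsetDl.
split; first by rewrite headsD in_setI (stableP _ _ _ stB) // wB; apply: (head_in sc').
exists v; first by rewrite inE vW.
by rewrite arrow_quot; apply/exists_inP; exists w; rewrite // eqxx.
Qed.
End QuotientCuts.

Section Commutation.
Variables (R : realType) (D : finType) (phi : D -> fsum R (KF D 1)).
Implicit Types (V U : finType).
Local Notation Sub := (substitute phi).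

Lemma compatible_cmark V (A : {set V}) o (s : {ffun V -> V * D}) : compatible A (cmark o) s.
Proof. by apply/forall_inP => v _; rewrite !ffunE. Qed.

Lemma subst_cut_plain (X Y : mspecies D) (x : fsum R X) (y : fsum R Y)
    V (A : {set V}) (g : graph D V) i j : aromatic_on A g ->
  \sum_(s : {ffun V -> V * D} | contraction A g s && compatible A (cmark None) s)
    weight phi A g s * \sum_(W : {set V} | (W \subset heads A s)
         && cut_type i j W (heads A s :\: W) (qgraph A g s))
      ev x W (plain (qgraph A g s)) * ev y (heads A s :\: W) (plain (qgraph A g s))
  = \sum_(W : {set V} | (W \subset A) && cut_type i j W (A :\: W) g)
      subst phi x W (plain g) * subst phi y (A :\: W) (plain g).
Proof.
move=> ga; apply: (@subst_cut R D phi V g X Y x y A (cmark None)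
  (fun W : {set V} => cut_type i j W (A :\: W) g)
  (fun s (W : {set V}) => cut_type i j W (heads A s :\: W) (qgraph A g s))
  (fun=> cmark None) (fun=> cmark None) (fun _ _ => cmark None) (fun _ _ => cmark None)) => //.
- by move=> s W sc _ WA st; apply: cut_type_quot.
- by move=> s W *; rewrite !compatible_cmark.
- by move=> s W *; rewrite !ffunE.
- by move=> s W *; rewrite !ffunE.
- by move=> W _ _ v u _; rewrite ffunE.
- by move=> W _ _ v u _; rewrite ffunE.
Qed.

Lemma ev_substitute_rep k (x : fsum R (mKF D k)) (p : isoclasses (mKF D k)) :
  ev (Sub x) [set: _] (pemb p) = subst phi x setT (plain (val (rep p : kforest D k _))).
Proof. exact: (ev_substitute_k phi x (aromatic_onT (kforest_aromatic (rep p : kforest D k _)))). Qed.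

(** Products, grafting and stolons differ only by the type of their cuts. *)
Lemma substitute_cut k1 k2 k i j
    (op : fsum R (KF D k1) -> fsum R (KF D k2) -> fsum R (KF D k)) :
  (forall x y U (A : {set U}) g, aromatic_on A g -> ev (op x y) A (plain g) =
     \sum_(W : {set U} | (W \subset A) && cut_type i j W (A :\: W) g)
       ev x W (plain g) * ev y (A :\: W) (plain g)) ->
  forall x y, Sub (op x y) = op (Sub x) (Sub y).
Proof.
move=> opE x y; apply: (@ev_ext R D (mKF D k)) => p; rewrite ev_substitute_rep.
set g := val _; have ga : aromatic_on setT g := aromatic_onT (kforest_aromatic _).
rewrite -[pemb p]/(plain g) opE //.
transitivity (\sum_(W : {set 'I_(size_of p)} | (W \subset setT) && cut_type i j W (setT :\: W) g)
   subst phi x W (plain g) * subst phi y (setT :\: W) (plain g)); last first.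
  apply: eq_bigr => W _; rewrite -!ev_substitute_k //; apply: aromatic_on_sub ga; exact: subsetT.
rewrite -subst_cut_plain //; apply: eq_bigr => s /andP[sc _]; congr (_ * _).
rewrite quot_plain opE //; exact: (quot_aromatic (M := plain g) ga sc).
Qed.

Lemma substitute_kprod k j (x : fsum R (KF D k)) (y : fsum R (KF D j)) :
  Sub (lift2 (@kprod D k j) x y) = lift2 (@kprod D k j) (Sub x) (Sub y).
Proof. exact: (substitute_cut (@ev_kprod R D k j)). Qed.

Lemma substitute_graft k (x : fsum R (KF D 1)) (y : fsum R (KF D k)) :
  Sub (lift2 (@graft D k) x y) = lift2 (@graft D k) (Sub x) (Sub y).
Proof. exact: (substitute_cut (@ev_graft R D k)). Qed.

Lemma substitute_stolon (x y : fsum R (KF D 1)) :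
  Sub (lift2 (@stolon D) x y) = lift2 (@stolon D) (Sub x) (Sub y).
Proof. exact: (substitute_cut (@ev_stolon R D)). Qed.

Lemma ev_substitute_rep_p (x : fsum R (mPT D)) (p : isoclasses (mPT D)) :
  ev (Sub x) [set: _] (pemb p) = subst phi x setT (pemb p).
Proof.
exact: (ev_substitute_p phi x (aromatic_onT (kforest_aromatic (rep p : kforest D 1 _ * _)%type.1))).
Qed.

(** As for grafting, with marks: the mark of the rest is the target of the cut, and
    contraction sends the target to the target. *)
Lemma substitute_compose (x y : fsum R (mPT D)) :
  substitute phi (lift2 (@compose D) x y) = lift2 (@compose D) (Sub x) (Sub y).
Proof.
apply: (@ev_ext R D (mPT D)) => p; rewrite ev_substitute_rep_p.
set g := val (rep p : kforest D 1 _ * _)%type.1; set v := (rep p : kforest D 1 _ * _)%type.2.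
have ga : aromatic_on setT g := aromatic_onT (kforest_aromatic _).
rewrite -[pemb p]/(g, cmark (Some v)) ev_compose //.
pose P (W : {set 'I_(size_of p)}) := cut_type 1 0 W (setT :\: W) g && (v \in W).
have tin (W : {set 'I_(size_of p)}) : P W -> exists2 w, w \in setT :\: W & target W (setT :\: W) g = Some w.
  case/andP=> /and3P[_ c _] _; have ga' : aromatic_on (W :|: (setT :\: W)) g.
    by apply: aromatic_on_sub ga; apply: subsetT.
  have /cards1P[u uE] := c; have : u \in crossing W (setT :\: W) g by rewrite uE inE.
  rewrite inE => /andP[uW /exists_inP[w wB uw]]; exists w => //; apply/eqP/targetP => //.
    exact/eqP.
  by split=> //; exists u.
transitivity (\sum_(W : {set 'I_(size_of p)} | (W \subset setT) && P W)
   subst phi y W (g, cmark (Some v)) * subst phi x (setT :\: W) (g, cmark (target W (setT :\: W) g))); last first.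
  apply: eq_bigr => W /andP[_ PW]; have [w wB wE] := tin W PW.
  have /andP[_ vW] := PW.
  by rewrite wE -!ev_substitute_p //; apply: aromatic_on_sub ga; exact: subsetT.
rewrite -(@subst_cut R D phi _ g (mPT D) (mPT D) y x setT (cmark (Some v)) P
  (fun s (W : {set _}) => cut_type 1 0 W (heads setT s :\: W) (qgraph setT g s) && ((s v).1 \in W))
  (fun=> cmark (Some v)) (fun W => cmark (target W (setT :\: W) g))
  (fun s _ => cmark (Some (s v).1))
  (fun s W => cmark (target W (heads setT s :\: W) (qgraph setT g s)))) //.
- apply: eq_bigr => s /andP[sc _]; congr (_ * _).
  rewrite quot_cmark ev_compose //; exact: (quot_aromatic (M := plain g) ga sc).
- move=> s W sc _ WA st; rewrite cut_type_quot // /P in_setI; congr andb.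
  rewrite (stableP _ _ _ st v (in_setT v)) andb_idr // => _.
  exact: (head_in (M := plain g) sc (in_setT v)).
- by move=> s W *; rewrite !compatible_cmark.
- by move=> s W *; rewrite !ffunE.
- move=> s W sc _ WA st /andP[PW _] u w _ _.
  by rewrite [cmark _ u]ffunE target_quot // ffunE.
- by move=> W _ /andP[_ vW] u w _; rewrite ffunE => -[<-].
- by move=> W _ /tin[w wB ->] u z _; rewrite ffunE => -[<-].
Qed.

Lemma substitute_mark (x : fsum R (mKF D 1)) :
  substitute phi (lift1 (@mark D) x) = lift1 (@mark D) (Sub x).
Proof.
apply: (@ev_ext R D (mPT D)) => p; rewrite ev_substitute_rep_p.
set g := val (rep p : kforest D 1 _ * _)%type.1; set v := (rep p : kforest D 1 _ * _)%type.2.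
have ga : aromatic_on setT g := aromatic_onT (kforest_aromatic _).
rewrite -[pemb p]/(g, cmark (Some v)) ev_mark ?inE // ev_substitute_k //.
rewrite /subst /=; apply: eq_big => [s|s /andP[sc _]]; first by rewrite !compatible_cmark.
rewrite quot_cmark quot_plain ev_mark //.
exact: (head_in (M := plain g) sc (in_setT v)).
Qed.
End Commutation.

(** * Substitution commutes with clumped products and traces *)

Lemma sum_transfer (R : nmodType) (I : finType) (P Q : pred I) (h h' : I -> I) (F G : I -> R) :
  (forall e, P e -> h (h' e) = e) -> (forall e, P (h e) && (h' (h e) == e) = Q e) ->
  (forall e, P e -> F e = G (h' e)) -> \sum_(e | P e) F e = \sum_(e | Q e) G e.
Proof.
move=> hK PQ FG; rewrite (reindex_onto h h') //=; apply: eq_big => // e.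
by case/andP=> Pe /eqP he; rewrite (FG _ Pe) he.
Qed.

Section Clumps.
Variables (D : finType).
Implicit Types (V U : finType).

Lemma roots_on_closed V (A B : {set V}) (g : graph D V) : aromatic_on A g -> B \subset A ->
  (forall v w, v \in B -> w \in A -> arrow g v w || tied g v w -> w \in B) ->
  roots_on B g = B :&: roots_on A g.
Proof.
move=> ga /subsetP BA cl; apply/setP => v; rewrite !inE.
have [vB|] //= := boolP (v \in B); rewrite BA //=.
apply/forall_inP/forall_inP => h w wA; last exact/h/BA.
have [wB|wB] := boolP (w \in B); first exact: h.
by rewrite -negb_or; apply: contra wB; apply: cl.
Qed.

(** No arrow or stolon joins W to its complement, so both parts keep their roots and
    their clumps. *)
Lemma clumping_on_sub V (A W : {set V}) (g : graph D V) m : aromatic_on A g ->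
  clumping_on A g m -> W \subset A -> cut_type 0 0 W (A :\: W) g -> saturated A W m ->
  clumping_on W g m /\ clumping_on (A :\: W) g m.
Proof.
move=> ga [cl [c1 c2 c3 c4 c5]] WA /and3P[/eqP/setP x1]; rewrite !cards_eq0.
move=> /eqP/setP x2 /eqP/setP x3 /forall_inP sat.
have WA' := subsetP WA; have BA' := subsetP (subsetDl A W).
have clA v : v \in A -> cl v \in A by move=> /c2; rewrite inE => /andP[].
have satE v : v \in A -> (cl v \in W) = (v \in W).
  move=> vA; have /forall_inP/(_ (cl v) (clA v vA)) := sat v vA.
  by rewrite c1 // eqxx => /eqP.
have no1 v w : v \in W -> w \in A :\: W -> arrow g v w || tied g v w = false.
  move=> vW wB; apply/negbTE; rewrite negb_or; apply/andP; split; apply/negP => e.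
    by have := x2 v; rewrite !inE vW /= => /exists_inP; apply; exists w.
  by have := x3 v; rewrite !inE vW /= => /exists_inP; apply; exists w.
have no2 v w : v \in A :\: W -> w \in W -> arrow g v w || tied g v w = false.
  move=> vB wW; apply/negbTE; rewrite negb_or; apply/andP; split; apply/negP => e.
    have : v \in crossing (A :\: W) W g by rewrite inE vB; apply/exists_inP; exists w.
    by rewrite x1 inE.
  by have := no1 w v wW vB; rewrite tied_sym e orbT.
have rW : roots_on W g = W :&: roots_on A g.
  apply: roots_on_closed => // v w vW wA e; apply: contraT => wW.
  by rewrite no1 ?inE ?wW in e.
have rB : roots_on (A :\: W) g = (A :\: W) :&: roots_on A g.
  apply: roots_on_closed => //; first exact: subsetDl.
  move=> v w vB wA e; rewrite inE wA andbT; apply/negP => wW.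
  by rewrite no2 in e.
split; exists cl; split.
- by move=> v /WA'/c1.
- by move=> v vW; rewrite rW inE satE ?WA' // vW c2 ?WA'.
- by move=> v; rewrite rW inE => /andP[_ /c3].
- by move=> v w vW wW; apply: c4; apply: WA'.
- by move=> v w vW wW; apply: c5; apply: WA'.
- by move=> v /BA'/c1.
- move=> v vB; have vA := BA' v vB; rewrite rB in_setI in_setD c2 // satE // clA //.
  by move: vB; rewrite inE => /andP[->].
- by move=> v; rewrite rB inE => /andP[_ /c3].
- by move=> v w vW wW; apply: c4; apply: BA'.
- by move=> v w vW wW; apply: c5; apply: BA'.
Qed.

Lemma clumping_on_rep n (c : cforest D 'I_n) :
  clumping_on setT (forget c) (mg_c c).2.
Proof.
have ca := cforest_aromatic c; have /clumpingP[h1 h2 h3 h4] := cforest_clumping c.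
have rE := roots_onT ca.
exists (clump c); split.
- by move=> v _; rewrite ffunE.
- by move=> v _; rewrite rE.
- by move=> v; rewrite rE => /h2.
- by move=> v w _ _; apply: h3.
- by move=> v w _ _ /andP[_ sS]; apply: (h4 _ _ _ sS); rewrite !inE eqxx ?orbT.
Qed.

Section Quotient.
Variables (V : finType) (A : {set V}) (g : graph D V) (m : {ffun V -> option V}).
Variables (s : {ffun V -> V * D}) (cl : V -> V).
Hypotheses (ga : aromatic_on A g) (sc : contraction A g s).
Hypothesis c1 : forall v, v \in A -> m v = Some (cl v).
Hypothesis c2 : forall v, v \in A -> cl v \in roots_on A g.

Lemma clump_head v : v \in A -> (s (cl v)).1 = cl v.
Proof.
move=> vA; have := roots_heads (M := plain g) sc (c2 vA).
by move/headsP=> [].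
Qed.

Lemma quot_mark v : v \in A -> (quot A (g, m) s).2 v = Some (cl v).
Proof. by move=> vA; rewrite ffunE c1 //= clump_head. Qed.

Lemma compatibleP : reflect (forall v, v \in A -> cl (s v).1 = cl v) (compatible A m s).
Proof.
have /contractionP[a _ _ _] := sc.
apply: (iffP forall_inP) => h v vA; have := h v vA; rewrite !c1 ?a //; last by move->.
by move/eqP => [].
Qed.
End Quotient.

Lemma clumping_quot V (A : {set V}) (g : graph D V) m s : aromatic_on A g ->
  contraction A g s -> compatible A m s -> clumping_on A g m ->
  clumping_on (heads A s) (qgraph A g s) (quot A (g, m) s).2.
Proof.
move=> ga sc cm [cl [c1 c2 c3 c4 c5]]; have hA := subsetP (heads_sub A s).
have rE : roots_on (heads A s) (qgraph A g s) = roots_on A g := roots_quot (M := plain g) sc.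
have h := compatibleP sc c1 cm.
exists cl; split.
- by move=> v /hA vA; rewrite (quot_mark sc c1 c2).
- by move=> v /hA vA; rewrite rE c2.
- by move=> v; rewrite rE => /c3.
- move=> v w /hA vA _; rewrite arrow_quot => /exists_inP[u uA /andP[/eqP <- e]].
  by rewrite (h u uA); apply: c4.
- by move=> v w /hA vA /hA wA; rewrite tied_quot => /and3P[_ _]; apply: c5.
Qed.
End Clumps.

Section Commutation.
Variables (R : realType) (D : finType) (phi : D -> fsum R (KF D 1)).
Implicit Types (V U : finType).
Local Notation Sub := (substitute phi).

Lemma ev_substitute_rep_c (x : fsum R (mCF D)) (p : isoclasses (mCF D)) :
  ev (Sub x) [set: _] (pemb p) = subst phi x setT (pemb p).
Proof.
exact: (ev_substitute_c phi x (aromatic_onT (cforest_aromatic (rep p : cforest D _)))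
         (clumping_on_rep _)).
Qed.

Lemma substitute_cprod (x y : fsum R (mCF D)) :
  substitute phi (lift2 (@cprod D) x y) = lift2 (@cprod D) (Sub x) (Sub y).
Proof.
apply: (@ev_ext R D (mCF D)) => p; rewrite ev_substitute_rep_c.
pose g := forget (rep p : cforest D _); pose m := (mg_c (rep p : cforest D _)).2.
have ME : pemb p = (g, m) by [].
have ga : aromatic_on setT g := aromatic_onT (cforest_aromatic (rep p : cforest D _)).
have mc : clumping_on setT g m := clumping_on_rep _.
rewrite ME ev_cprod //.
pose P (W : {set 'I_(size_of p)}) := cut_type 0 0 W (setT :\: W) g && saturated setT W m.
transitivity (\sum_(W : {set 'I_(size_of p)} | (W \subset setT) && P W)
   subst phi x W (g, m) * subst phi y (setT :\: W) (g, m)); last first.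
  apply: eq_bigr => W /andP[WA /andP[P1 P2]].
  have [mW mB] := clumping_on_sub ga mc WA P1 P2.
  by rewrite -!ev_substitute_c //; apply: aromatic_on_sub ga; exact: subsetT.
case: (mc) => cl [c1 c2 c3 _ _].
have clE s v : contraction setT g s -> (quot setT (g, m) s).2 v = Some (cl v).
  by move=> sc; rewrite (quot_mark sc c1 c2) ?inE.
rewrite -(@subst_cut R D phi _ g (mCF D) (mCF D) x y setT m P
  (fun s (W : {set _}) => cut_type 0 0 W (heads setT s :\: W) (qgraph setT g s)
     && saturated (heads setT s) W (quot setT (g, m) s).2)
  (fun=> m) (fun=> m)
  (fun s _ => (quot setT (g, m) s).2) (fun s _ => (quot setT (g, m) s).2)) //.
- apply: eq_bigr => s /andP[sc _]; congr (_ * _).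
  rewrite [quot _ _ _](_ : _ = (qgraph setT g s, (quot setT (g, m) s).2)) // ev_cprod //.
  exact: (quot_aromatic (M := plain g) ga sc).
- move=> s W sc cm WA st; rewrite cut_type_quot // /P; congr andb.
  have cmE := compatibleP sc c1 cm; have st' := stableP _ _ _ st.
  apply/forall_inP/forall_inP => h v vA; apply/forall_inP => w wA; apply/implyP.
    rewrite c1 // => /eqP[wE].
    have ch := head_in (M := plain g) sc (in_setT v).
    have wh : w \in heads setT s by rewrite -wE; apply: (roots_heads (M := plain g) sc); apply: c2.
    have /forall_inP/(_ w wh) := h _ ch; rewrite clE // cmE // wE eqxx /= !in_setI.
    by rewrite wh ch !andbT st'.
  rewrite clE // => /eqP[wE]; have /forall_inP/(_ w (in_setT w)) := h v (in_setT v).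
  by rewrite c1 ?in_setT // wE eqxx /= !in_setI vA wA !andbT.
- move=> s W sc WA st _; apply/forall_inP/andP => [h|[/forall_inP h1 /forall_inP h2] v _].
    split; apply/forall_inP => v vW; rewrite srestr_in //; exact: h.
  have [vW|vW] := boolP (v \in W); first by have := h1 v vW; rewrite srestr_in.
  by have := h2 v; rewrite !inE vW srestr_in ?inE ?vW //; apply.
- by move=> s W sc *; rewrite ffunE.
- by move=> s W sc *; rewrite ffunE.
- move=> W WA /andP[P1 P2]; have [[cl' [d1 d2 _ _ _]] _] := clumping_on_sub ga mc WA P1 P2.
  by move=> v u vW; rewrite d1 // => -[<-]; have := d2 v vW; rewrite inE => /andP[].
- move=> W WA /andP[P1 P2]; have [_ [cl' [d1 d2 _ _ _]]] := clumping_on_sub ga mc WA P1 P2.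
  by move=> v u vW; rewrite d1 // => -[<-]; have := d2 v vW; rewrite inE => /andP[].
Qed.

(** A contraction that mixes clumps has a quotient with several roots, on which a sum
    of trees vanishes. *)
Lemma substitute_tree (x : fsum R (mKF D 1)) :
  substitute phi (lift1 (@tree D) x) = lift1 (@tree D) (Sub x).
Proof.
apply: (@ev_ext R D (mCF D)) => p; rewrite ev_substitute_rep_c.
pose g := forget (rep p : cforest D _); pose m := (mg_c (rep p : cforest D _)).2.
have ME : pemb p = (g, m) by [].
have ga : aromatic_on setT g := aromatic_onT (cforest_aromatic (rep p : cforest D _)).
have mc : clumping_on setT g m := clumping_on_rep _.
rewrite ME ev_tree // ev_substitute_k // /subst /= big_mkcondr /=.
rewrite [RHS]big_mkcondr /=; apply: eq_bigr => s sc; rewrite compatible_cmark quot_plain.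
have qa := quot_aromatic (M := plain g) ga sc.
case: ifPn => cm.
  rewrite [quot _ _ _](_ : _ = (qgraph setT g s, (quot setT (g, m) s).2)) // ev_tree //.
  exact: clumping_quot.
have [->|ne] := eqVneq (ev x (heads setT s) (plain (qgraph setT g s))) 0; first by rewrite mulr0.
case/negP: cm; have /present_k := ev_neq0 ne => /(_ qa).
rewrite (roots_quot (M := plain g) sc) => /eqP/cards1P[r rE].
case: mc => cl [c1 c2 _ _ _]; apply/(compatibleP sc c1) => v _.
have := c2 v (in_setT _); have := c2 (s v).1 (in_setT _).
by rewrite -[g]/(plain g).1 rE !inE => /eqP-> /eqP->.
Qed.

Lemma cut_aromatic_on V (A : {set V}) (g : graph D V) r :
  aromatic_on A g -> aromatic_on A (cut r g).
Proof.
by apply: sub_aromatic; apply/subsetP => e; rewrite !inE => /andP[/andP[-> _] ->].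
Qed.

Section Trace.
Variables (V : finType) (A : {set V}) (g : graph D V) (s : {ffun V -> V * D}) (r w : V).
Hypotheses (ga : aromatic_on A g) (rA : r \in A) (wA : w \in A) (rw : arrow g r w).

Lemma tied_off u : u \in A -> tied g r u = false.
Proof.
move=> uA; apply/negP => ru; apply: (@arrow_tied _ _ _ r w u ga).
  by rewrite arrow_restr rA wA.
by rewrite tied_restr rA uA.
Qed.

(** Removing the arrow of r forces r to be the root of its block and changes nothing
    else, as r has no stolon. *)
Lemma contraction_cut : contraction A (cut r g) s = contraction A g s && (r \in heads A s).
Proof.
have att v : v \in A -> v != r -> attached A (cut r g) s v = attached A g s v.
  move=> vA vr.
  have aE u : arrow (cut r g) v u = arrow g v u by rewrite arrow_cut vr.
  have tE u : u \in A -> tied (cut r g) v u = tied g v u.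
    move=> uA; rewrite tied_cut vr /=; have [->|//] := eqVneq u r.
    by rewrite tied_sym tied_off.
  apply/attachedP/attachedP => -[a b [u uA c]]; split.
  - by move=> x xA; rewrite -aE; apply: a.
  - by move=> x xA; rewrite -tE //; apply: b.
  - by exists u; rewrite // -aE -tE.
  - by move=> x xA; rewrite aE; apply: a.
  - by move=> x xA; rewrite tE //; apply: b.
  - by exists u; rewrite // aE tE.
apply/idP/andP => [sc|[sc rh]]; have /contractionP[a b c d] := sc.
  have rh : r \in heads A s.
    apply/headsP; split=> //; apply/eqP/negPn/negP => /eqP ne.
    have /attachedP[_ _ [u uA]] := c r rA ne.
    by rewrite arrow_cut tied_cut eqxx.
  split=> //; apply/contractionP; split=> // v vA ne; rewrite -att //; first exact: c.
  by apply/eqP => vr; apply: ne; rewrite vr; case/headsP: rh.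
apply/contractionP; split=> // v vA ne; rewrite att //; first exact: c.
by apply/eqP => vr; apply: ne; rewrite vr; case/headsP: rh.
Qed.

Lemma weight_cut : r \in heads A s -> weight phi A (cut r g) s = weight phi A g s.
Proof.
move=> rh; apply: eq_bigr => u uh; apply: ev_agree; split=> //=.
- move=> v z; rewrite !inE => /andP[vA /eqP vu] /andP[zA /eqP zu]; rewrite !arrow_cut.
  have [vr|vr] := eqVneq v r; rewrite ?andbF //=.
  by rewrite vr in vu *; case/headsP: rh => _ rE; rewrite -vu rE eqxx.
- move=> t /subsetP tB; rewrite !inE -andbA; congr andb; rewrite andb_idl // => ut.
  apply/negP => rt; case/negP: ut; have := tB r rt; rewrite inE => /andP[_ /eqP <-].
  by case/headsP: rh => _ ->.
Qed.

Lemma agree_quot_cut mu :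
  agree (heads A s) (qgraph A (cut r g) s, mu) (cut r (qgraph A g s), mu).
Proof.
split=> //=.
- move=> v z _ _; rewrite arrow_cut !arrow_quot; apply/exists_inP/andP.
    case=> u uA /=; rewrite arrow_cut => /and3P[e vr e']; split=> //.
    by apply/exists_inP; exists u; rewrite ?e.
  case=> vr /exists_inP[u uA /andP[e e']]; exists u => //=.
  by rewrite arrow_cut vr e.
- by move=> t _; rewrite !inE /= -!andbA; congr andb; rewrite andbC.
Qed.
End Trace.

(** An arrow of the quotient comes from the arrow that its source has in the graph.
    Removing it before or after the contraction gives the same quotient. *)
Lemma substitute_trace (x : fsum R (mPT D)) :
  substitute phi (lift1 (@trace D) x) = lift1 (@trace D) (Sub x).
Proof.
apply: (@ev_ext R D (mKF D 0)) => p; rewrite ev_substitute_rep.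
set g := val _; have ga : aromatic_on setT g := aromatic_onT (kforest_aromatic _).
rewrite -[pemb p]/(plain g) ev_trace //; clearbody g; set A : {set 'I_(size_of p)} := setT.
transitivity (\sum_(e | arrows_in A g e)
    \sum_(s : {ffun 'I_(size_of p) -> 'I_(size_of p) * D} | contraction A g s && (e.1 \in heads A s))
      weight phi A g s * ev x (heads A s) (cut e.1 (qgraph A g s), cmark (Some (s e.2).1))); last first.
  apply: eq_bigr => -[r w] /and3P[/= rA wA rw].
  have gc : aromatic_on A (cut r g) := cut_aromatic_on r ga.
  rewrite (ev_substitute_p phi x gc wA) /subst.
  apply: eq_big => [s|s /andP[sc rh]].
    by rewrite /= (compatible_cmark A (Some w) s) andbT (contraction_cut s ga rA wA rw).
  have e1 : weight phi A (cut r g) s = weight phi A g s by apply: weight_cut.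
  have e2 : ev x (heads A s) (quot A (cut r g, cmark (Some w)) s)
      = ev x (heads A s) (cut r (qgraph A g s), cmark (Some (s w).1)).
    by rewrite quot_cmark; apply: ev_agree; exact: agree_quot_cut.
  by rewrite /= -e1 -e2.
rewrite (exchange_big_dep (contraction A g)) /=; last by move=> e s _ /andP[].
rewrite /subst /=; apply: eq_big => [s|s /andP[sc _]]; first by rewrite compatible_cmark andbT.
have qa := quot_aromatic (M := plain g) ga sc.
rewrite quot_plain ev_trace // mulr_sumr.
pose h (e : 'I_(size_of p) * 'I_(size_of p)) :=
  (e.1, odflt e.2 [pick u | ((s u).1 == e.2) && arrow g e.1 u]).
pose h' (e : 'I_(size_of p) * 'I_(size_of p)) := (e.1, (s e.2).1).
have hE e : arrows_in (heads A s) (qgraph A g s) e ->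
    [/\ (h e).1 = e.1, (s (h e).2).1 = e.2 & arrow g e.1 (h e).2].
  case: e => r w /and3P[/= rh wh]; rewrite arrow_quot => /exists_inP[u uA /andP[e1 e2]].
  rewrite /h /=; case: pickP => [z /andP[/eqP a b] //|/(_ u)]; by rewrite e1 e2.
apply/esym/(sum_transfer (h := h) (h' := h')).
- move=> [r w] /andP[/and3P[/= rA wA rw] rh]; rewrite /h /h' /=; congr (_, _).
  case: pickP => [z /andP[_ rz]|/(_ w)]; last by rewrite rw eqxx.
  by apply: (arrow_fun ga (v := r)); rewrite arrow_restr !inE.
- move=> e; apply/idP/idP.
    case/andP=> /andP[/and3P[_ _ a] /andP[_ rh]] /eqP he; rewrite -he /h' /=.
    rewrite /arrows_in /= rh (head_in (M := plain g) sc (in_setT _)) /= arrow_quot.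
    by apply/exists_inP; exists (h e).2; rewrite // eqxx.
  move=> ea; have [e1 e2 e3] := hE e ea; have /and3P[rh _ _] := ea.
  by rewrite /arrows_in !in_setT /= e3 sc rh /h' e2 /= -surjective_pairing eqxx.
- by [].
Qed.
End Commutation.

(** * Existence of the substitution morphism *)

Section Existence.
Variables (R : realType) (D : finType) (phi : D -> fsum R (KF D 1)).
Implicit Types (V U : finType).

Lemma ev_basis (X : mspecies D) (p : isoclasses X) U (A : {set U}) (M : mgraph D U) :
  ev (basis R p) A M = #|occs (pemb p) A M|%:R.
Proof.
rewrite (evE _ _ (leq_addr (size_of p) #|A|)).
rewrite (@big_single R (isoclasses X) _ p) ?classes_upto_uniq ?classes_uptoP ?leq_addl //.
  by rewrite /basis eqxx mul1r.
by move=> q /negbTE; rewrite /basis => ->; rewrite mul0r.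
Qed.

Lemma substitute_linear (X : mspecies D) : linear (@substitute R D phi X).
Proof.
move=> c x y; apply/funext => p; rewrite /substitute !fctE.
have -> : subst phi (c *: x + y) setT (pemb p) =
    c * subst phi x setT (pemb p) + subst phi y setT (pemb p).
  rewrite /subst mulr_sumr -big_split; apply: eq_bigr => s _ /=.
  by rewrite evD mulrDr mulrCA.
by rewrite mulrDl -mulrA.
Qed.

Lemma substitute_continuous (X : mspecies D) : fcontinuous (@substitute R D phi X).
Proof.
move=> n; exists n => x x0 q qn; rewrite /substitute /subst big1 ?mul0r // => s _.
apply/eqP; rewrite mulf_eq0; apply/orP; right; rewrite /ev sum_uptoE; apply/eqP.
apply: (@big_vanish R (isoclasses X)) => p; rewrite classes_uptoP => pA.
rewrite x0 ?mul0r //; apply: leq_ltn_trans pA (leq_ltn_trans _ qn).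
by rewrite -[X in (_ <= X)%N]card_ord; apply: max_card.
Qed.

(** A quotient is empty only if the graph is. *)
Lemma substitute_empty (X : mspecies D) (p : isoclasses X) : size_of p = 0%N ->
  substitute phi (basis R p) = basis R p.
Proof.
move=> p0; apply: (@ev_ext R D X) => q; rewrite ev_rep /substitute divfK; last exact: (@sigma_gt0 R D X).
have pc (B : {set 'I_(size_of q)}) M : #|B| != 0%N -> ev (basis R p) B M = 0.
  move=> h; rewrite ev_basis occs_neq0 // card_ord p0; exact/eqP.
have [q0|q0] := eqVneq (size_of q) 0%N; last first.
  rewrite pc ?cardsT ?card_ord // /subst big1 // => s /andP[sc _]; rewrite pc ?mulr0 //.
  have v : 'I_(size_of q) by apply: (Ordinal (m := 0)); rewrite lt0n.
  rewrite -lt0n; apply/card_gt0P; exists (s v).1.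
  exact: (head_in (M := pemb q) sc (in_setT v)).
have no (v : 'I_(size_of q)) : False by move: (ltn_ord v); rewrite [X in (_ < X)%N]q0.
have e0 (B : {set 'I_(size_of q)}) : B = setT by apply/setP => v; case: (no v).
pose s0 : {ffun 'I_(size_of q) -> 'I_(size_of q) * D} := finfun (fun v => False_rect _ (no v)).
rewrite /subst (big_pred1 s0).
  rewrite (e0 (heads _ _)) /weight big_pred0 => [|v]; last by case: (no v).
  rewrite mul1r; apply: ev_agree; split=> [v|t _|v|v]; try by case: (no v).
  by rewrite inE (e0 (heads _ _)) subsetT andbT.
move=> s; have -> : s = s0 by apply/ffunP => v; case: (no v).
rewrite [RHS]eqxx; apply/andP; split; last by apply/forall_inP => v; case: (no v).
by apply/contractionP; split=> v; case: (no v).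
Qed.

Lemma kclass_empty : size_of (kclass (knil D)) = 0%N.
Proof. by rewrite /size_of /= card_void. Qed.
Lemma cclass_empty : size_of (cclass (cnil D)) = 0%N.
Proof. by rewrite /size_of /= card_void. Qed.

(** Only one contraction has a single vertex of colour d as its quotient: the one that
    contracts the whole tree to its root. *)
Lemma substitute_vertex d :
  substitute phi (basis R (kclass (kdot d))) = phi d.
Proof.
apply: (@ev_ext R D (mKF D 1)) => p; rewrite ev_substitute_rep.
have [r rE] := kroot (rep p : kforest D 1 _).
rewrite -[pemb p]/(plain (val (rep p : kforest D 1 _))).
have pa := kforest_aromatic (rep p : kforest D 1 _).
set g := val _ in rE pa *; clearbody g; have ga := aromatic_onT pa.
have ron : roots_on setT g = [set r] by rewrite roots_onT.
have rr w : arrow g r w = false /\ tied g r w = false.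
  have : r \in roots_on setT g by rewrite ron inE.
  rewrite inE => /andP[_ /forall_inP/(_ w (in_setT w))/andP[/negbTE-> /negbTE->]] //.
pose s0 : {ffun 'I_(size_of p) -> 'I_(size_of p) * D} := [ffun=> (r, d)].
have att v : v != r -> attached setT g s0 v.
  move=> vr; have : v \notin roots_on setT g by rewrite ron inE.
  rewrite inE in_setT /= => /forall_inPn[w _ vw].
  apply/attachedP; split.
  - by move=> u _ _; rewrite !ffunE.
  - move=> u _ vu; rewrite !ffunE /=; split=> // ru; rewrite -ru tied_sym in vu.
    by have [_ e] := rr v; rewrite e in vu.
  - by exists w; rewrite // -[X in is_true X]negbK negb_or.
have s0c : contraction setT g s0.
  apply/contractionP; split.
  - by move=> v _; rewrite inE.
  - by move=> v _; rewrite !ffunE.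
  - by move=> v _; rewrite ffunE /= => /eqP; rewrite eq_sym; apply: att.
  - by move=> v; rewrite inE.
have h0 : heads setT s0 = [set r].
  by apply/setP => v; rewrite !inE ffunE /= eq_sym.
have qa := quot_aromatic (M := plain g) ga s0c.
rewrite /subst (bigD1 s0) /=; last by rewrite s0c compatible_cmark.
rewrite [X in _ + X]big1 ?addr0 => [|s /andP[/andP[sc _] ne]].
  rewrite /weight h0 big_set1 ffunE /= quot_plain ev_basis occs_kclass.
  have -> : [set v in [set: 'I_(size_of p)] | (s0 v).1 == r] = setT.
    by apply/setP => v; rewrite !inE ffunE eqxx.
  have -> : #|occs (mg_k (kdot d)) [set r] (plain (qgraph setT g s0))| = 1%N.
    transitivity #|[set ([ffun=> r] : {ffun unit -> 'I_(size_of p)})]|; last exact: cards1.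
    apply: eq_card => psi.
    rewrite in_set1; apply/occsP/eqP => [[_ e _]|->].
      apply/ffunP => -[]; rewrite ffunE; apply/set1P; rewrite -e; exact: imset_f.
    split; first by move=> [] [].
      by apply/setP => v; rewrite inE; apply/imsetP/eqP => [[[] _]|->]; [rewrite ffunE|exists tt; rewrite ?ffunE].
    apply/eqP; rewrite eq_mg_k; apply/eqP/graph_ext.
    - apply: (aromatic_on_pull _ _ qa); first by move=> [] [].
      by move=> []; rewrite ffunE h0 inE.
    - exact: kforest_aromatic.
    - move=> [] []; rewrite arrow_pull !ffunE arrow_quot [RHS]inE.
      by apply/exists_inP => -[u _ /andP[_]]; have [-> _] := rr u.
    - by move=> [] []; rewrite /tied eqxx.
    - by move=> []; rewrite /deco /= !ffunE.
  rewrite mulr1; apply: ev_agree; split=> //=.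
    move=> v w _ _; rewrite arrow_cut; have [->|//] := eqVneq v r.
    by have [-> _] := rr w.
  move=> t _; rewrite inE andb_idr // => tS; apply/negP => rt.
  have [v [w [tE vw]]] := stolonP pa tS.
  move: rt; rewrite tE !inE => /orP[] /eqP rv; rewrite -rv in vw.
    by have [_ e] := rr w; rewrite e in vw.
  by have [_ e] := rr v; rewrite tied_sym e in vw.
rewrite quot_plain; apply/eqP; rewrite mulf_eq0; apply/orP; right; rewrite ev_basis pnatr_eq0.
rewrite occs_kclass; apply: contraNT ne; rewrite -lt0n => /card_gt0P[psi /occsP[_ e m]].
have hE : heads setT s = [set psi tt].
  by rewrite -e; apply/setP => v; rewrite in_set1; apply/imsetP/eqP => [[[] _]|->] //; exists tt.
have pr : psi tt = r.
  have : r \in heads setT s by apply: (roots_heads (M := plain g) sc); rewrite ron inE.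
  by rewrite hE inE => /eqP.
have /contractionP[_ c2 _ _] := sc.
have cv v : (s v).1 = r.
  by have := head_in (M := plain g) sc (in_setT v); rewrite hE inE pr => /eqP.
have sr : s r = (r, d).
  rewrite [LHS]surjective_pairing cv; congr (_, _).
  by have := congr1 (fun M : mgraph D unit => deco M.1 tt) m; rewrite /deco /= !ffunE pr.
by apply/eqP/ffunP => v; rewrite ffunE -sr -(c2 v) ?inE // cv.
Qed.

Lemma substitute_elementary (t : fsum R (KF D 1)) (us : seq (fsum R (KF D 1))) :
  substitute phi (elementary t us) =
  elementary (substitute phi t)
    [seq substitute phi u | u <- us].
Proof.
rewrite /elementary -[X in foldl _ X (map _ _)]substitute_mark.
elim: us (lift1 (@mark D) t) => [//|u us IH] e /=.
by rewrite IH substitute_compose substitute_mark.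
Qed.

Theorem substitution_exists : substitution_morphism phi
  (@substitute R D phi (mKF D 0)) (@substitute R D phi (mKF D 1)) (@substitute R D phi (mCF D)).
Proof.
split.
- exact: (@substitute_linear (mKF D 0)).
- exact: (@substitute_linear (mKF D 1)).
- exact: (@substitute_linear (mCF D)).
- exact: (@substitute_continuous (mKF D 0)).
- exact: (@substitute_continuous (mKF D 1)).
- exact: (@substitute_continuous (mCF D)).
- exact: substitute_vertex.
- exact: (substitute_empty kclass_empty).
- exact: (@substitute_kprod R D phi 0 0).
- exact: (@substitute_kprod R D phi 0 1).
- exact: substitute_graft.
- exact: substitute_graft.
- by move=> t s; rewrite -[LHS]/(@substitute R D phi (mKF D 0) _) substitute_trace substitute_elementary.
- exact: substitute_stolon.
- exact: (substitute_empty cclass_empty).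
- exact: substitute_cprod.
- exact: substitute_tree.
Qed.
End Existence.

(** * Descendants of a vertex *)

Section Descendants.
Variable D : finType.
Implicit Types (U V : finType).

(** The subtree hanging at v, or all that flows into a cycle through v. *)
Definition desc V (A : {set V}) (g : graph D V) (v : V) : {set V} :=
  [set u in A | connect (arrow (grestr A g)) u v].

Section Desc.
Variables (V : finType) (A : {set V}) (g : graph D V) (v : V).

Lemma desc_sub : desc A g v \subset A.
Proof. by apply/subsetP => u; rewrite inE => /andP[]. Qed.

Lemma desc_self : v \in A -> v \in desc A g v.
Proof. by move=> vA; rewrite inE vA connect0. Qed.

Lemma desc_pred u w : u \in A -> w \in desc A g v -> arrow g u w -> u \in desc A g v.
Proof.
move=> uA; rewrite !inE uA => /andP[wA wv] uw /=; apply: connect_trans wv.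
by apply: connect1; rewrite arrow_restr uA wA.
Qed.

Lemma desc_min (S : {set V}) : v \in S ->
  (forall u w, u \in A -> w \in S -> arrow g u w -> u \in S) -> desc A g v \subset S.
Proof.
move=> vS cl; apply/subsetP => u; rewrite inE => /andP[_ /connectP[p]].
elim: p u => [u _ /= <- //|w p IH u /= /andP[e pp] vE].
move: e; rewrite arrow_restr => /and3P[uA wA e]; exact: cl uA (IH w pp vE) e.
Qed.

Lemma desc_succ u : u \in desc A g v -> u <> v -> v \in A ->
  exists2 w, w \in desc A g v & arrow g u w.
Proof.
move=> ud uv vA.
pose S := [set x in desc A g v | (x == v) || [exists w in desc A g v, arrow g x w]].
have /subsetP/(_ u ud) : desc A g v \subset S.
  apply: desc_min; first by rewrite inE desc_self ?eqxx.
  move=> x w xA; rewrite inE => /andP[wd _] e; rewrite inE (desc_pred xA wd e) /=.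
  by apply/orP; right; apply/exists_inP; exists w.
by rewrite inE => /andP[_ /orP[/eqP //|/exists_inP[w wd e]]]; exists w.
Qed.

Lemma desc_next u w : aromatic_on A g -> v \in A -> u \in desc A g v -> u <> v ->
  w \in A -> arrow g u w -> w \in desc A g v.
Proof.
move=> ga vA ud uv wA uw; have [w' w'd uw'] := desc_succ ud uv vA.
suff -> : w = w' by [].
have uA := subsetP desc_sub u ud; have w'A := subsetP desc_sub w' w'd.
by apply: (arrow_fun ga (v := u)); rewrite arrow_restr uA ?wA ?w'A.
Qed.

(** A descendant other than v has an arrow, hence no stolon. *)
Lemma desc_untied u w : aromatic_on A g -> v \in A -> u \in desc A g v -> u <> v ->
  w \in A -> tied g u w = false.
Proof.
move=> ga vA ud uv wA; have [w' w'd uw'] := desc_succ ud uv vA.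
have uA := subsetP desc_sub u ud; have w'A := subsetP desc_sub w' w'd.
by apply/negP => t; apply: (@arrow_tied _ _ _ u w' w ga);
  rewrite ?arrow_restr ?tied_restr uA ?wA ?w'A.
Qed.

Lemma desc_root : aromatic_on A g -> v \in A ->
  (forall w, w \in desc A g v -> arrow g v w = false) ->
  roots_on (desc A g v) g = [set v].
Proof.
move=> ga vA no; apply/setP => u; rewrite in_set1 inE.
apply/andP/eqP => [[ud /forall_inP h]|->].
  apply/eqP/negPn/negP => /eqP uv; have [w wd uw] := desc_succ ud uv vA.
  by have := h w wd; rewrite uw.
split; first exact: desc_self.
apply/forall_inP => w wd; rewrite no //=; apply/negP => t.
have [wv|/eqP wv] := eqVneq w v; first by move: t; rewrite wv /tied eqxx.
by rewrite tied_sym (desc_untied ga vA wd wv vA) in t.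
Qed.
End Desc.

(** As r has no arrow, no cycle leads to r. *)
Lemma desc_acyclic V (A : {set V}) (g : graph D V) r v w : aromatic_on A g -> r \in A -> v \in A ->
  (forall u, u \in A -> arrow g r u = false) -> v \in desc A g r -> w \in desc A g v ->
  arrow g v w = false.
Proof.
move=> ga rA vA nor vr wv; apply/negP => vw.
have rv : r <> v by move=> e; move: vw; rewrite -e nor // (subsetP (desc_sub A g v)).
have : desc A g r \subset A :\: desc A g v.
  apply: desc_min.
    rewrite inE rA andbT; apply/negP => rd; have [x xd rx] := desc_succ rd rv vA.
    by rewrite nor // (subsetP (desc_sub A g v)) in rx.
  move=> u x uA; rewrite !in_setD => /andP[xd xA] ux; rewrite uA andbT.
  apply: contra xd => ud; have [uv|/eqP uv] := eqVneq u v; last exact: desc_next ud uv xA ux.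
  suff -> : x = w by [].
  rewrite uv in ux; have wA := subsetP (desc_sub A g v) w wv.
  by apply: (arrow_fun ga (v := v)); rewrite arrow_restr vA ?wA ?xA.
by move=> /subsetP/(_ v vr); rewrite in_setD desc_self.
Qed.

Lemma desc_pull V U (f : U -> V) (A : {set V}) (g : graph D V) a :
  injective f -> f @: [set: U] = A -> f @: desc setT (gpull f g) a = desc A g (f a).
Proof.
move=> fI fA; have inA x : f x \in A by rewrite -fA imset_f.
apply/eqP; rewrite eqEsubset; apply/andP; split.
  have pre x (B : {set V}) : (x \in f @^-1: B) = (f x \in B) by rewrite inE.
  have : desc setT (gpull f g) a \subset f @^-1: desc A g (f a).
    apply: desc_min; first by rewrite pre desc_self.
    move=> u w _; rewrite !pre => wd; rewrite arrow_pull => e.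
    exact: desc_pred (inA u) wd e.
  by move=> /subsetP h; apply/subsetP => _ /imsetP[x /h xd ->]; rewrite pre in xd.
apply: desc_min; first by rewrite imset_f ?desc_self ?inE.
move=> u _ uA /imsetP[x xd ->]; move: uA; rewrite -fA => /imsetP[y _ ->] e.
by apply: imset_f; apply: (desc_pred _ xd); rewrite ?inE ?arrow_pull.
Qed.

(** A path to r may be stopped at its first visit of r, and so avoids the arrow of r. *)
Lemma desc_cut V (A : {set V}) (g : graph D V) r : desc A g r \subset desc A (cut r g) r \/ r \notin A.
Proof.
have [rA|] := boolP (r \in A); [left|by right].
apply: desc_min; first exact: desc_self.
move=> u w uA wd e; have [->|ur] := eqVneq u r; first exact: desc_self.
by apply: (desc_pred uA wd); rewrite arrow_cut ur.
Qed.
End Descendants.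

Section Linear.
Variable R : realType.

Section Subspace.
Variables (X : species) (Sp : fsum R X -> Prop).
Hypothesis Sp_lin : forall c e e', Sp e -> Sp e' -> Sp (c *: e + e').

(** If a finite sum e lies in a subspace that contains all its other terms, it can be
    solved for the term of q. *)
Lemma triangular (e : fsum R X) N (q : isoclasses X) :
  Sp e -> (forall z, e z != 0 -> (size_of z <= N)%N) -> e q != 0 ->
  (forall z, e z != 0 -> z != q -> Sp (basis R z)) -> Sp (basis R q).
Proof.
move=> eS eN eq0 eO.
have S0 : Sp 0.
  have -> : (0 : fsum R X) = -1 *: e + e by rewrite scaleN1r addNr.
  exact: Sp_lin.
pose rest : fsum R X := \sum_(z <- classes_upto X N | z != q) e z *: basis R z.
have restS : Sp rest.
  rewrite /rest; elim: (classes_upto X N) => [|z L IH]; first by rewrite big_nil.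
  rewrite big_cons; case: ifP => // zq.
  have [->|ez] := eqVneq (e z) 0; first by rewrite scale0r add0r.
  by apply: Sp_lin => //; apply: eO.
have eE : e = e q *: basis R q + rest.
  have -> : e q *: basis R q + rest = \sum_(z <- classes_upto X N) e z *: basis R z.
    rewrite [RHS](bigID (pred1 q)) /= /rest; congr (_ + _).
    rewrite -big_filter; have -> : [seq z <- classes_upto X N | z == q] = [:: q].
      apply: (@perm_small_eq (isoclasses X)); rewrite //.
      apply: (@uniq_perm (isoclasses X)); rewrite ?filter_uniq ?classes_upto_uniq //.
      move=> z; rewrite mem_filter inE; have [->|//] := eqVneq z q.
      by rewrite classes_uptoP eN.
    by rewrite big_seq1.
  apply/funext => z; rewrite fct_sumE.
  have [ez|ez] := eqVneq (e z) 0.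
    rewrite big1 ?ez // => y _; rewrite /basis !fctE /GRing.scale /=.
    by have [<-|_] := eqVneq z y; [rewrite ez mul0r|rewrite mulr0].
  rewrite (@big_single R (isoclasses X) _ z) ?classes_upto_uniq ?classes_uptoP ?eN //.
    by rewrite /basis !fctE eqxx /GRing.scale /= mulr1.
  by move=> y yz; rewrite /basis !fctE eq_sym (negbTE yz) /GRing.scale /= mulr0.
have restE : -1 *: rest + e = e q *: basis R q.
  by rewrite scaleN1r [X in _ + X]eE addrC addrK.
have -> : basis R q = (e q)^-1 *: (-1 *: rest + e) + 0.
  by rewrite addr0 restE scalerA mulVf // scale1r.
by apply: (Sp_lin _ (Sp_lin _ restS eS) S0).
Qed.
End Subspace.

Lemma lift1_lin (X Y : species) (op : isoclasses X -> seq (isoclasses Y)) c (x x' : fsum R X) :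
  lift1 op (c *: x + x') = c *: lift1 op x + lift1 op x'.
Proof.
apply/funext => z; rewrite /lift1 !fctE !sum_uptoE.
rewrite -[c *: _]/(c * _) mulr_sumr -big_split; apply: eq_bigr => p _ /=.
by rewrite mulrDl mulrA.
Qed.

Lemma lift2_lin (X Y Z : species) (op : isoclasses X -> isoclasses Y -> seq (isoclasses Z))
   c (x x' : fsum R X) y :
  lift2 op (c *: x + x') y = c *: lift2 op x y + lift2 op x' y.
Proof.
apply/funext => z; rewrite /lift2 !fctE !sum_uptoE.
rewrite -[c *: _]/(c * _) mulr_sumr -big_split; apply: eq_bigr => p _ /=.
rewrite !sum_uptoE mulr_sumr -big_split; apply: eq_bigr => q _ /=.
by rewrite !mulrDl !mulrA.
Qed.

Lemma lift1_basis_supp (X Y : species) (op : isoclasses X -> seq (isoclasses Y)) p z :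
  lift1 op (basis R p) z != 0 -> z \in op p.
Proof.
apply: contraNT => zn; rewrite /lift1 sum_uptoE; apply/eqP.
apply: (@big_vanish R (isoclasses X)) => p' _; rewrite /basis.
have [->|_] := eqVneq p' p; last by rewrite mul0r.
by rewrite (count_memPn zn) mulr0.
Qed.

Lemma lift2_basis_supp (X Y Z : species) (op : isoclasses X -> isoclasses Y -> seq (isoclasses Z)) p q z :
  lift2 op (basis R p) (basis R q) z != 0 -> z \in op p q.
Proof.
apply: contraNT => zn; rewrite /lift2 sum_uptoE; apply/eqP.
apply: (@big_vanish R (isoclasses X)) => p' _; rewrite sum_uptoE.
apply: (@big_vanish R (isoclasses Y)) => q' _; rewrite /basis.
have [->|_] := eqVneq p' p; last by rewrite mul0r mul0r.
have [->|_] := eqVneq q' q; last by rewrite mulr0 mul0r.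
by rewrite (count_memPn zn) mulr0.
Qed.
End Linear.

(** * Supports of products of basis elements *)

Section Supports.
Variables (R : realType) (D : finType).
Implicit Types (U V : finType).

Lemma ev_basis_gt0 (X : mspecies D) (p : isoclasses X) U (A : {set U}) (M : mgraph D U) :
  (0 < ev (basis R p) A M) <-> exists psi, psi \in occs (pemb p) A M.
Proof. by rewrite ev_basis ltr0n; split=> [/card_gt0P|h]; last exact/card_gt0P. Qed.

Lemma ev_neq0_coef (X : mspecies D) (e : fsum R X) (q : isoclasses X) :
  (e q != 0) = (ev e setT (pemb q) != 0).
Proof. by rewrite ev_rep mulf_eq0 (negbTE (@sigma_gt0 R D X q)) orbF. Qed.

(** The terms of a product of basis elements are nonnegative, so nothing cancels and
    one contributing cut is enough. *)
Lemma cut_neq0 (X Y Z : mspecies D) (e : fsum R Z) (p : isoclasses X) (p' : isoclasses Y)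
   (q : isoclasses Z) (cond : pred {set 'I_(size_of q)}) M1 M2 :
  ev e setT (pemb q) = \sum_(W : {set 'I_(size_of q)} | (W \subset setT) && cond W)
     ev (basis R p) W (M1 W) * ev (basis R p') (setT :\: W) (M2 W) ->
  (e q != 0) <-> exists W : {set 'I_(size_of q)}, [/\ cond W,
     exists psi, psi \in occs (pemb p) W (M1 W)
   & exists psi, psi \in occs (pemb p') (setT :\: W) (M2 W)].
Proof.
move=> E; rewrite ev_neq0_coef E.
have ge0 W : 0 <= ev (basis R p) W (M1 W) * ev (basis R p') (setT :\: W) (M2 W).
  by rewrite !ev_basis mulr_ge0 ?ler0n.
split=> [ne|[W [cW /ev_basis_gt0 h1 /ev_basis_gt0 h2]]].
  have [W /andP[_ cW] ne'] : exists2 W : {set 'I_(size_of q)}, (W \subset setT) && cond W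
      & ev (basis R p) W (M1 W) * ev (basis R p') (setT :\: W) (M2 W) != 0.
    by apply/exists_inP; apply: contraNT ne => /exists_inPn no; apply/eqP/big1 => W /no;
      rewrite negbK => /eqP.
  move: ne'; rewrite mulf_eq0 negb_or !ev_basis !pnatr_eq0 -!lt0n => /andP[/card_gt0P h1 /card_gt0P h2].
  by exists W.
rewrite (bigD1 W) /= ?subsetT //; apply: lt0r_neq0; apply: ltr_pwDl; first exact: mulr_gt0.
by apply: sumr_ge0 => W' _.
Qed.

Lemma class_eq (X : mspecies D) (p q : isoclasses X) U (A : {set U}) (M : mgraph D U) psi psi' :
  psi \in occs (pemb p) A M -> psi' \in occs (pemb q) A M -> p = q.
Proof. by move=> h h'; have := occs_two h h'; rewrite !class_rep. Qed.

Lemma occs_id V (M : mgraph D V) : [ffun v => v] \in occs M setT M.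
Proof.
apply/occsP; split; first by move=> x y; rewrite !ffunE.
- by apply/setP => u; rewrite inE; apply/imsetP; exists u; rewrite ?ffunE.
- by apply: mpull_id => v; rewrite ffunE.
Qed.

Lemma occs_size (X : mspecies D) (p : isoclasses X) U (A : {set U}) (M : mgraph D U) psi :
  psi \in occs (pemb p) A M -> #|A| = size_of p.
Proof. by move/occs_card; rewrite card_ord. Qed.

Lemma cut_size (X Y : mspecies D) (p : isoclasses X) (p' : isoclasses Y) n
    (W : {set 'I_n}) (M M' : mgraph D 'I_n) psi psi' :
  psi \in occs (pemb p) W M -> psi' \in occs (pemb p') (setT :\: W) M' ->
  n = (size_of p + size_of p')%N.
Proof.
move=> /occs_size <- /occs_size <-.
by rewrite -[LHS](card_ord n) -(cardsC W) setTD.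
Qed.

Definition rep_graph k (p : isoclasses (KF D k)) : graph D 'I_(size_of p) :=
  val (rep p : kforest D k _).

Lemma rep_aromatic k (p : isoclasses (KF D k)) : aromatic_on setT (rep_graph p).
Proof. exact: aromatic_onT (kforest_aromatic _). Qed.

Lemma kclass_occ k V (h : kforest D k V) U (A : {set U}) M psi :
  psi \in occs (mg_k h) A M -> exists psi', psi' \in occs (pemb (kclass h)) A M.
Proof.
move=> hp; apply/card_gt0P; rewrite occs_kclass; apply/card_gt0P; by exists psi.
Qed.

Lemma size1_dot (q : isoclasses (KF D 1)) : size_of q = 1%N -> exists d, q = kclass (kdot d).
Proof.
move=> q1; have [r rE] := kroot (rep q : kforest D 1 _).
set g := rep_graph q; have ga : aromatic g := kforest_aromatic _.
have all v : v = r.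
  have v0 (u : 'I_(size_of q)) : val u = 0%N.
    by apply/eqP; rewrite -leqn0 -ltnS; move: (ltn_ord u); rewrite [X in (_ < X)%N]q1.
  by apply: val_inj; rewrite !v0.
exists (deco g r).
have h : [ffun=> r] \in occs (mg_k (kdot (deco g r))) setT (plain g).
  apply/occsP; split; first by move=> [] [].
    by apply/setP => v; rewrite inE (all v); apply/imsetP; exists tt; rewrite ?ffunE.
  apply/eqP; rewrite eq_mg_k; apply/eqP/graph_ext.
  - by apply: gpull_aromatic => // -[] [].
  - exact: kforest_aromatic.
  - move=> [] []; rewrite arrow_pull !ffunE [RHS]inE.
    have : r \in roots g by rewrite rE inE.
    by rewrite root_rel // => /forallP/(_ r)/andP[/negbTE].
  - by move=> [] []; rewrite /tied eqxx.
  - by move=> []; rewrite /deco /= !ffunE.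
have [psi' h'] := kclass_occ h.
exact: (class_eq (occs_id (pemb q)) h').
Qed.

Lemma size0_nil (q : isoclasses (KF D 0)) : size_of q = 0%N -> q = kclass (knil D).
Proof.
move=> q0; set g := rep_graph q; have ga : aromatic g := kforest_aromatic _.
have no (v : 'I_(size_of q)) : False by move: (ltn_ord v); rewrite [X in (_ < X)%N]q0.
pose f0 : {ffun void -> 'I_(size_of q)} := [ffun v : void => match v with end].
have h : f0 \in occs (mg_k (knil D)) setT (plain g).
  apply/occsP; split; first by case.
    by apply/setP => v; case: (no v).
  by apply/eqP; rewrite eq_mg_k; apply/eqP/graph_ext; rewrite ?kforest_aromatic //;
    apply: gpull_aromatic => // -[].
have [psi' h'] := kclass_occ h.
exact: (class_eq (occs_id (pemb q)) h').
Qed.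

(** Trees with the same number of vertices are solved for in increasing order of this
    number. *)
Definition indeg V (g : graph D V) : nat :=
  #|[set e : V * V | arrow g e.1 e.2 && (e.2 \in roots g)]|.

Lemma roots_gpull V U (f : U -> V) (g : graph D V) x : injective f -> f @: [set: U] = setT ->
  aromatic g -> (x \in roots (gpull f g)) = (f x \in roots g).
Proof.
move=> fI fT ga; rewrite -(roots_onT ga) -(roots_pull fI fT (aromatic_onT ga)).
by rewrite mem_imset.
Qed.

Lemma indeg_pull V U (f : U -> V) (g : graph D V) : injective f -> f @: [set: U] = setT ->
  aromatic g -> indeg (gpull f g) = indeg g.
Proof.
move=> fI fT ga; pose F (e : U * U) := (f e.1, f e.2).
have FI : injective F by move=> [a b] [c d] [/fI -> /fI ->].
rewrite /indeg -(card_imset _ FI); apply: eq_card => -[x y].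
apply/imsetP/idP => [[[a b]]|].
  by rewrite in_set /= arrow_pull roots_gpull // => h [-> ->]; rewrite in_set.
have : x \in f @: setT by rewrite fT inE.
have : y \in f @: setT by rewrite fT inE.
move=> /imsetP[b _ ->] /imsetP[a _ ->]; rewrite in_set /= => h.
by exists (a, b); rewrite // in_set /= arrow_pull roots_gpull.
Qed.

Lemma indeg_kclass k V (h : kforest D k V) : indeg (rep_graph (kclass h)) = indeg (val h).
Proof.
have [psi /occsP[a b c]] := kclass_occ (occs_id (mg_k h)).
rewrite -(indeg_pull a b (kforest_aromatic h)); congr indeg.
by rewrite -[RHS]/(mpull psi (mg_k h)).1 c.
Qed.

Lemma indeg_kgraft k V1 V2 (t : kforest D 1 V1) (u : kforest D k V2) w :
  indeg (val (kgraft t u w)) = (indeg (val u) + (w \in roots (val u)))%N.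
Proof.
have [r rE] := kroot t.
have aE x y : arrow (val (kgraft t u w)) x y =
   arrow (gunion (val t) (val u)) x y || ((x == inl r) && (y == inr w)).
  by rewrite [LHS]arrow_link rE imset_set1 inE.
have rtE x : (inr x \in roots (val (kgraft t u w))) = (x \in roots (val u)).
  rewrite [roots _]glink_roots gunion_roots rE in_setD in_setU !mem_sumE.
  by rewrite orFb.
have rtE' x : (inl x \in roots (val (kgraft t u w))) = false.
  by rewrite [roots _]glink_roots gunion_roots rE in_setD in_setU !mem_sumE orbF andNb.
pose F (e : V2 * V2) : (V1 + V2) * (V1 + V2) := (inr e.1, inr e.2).
have FI : injective F by move=> [a b] [c d] [-> ->].
rewrite /indeg -(card_imset _ FI).
set S := F @: _; set S' := [set e | _].
have S'E : S' = S :|: [set e in [set (inl r, inr w)] | w \in roots (val u)].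
  apply/setP => -[[x|x] [y|y]]; rewrite in_setU in_set /= ?rtE ?rtE' ?andbF //=.
  - symmetry; apply/negbTE; rewrite negb_or; apply/andP; split; last by rewrite in_set in_set1 -pair_eqE /= ?andbF.
    by apply/imsetP => -[].
  - have -> : ((inl x, inr y) \in S) = false by apply/imsetP => -[].
    rewrite [X in _ || X]in_set in_set1 aE arrow_union /= -pair_eqE /=.
    rewrite -[inr y == inr w]/(y == w); by have [->|_] := eqVneq y w; rewrite ?andbF.
  - symmetry; apply/negbTE; rewrite negb_or; apply/andP; split; last by rewrite in_set in_set1 -pair_eqE /= ?andbF.
    by apply/imsetP => -[].
  - rewrite [X in _ || X]in_set in_set1 -pair_eqE /= aE arrow_union /= !orbF.
    by rewrite -[(inr x, inr y)]/(F (x, y)) mem_imset // [RHS]in_set.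
rewrite S'E cardsU.
have -> : S :&: [set e in [set (inl r, inr w)] | w \in roots (val u)] = set0.
  by apply/setP => e; rewrite !inE; apply/negP => /andP[/imsetP[x _ ->]] /andP[/eqP[]].
rewrite cards0 subn0; congr addn.
case: (w \in roots (val u)).
  by rewrite -[RHS](cards1 (inl r : V1 + V2, inr w : V1 + V2)); apply: eq_card => e; rewrite !inE andbT.
by apply: eq_card0 => e; rewrite !inE andbF.
Qed.
End Supports.

(** * Marked trees and elementary endomorphisms *)

Section Linked.
Variable D : finType.
Implicit Types (U V : finType).

(** All of A hangs at a single root; there are no cycles and no stolons. *)
Definition linked V (A : {set V}) (g : graph D V) : Prop :=
  exists2 r, roots_on A g = [set r] & desc A g r = A.

Lemma linked_pull V U (f : U -> V) (A : {set V}) (g : graph D V) :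
  injective f -> f @: [set: U] = A -> aromatic_on A g ->
  linked setT (gpull f g) <-> linked A g.
Proof.
move=> fI fA ga; have inA x : f x \in A by rewrite -fA imset_f.
have pa : aromatic (gpull f g) := aromatic_on_pull fI inA ga.
have rE := roots_pull fI fA ga; split=> -[r r1 r2].
  exists (f r); first by rewrite -rE -(roots_onT pa) r1 imset_set1.
  by rewrite -(desc_pull _ _ fI fA) r2.
have : r \in roots_on A g by rewrite r1 in_set1.
rewrite -rE => /imsetP[x xr rx]; exists x.
  apply: (imset_inj fI); rewrite roots_onT // rE r1 imset_set1; by rewrite rx.
by apply: (imset_inj fI); rewrite (desc_pull _ _ fI fA) -rx r2.
Qed.

Lemma desc_closed V (A W : {set V}) (g : graph D V) v : W \subset A -> v \in W ->
  (forall u w, u \in A -> w \in W -> arrow g u w -> u \in W) -> desc W g v = desc A g v.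
Proof.
move=> /subsetP WA vW cl; apply/eqP; rewrite eqEsubset; apply/andP; split.
  apply: desc_min; first by apply: desc_self; apply: WA.
  by move=> u w uW; apply: desc_pred; apply: WA.
apply: desc_min; first exact: desc_self.
move=> u w uA wd e; have wW := subsetP (desc_sub W g v) w wd.
exact: (desc_pred (cl u w uA wW e) wd e).
Qed.

Lemma desc_mono V (A W : {set V}) (g : graph D V) v : W \subset A -> v \in W ->
  desc W g v \subset desc A g v.
Proof.
move=> /subsetP WA vW; apply: desc_min; first by apply: desc_self; apply: WA.
by move=> u w uW; apply: desc_pred; apply: WA.
Qed.

Lemma desc_trans V (A : {set V}) (g : graph D V) u v : u \in desc A g v -> desc A g u \subset desc A g v.
Proof. by move=> ud; apply: desc_min => // x w xA; apply: desc_pred. Qed.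

Lemma setTDin V (W : {set V}) v : (v \in setT :\: W) = (v \notin W).
Proof. by rewrite in_setD in_setT andbT. Qed.

(** The descendants of a vertex v that points outside them form a tree grafted onto
    the rest of the graph. *)
Section CutOff.
Variables (V : finType) (g : graph D V) (v v1 : V).
Hypotheses (ga : aromatic g) (vv1 : arrow g v v1) (v1W : v1 \notin desc setT g v).
Let W := desc setT g v.
Let gaT := aromatic_onT ga.

Lemma cutoff_pred u w : w \in W -> arrow g u w -> u \in W.
Proof. by move=> wW e; apply: (desc_pred _ wW e); rewrite inE. Qed.
Lemma cutoff_self : v \in W.
Proof. by apply: desc_self; rewrite inE. Qed.
Lemma cutoff_next u w : u \in W -> w \notin W -> arrow g u w -> u = v.
Proof.
move=> uW wW e; apply/eqP/negPn/negP => /eqP uv; move/negP: wW; apply.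
by apply: (desc_next gaT _ uW uv _ e); rewrite inE.
Qed.
Lemma cutoff_tied u w : u \in W -> tied g u w = false.
Proof.
move=> uW; have [->|/eqP uv] := eqVneq u v.
  by apply/negP => /(arrow_tied ga vv1).
by apply: (desc_untied gaT _ uW uv); rewrite inE.
Qed.

Lemma cutoff_crossing : crossing W (setT :\: W) g = [set v].
Proof.
apply/setP => u; rewrite in_crossing in_set1; apply/andP/eqP => [[uW /exists_inP[w]]|->].
  by rewrite setTDin => wW; apply: cutoff_next.
split; first exact: cutoff_self.
by apply/exists_inP; exists v1; rewrite // setTDin.
Qed.

Lemma cutoff_cut_type : cut_type 1 0 W (setT :\: W) g.
Proof.
apply/and3P; split.
- apply/eqP/setP => u; rewrite in_crossing in_set0 setTDin; apply/negP => /andP[uW /exists_inP[w wW e]].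
  by rewrite (cutoff_pred wW e) in uW.
- by rewrite cutoff_crossing cards1.
- rewrite cards_eq0; apply/eqP/setP => u; rewrite in_bonded in_set0; apply/negP => /andP[uW /exists_inP[w _]].
  by rewrite cutoff_tied.
Qed.

Lemma cutoff_target : target W (setT :\: W) g = Some v1.
Proof.
apply/eqP/targetP; first by apply: aromatic_on_sub gaT; apply: subsetT.
  by rewrite cutoff_crossing cards1.
by split; [rewrite setTDin|exists v; rewrite ?cutoff_self].
Qed.

Lemma cutoff_roots : roots_on W g = [set v].
Proof.
apply: (desc_root gaT); first by rewrite inE.
move=> w wW; apply/negP => vw.
by move/negP: v1W; rewrite (arrow_fun ga vv1 vw).
Qed.

Lemma cutoff_rest : roots_on (setT :\: W) g = roots g.
Proof.
rewrite (roots_on_closed gaT (subsetT _)) ?roots_onT //.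
  apply/setIidPr/subsetP => u ur; rewrite setTDin; apply/negP => uW.
  have [uv|/eqP uv] := eqVneq u v.
    by move: ur; rewrite uv root_rel // => /forallP/(_ v1); rewrite vv1.
  have [w _ uw] := desc_succ uW uv (in_setT v).
  by move: ur; rewrite root_rel // => /forallP/(_ w); rewrite uw.
move=> u w; rewrite !setTDin => uW _ /orP[] e; apply/negP => wW; move/negP: uW; apply.
  exact: cutoff_pred wW e.
by rewrite tied_sym cutoff_tied in e.
Qed.
End CutOff.
End Linked.

Section Marked.
Variables (R : realType) (D : finType).
Implicit Types (U V : finType).

Lemma root_marked (p : isoclasses (mKF D 1)) rho U (W : {set U}) g v psi :
  roots (rep_graph p) = [set rho] -> aromatic_on W g ->
  psi \in occs (pemb p) W (plain g) -> roots_on W g = [set v] ->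
  exists psi', psi' \in occs (pemb (pclass (rep p : kforest D 1 _) rho))
                 W (g, cmark (Some v)).
Proof.
move=> rE ga /occsP[a b c] vE; apply/card_gt0P; rewrite occs_pclass; apply/card_gt0P.
exists psi; apply/occsP; split=> //; apply/eqP; rewrite eq_mg_p //.
have e : gpull psi g = rep_graph p by have := congr1 (fun M : mgraph D _ => M.1) c.
rewrite e eqxx /=; have := roots_pull a b ga; rewrite e rE imset_set1 vE.
by move/setP/(_ v); rewrite !inE eqxx => /eqP->.
Qed.

Definition pgraph (x : isoclasses (PT D)) : graph D 'I_(size_of x) :=
  val (rep x : kforest D 1 _ * _)%type.1.
Definition pmark (x : isoclasses (PT D)) : 'I_(size_of x) :=
  (rep x : kforest D 1 _ * _)%type.2.
Lemma pgraph_aromatic x : aromatic (pgraph x).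
Proof. exact: kforest_aromatic. Qed.
Lemma pgraph_roots x : exists r, roots (pgraph x) = [set r].
Proof. exact: kroot. Qed.

Lemma linked_occ_k (p : isoclasses (mKF D 1)) U (A : {set U}) g psi : aromatic_on A g ->
  psi \in occs (pemb p) A (plain g) -> linked setT (rep_graph p) <-> linked A g.
Proof.
move=> ga /occsP[a b c]; rewrite -(linked_pull a b ga).
by have -> : gpull psi g = rep_graph p by have := congr1 (fun M : mgraph D _ => M.1) c.
Qed.

Lemma linked_occ_p (x : isoclasses (mPT D)) U (A : {set U}) g m psi : aromatic_on A g ->
  psi \in occs (pemb x) A (g, m) -> linked setT (pgraph x) <-> linked A g.
Proof.
move=> ga /occsP[a b c]; rewrite -(linked_pull a b ga).
by have -> : gpull psi g = pgraph x by have := congr1 (fun M : mgraph D _ => M.1) c.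
Qed.

Variable good : fsum R (KF D 1) -> Prop.

(** The sums whose trace is determined by the values of a morphism on good trees. *)
Inductive span : fsum R (PT D) -> Prop :=
| span_elementary t us : good t -> Stdlib.Lists.List.Forall good us -> span (elementary t us)
| span_comb c e e' : span e -> span e' -> span (c *: e + e').

Lemma span_compose e u : span e -> good u -> span (lift2 (@compose D) e (lift1 (@mark D) u)).
Proof.
move=> es ug; elim: es => [t us tg usg|c e1 e2 _ IH1 _ IH2]; last first.
  by rewrite lift2_lin; apply: span_comb.
have -> : lift2 (@compose D) (elementary t us) (lift1 (@mark D) u) = elementary t (rcons us u).
  by rewrite /elementary foldl_rcons.
apply: span_elementary => //; elim: us usg => [|x us IH] h /=.
  exact: List.Forall_cons (List.Forall_nil _).
apply: List.Forall_cons; first exact: (List.Forall_inv h).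
by apply: IH; apply: (List.Forall_inv_tail h).
Qed.

Lemma mark_neq0 (p : isoclasses (mKF D 1)) (z : isoclasses (mPT D)) :
  (lift1 (@mark D) (basis R p) z != 0) <-> exists psi, psi \in occs (pemb p) setT (plain (pgraph z)).
Proof.
rewrite (ev_neq0_coef).
have -> : ev (lift1 (@mark D) (basis R p)) setT (pemb z)
   = ev (basis R p) setT (plain (pgraph z)) by apply: ev_mark; rewrite inE.
by rewrite ev_basis pnatr_eq0 -lt0n; split=> [/card_gt0P|h]; last exact/card_gt0P.
Qed.

Definition compose_cut (z : isoclasses (mPT D)) (W : {set 'I_(size_of z)}) :=
  cut_type 1 0 W (setT :\: W) (pgraph z) && (pmark z \in W).

Lemma compose_neq0 (x1 x2 z : isoclasses (mPT D)) :
  (lift2 (@compose D) (basis R x1) (basis R x2) z != 0) <->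
  exists W : {set 'I_(size_of z)}, [/\ compose_cut W,
    exists psi, psi \in occs (pemb x2) W (pgraph z, cmark (Some (pmark z)))
  & exists psi, psi \in occs (pemb x1) (setT :\: W)
      (pgraph z, cmark (target W (setT :\: W) (pgraph z)))].
Proof.
apply: (cut_neq0 (Y := mPT D) (Z := mPT D)
  (M1 := fun=> (pgraph z, cmark (Some (pmark z))))
  (M2 := fun W => (pgraph z, cmark (target W (setT :\: W) (pgraph z))))).
exact: (ev_compose _ _ _ (aromatic_onT (pgraph_aromatic z))).
Qed.

Lemma compose_mark_neq0 (x1 : isoclasses (mPT D)) (p2 : isoclasses (mKF D 1)) (z : isoclasses (mPT D)) :
  (lift2 (@compose D) (basis R x1) (lift1 (@mark D) (basis R p2)) z != 0) <->
  exists W : {set 'I_(size_of z)}, [/\ compose_cut W,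
    exists psi, psi \in occs (pemb p2) W (plain (pgraph z))
  & exists psi, psi \in occs (pemb x1) (setT :\: W)
      (pgraph z, cmark (target W (setT :\: W) (pgraph z)))].
Proof.
apply: (cut_neq0 (Y := mPT D) (Z := mPT D) (M1 := fun=> plain (pgraph z))
  (M2 := fun W => (pgraph z, cmark (target W (setT :\: W) (pgraph z))))).
rewrite (ev_compose _ _ (pmark z) (aromatic_onT (pgraph_aromatic z))).
apply: eq_bigr => W /andP[_ /andP[_ vW]]; congr (_ * _); exact: ev_mark.
Qed.

Lemma compose_unique (x1 x2 z z' : isoclasses (mPT D)) :
  lift2 (@compose D) (basis R x1) (basis R x2) z != 0 ->
  lift2 (@compose D) (basis R x1) (basis R x2) z' != 0 -> z = z'.
Proof.
move=> /lift2_basis_supp + /lift2_basis_supp; rewrite /compose !inE.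
by move=> /eqP-> /eqP->.
Qed.

(** Marked trees without cycles and stolons are spanned by elementary endomorphisms,
    by induction on the size and then on the number of descendants of the mark.
    If the mark is the root, summing over all marks of the tree gives it up to trees
    marked elsewhere, where the mark has fewer descendants. If not, the subtree at
    the mark is cut off, and the rest is marked at the vertex that receives it.
    Composing the rest with the endomorphism of the subtree sums over the marks of
    the subtree, and again the other terms have marks with fewer descendants. *)
Lemma marked_span N (x : isoclasses (mPT D)) :
  (forall p : isoclasses (mKF D 1), (size_of p <= N)%N -> good (basis R p)) ->
  (size_of x <= N)%N -> linked setT (pgraph x) -> span (basis R x).
Proof.
move=> gN; have [n] := ubnP (size_of x).
elim: n x => // n IHn x; rewrite ltnS => xn.
have [k] := ubnP #|desc setT (pgraph x) (pmark x)|.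
elim: k x xn => // k IHk x xn; rewrite ltnS => xk xN lx.
have IH z : size_of z = size_of x -> linked setT (pgraph z) ->
    (#|desc setT (pgraph z) (pmark z)| < #|desc setT (pgraph x) (pmark x)|)%N -> span (basis R z).
  by move=> zx lz zk; apply: IHk => //; rewrite ?zx //; apply: leq_trans zk xk.
set g := pgraph x in lx xk IH; set v := pmark x in xk IH.
have ga : aromatic g := pgraph_aromatic x; have gaT := aromatic_onT ga.
have [r r1 r2] := lx; have rE : roots g = [set r] by rewrite -roots_onT.
have [vr|/eqP vr] := eqVneq v r.
  have [p [psi hp]] : present (mKF D 1) setT (plain g).
    by apply/(present_k 1 gaT); rewrite r1 cards1.
  have [rho rhoE] := kroot (rep p : kforest D 1 _).
  (* In the other terms the mark is not the root, so it has fewer descendants. *)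
  apply: (triangular span_comb (e := lift1 (@mark D) (basis R p)) (N := size_of x)).
  - rewrite -[lift1 _ _]/(elementary (basis R p) [::]); apply: span_elementary => //.
    by apply: gN; rewrite -(occs_size hp) cardsT card_ord.
  - by move=> z /mark_neq0[psi' /occs_size]; rewrite -(occs_size hp) !cardsT !card_ord => ->.
  - by apply/mark_neq0; exists psi.
  - move=> z /mark_neq0[psi' hp'] zx.
    have za := pgraph_aromatic z; have zaT := aromatic_onT za.
    have lz : linked setT (pgraph z) by apply/(linked_occ_k zaT hp')/(linked_occ_k gaT hp).
    have sz : size_of z = size_of x.
      by have := occs_size hp'; rewrite -(occs_size hp) !cardsT !card_ord.
    apply: IH => //; rewrite -/g -/v vr r2 cardsT card_ord -sz -[X in (_ < X)%N]card_ord -cardsT.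
    apply: proper_card; rewrite properEneq subsetT andbT; apply: contra zx => /eqP dz.
    have [rz rz1 rz2] := lz.
    have vz : rz = pmark z.
      apply/eqP/negPn/negP => /eqP ne; have rzd : rz \in desc setT (pgraph z) (pmark z) by rewrite dz in_setT.
      have [w _ e] := desc_succ rzd ne (in_setT _).
      have : rz \in roots_on setT (pgraph z) by rewrite rz1 in_set1.
      by rewrite in_roots_on in_setT /= => /forall_inP/(_ w (in_setT w)); rewrite e.
    have [f1 h1] := root_marked rhoE gaT hp r1; have [f2 h2] := root_marked rhoE zaT hp' rz1.
    rewrite vz in h2; rewrite -vr in h1; apply/eqP.
    rewrite (class_eq (occs_id (pemb z)) h2).
    by rewrite (class_eq (occs_id (pemb x)) h1).
have vd : v \in desc setT g r by rewrite r2 in_setT.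
have [v1 _ vv1] := desc_succ vd vr (in_setT r).
pose W := desc setT g v.
have rno u : arrow g r u = false.
  have : r \in roots g by rewrite rE in_set1.
  by rewrite root_rel // => /forallP/(_ u)/andP[/negbTE].
have v1W : v1 \notin W.
  apply/negP => v1W; have := desc_acyclic gaT (in_setT r) (in_setT v) (fun u _ => rno u) vd v1W.
  by rewrite vv1.
have WT : W \subset setT := subsetT W; have BT : setT :\: W \subset setT := subsetT _.
have gaW := aromatic_on_sub WT gaT; have gaB := aromatic_on_sub BT gaT.
have rW : roots_on W g = [set v] := cutoff_roots ga vv1 v1W.
have rB : roots_on (setT :\: W) g = [set r] by rewrite (cutoff_rest ga vv1).
have [p2 [f2 hp2]] : present (mKF D 1) W (plain g).
  by apply/(present_k 1 gaW); rewrite rW cards1.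
have v1B : v1 \in setT :\: W by rewrite setTDin.
have [x1 [f1 hx1]] : present (mPT D) (setT :\: W) (g, cmark (Some v1)).
  by apply/present_p; rewrite // rB cards1.
have vW : v \in W := cutoff_self g v.
have lW : linked W g.
  exists v => //; rewrite (desc_closed WT vW) // => u w _; exact: cutoff_pred.
have lB : linked (setT :\: W) g.
  exists r => //; apply/eqP; rewrite eqEsubset desc_sub /=.
  have : desc setT g r \subset desc (setT :\: W) g r :|: W.
    have rB' : r \in setT :\: W by have /setP/(_ r) := rB; rewrite in_roots_on in_set1 eqxx => /andP[].
    apply: desc_min; first by rewrite in_setU desc_self.
    move=> u w _; rewrite !in_setU => /orP[wd|wW] e; last by rewrite (cutoff_pred wW e) orbT.
    have [uW|uW] := boolP (u \in W); first by rewrite orbT.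
    by rewrite (desc_pred _ wd e) // setTDin.
  rewrite r2 => /subsetP h; apply/subsetP => u; rewrite setTDin => uW.
  by have := h u (in_setT u); rewrite in_setU (negbTE uW) orbF.
have sz2 : size_of p2 = #|W| := esym (occs_size hp2).
have szx : size_of x = (size_of p2 + size_of x1)%N := cut_size (Y := mPT D) hp2 hx1.
have p2gt : (0 < size_of p2)%N by rewrite sz2; apply/card_gt0P; exists v.
have cW : compose_cut (z := x) W by rewrite /compose_cut (cutoff_cut_type ga vv1 v1W).
have tE : target W (setT :\: W) g = Some v1 := cutoff_target ga vv1 v1W.
have [rho rhoE] := kroot (rep p2 : kforest D 1 _).
apply: (triangular span_comb (e := lift2 (@compose D) (basis R x1) (lift1 (@mark D) (basis R p2))) (N := size_of x)).
- apply: span_compose; last by apply: gN; apply: leq_trans xN; rewrite szx leq_addr.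
  have x1x : (size_of x1 < size_of x)%N by rewrite szx -[X in (X < _)%N]add0n ltn_add2r.
  apply: IHn; first exact: leq_trans x1x xn.
    by apply: leq_trans (ltnW x1x) xN.
  by apply/(linked_occ_p gaB hx1).
- move=> z /compose_mark_neq0[W' [_ [a ha] [b hb]]].
  by rewrite szx -(cut_size (Y := mPT D) ha hb).
- apply/compose_mark_neq0; exists W; split=> //; first by exists f2.
  by exists f1; rewrite tE.
move=> z /compose_mark_neq0[W' [/andP[ct zW'] [a ha] [b hb]]] zx.
have szz : size_of z = size_of x by rewrite szx; exact: (cut_size (Y := mPT D) ha hb).
have za := pgraph_aromatic z; have zaT := aromatic_onT za.
have zaW : aromatic_on W' (pgraph z) := aromatic_on_sub (subsetT _) zaT.
have zaB : aromatic_on (setT :\: W') (pgraph z) := aromatic_on_sub (subsetT _) zaT.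
have [rho1 s1 s2] : linked W' (pgraph z) by apply/(linked_occ_k zaW ha)/(linked_occ_k gaW hp2).
have [rho2 t1 t2] : linked (setT :\: W') (pgraph z).
  by apply/(linked_occ_p zaB hb)/(linked_occ_p gaB hx1).
have /and3P[/eqP/setP ct1 /cards1P[c cE] /eqP ct3] := ct.
have : c \in crossing W' (setT :\: W') (pgraph z) by rewrite cE in_set1.
rewrite in_crossing => /andP[cW' /exists_inP[t tB ct']].
have c1 : c = rho1.
  apply/set1P; rewrite -s1 in_roots_on cW' /=; apply/forall_inP => w wW'; apply/andP; split.
    apply/negP => /(arrow_fun za ct') tw; move: tB; by rewrite tw setTDin wW'.
  by apply/negP => /(arrow_tied za ct').
(* z is another term: W' is its copy of the subtree, and no arrow enters W'. *)
have clW u w : w \in W' -> arrow (pgraph z) u w -> u \in W'.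
  move=> wW e; apply: contraT => uW; have := ct1 u; rewrite in_crossing in_set0 setTDin uW /=.
  by move=> /negbT/exists_inPn/(_ w wW); rewrite e.
have lz : linked setT (pgraph z).
  have [rz rzE] := pgraph_roots z; exists rz; first by rewrite roots_onT.
  have rzr : rz \in roots (pgraph z) by rewrite rzE in_set1.
  rewrite root_rel // in rzr; have rzno w := forallP rzr w.
  have rzB : rz \in setT :\: W'.
    rewrite setTDin; apply/negP => rzW.
    have : rz \in roots_on W' (pgraph z) by rewrite in_roots_on rzW; apply/forall_inP => w _; apply: rzno.
    by rewrite s1 in_set1 -c1 => /eqP rzc; have := rzno t; rewrite rzc ct'.
  have rz2 : rz = rho2.
    by apply/set1P; rewrite -t1 in_roots_on rzB /=; apply/forall_inP => w _; apply: rzno.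
  have B1 : setT :\: W' \subset desc setT (pgraph z) rz.
    by rewrite -{1}t2 -rz2; apply: desc_mono => //; apply: subsetT.
  have cd : c \in desc setT (pgraph z) rz.
    by apply: (desc_pred (in_setT c) _ ct'); apply: (subsetP B1).
  have W1 : W' \subset desc setT (pgraph z) rz.
    apply: subset_trans (desc_trans cd); rewrite -{1}s2 -c1.
    by apply: desc_mono; [apply: subsetT|rewrite cW'].
  apply/setP => u; rewrite in_setT; have [uW|uW] := boolP (u \in W'); first exact: (subsetP W1).
  by apply: (subsetP B1); rewrite setTDin.
have dW : desc setT (pgraph z) (pmark z) \subset W'.
  by apply: desc_min => // u w _; apply: clW.
apply: IH => //; rewrite -/W -sz2 -(occs_size ha); apply: proper_card.
rewrite properEneq dW andbT; apply: contra zx => /eqP dz; apply/eqP.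
have zr : pmark z = rho1.
  apply/eqP; rewrite eq_sym; apply/negPn/negP => /eqP ne.
  have rd : rho1 \in desc setT (pgraph z) (pmark z) by rewrite dz -c1.
  have [w] := desc_succ rd ne (in_setT _); rewrite dz => wW e.
  by move: tB; rewrite -c1 in e; rewrite (arrow_fun za ct' e) setTDin wW.
have [h1 H1] := root_marked rhoE gaW hp2 rW; have [h2 H2] := root_marked rhoE zaW ha s1.
apply: (@compose_unique x1 (pclass (rep p2 : kforest D 1 _) rho)).
  apply/compose_neq0; exists W'; split; first by rewrite /compose_cut ct.
    by exists h2; rewrite zr.
  by exists b.
apply/compose_neq0; exists W; split=> //; first by exists h1.
by exists f1; rewrite tE.
Qed.
End Marked.

(** * Uniqueness of the substitution morphism *)

Section Solve.
Variable R : realType.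

Lemma solve_unique (X : species) (Sp : fsum R X -> Prop) :
  (forall c e e', Sp e -> Sp e' -> Sp (c *: e + e')) ->
  forall (e : fsum R X) q, Sp e -> e q != 0 -> (forall z, e z != 0 -> z = q) -> Sp (basis R q).
Proof.
move=> lin e q es eq u; apply: (triangular lin (e := e) (N := size_of q)) => //.
  by move=> z /u ->.
by move=> z /u ->; rewrite eqxx.
Qed.

(** An operation with a single term leaves nothing to solve for. *)
Lemma solve_lift2 (X Y Z : species) (op : isoclasses X -> isoclasses Y -> seq (isoclasses Z))
    (Sp : fsum R Z -> Prop) p p' q :
  (forall c e e', Sp e -> Sp e' -> Sp (c *: e + e')) -> size (op p p') = 1%N ->
  Sp (lift2 op (basis R p) (basis R p')) -> lift2 op (basis R p) (basis R p') q != 0 ->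
  Sp (basis R q).
Proof.
move=> lin op1 es eq; apply: (solve_unique lin es eq) => z /lift2_basis_supp.
move: (lift2_basis_supp eq); case: (op p p') op1 => [|a []] // _.
by rewrite !mem_seq1 => /eqP-> /eqP->.
Qed.

Lemma solve_lift1 (X Y : species) (op : isoclasses X -> seq (isoclasses Y))
    (Sp : fsum R Y -> Prop) p q :
  (forall c e e', Sp e -> Sp e' -> Sp (c *: e + e')) -> size (op p) = 1%N ->
  Sp (lift1 op (basis R p)) -> lift1 op (basis R p) q != 0 -> Sp (basis R q).
Proof.
move=> lin op1 es eq; apply: (solve_unique lin es eq) => z /lift1_basis_supp.
move: (lift1_basis_supp eq); case: (op p) op1 => [|a []] // _.
by rewrite !mem_seq1 => /eqP-> /eqP->.
Qed.

Lemma linear_comb (U V : lmodType R) (f f' : U -> V) : linear f -> linear f' ->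
  forall c (x y : U), f x = f' x -> f y = f' y -> f (c *: x + y) = f' (c *: x + y).
Proof. by move=> l l' c x y e e'; rewrite l l' e e'. Qed.
End Solve.

Section Cutting.
Variables (R : realType) (D : finType).
Implicit Types (V : finType).

Lemma cut_type00 V (W : {set V}) (g : graph D V) :
  (forall u w, u \in W -> w \notin W -> [/\ arrow g u w = false, arrow g w u = false & tied g u w = false]) ->
  cut_type 0 0 W (setT :\: W) g.
Proof.
move=> no; apply/and3P; split; rewrite ?cards_eq0; apply/eqP/setP => u;
  rewrite ?in_crossing ?in_bonded in_set0 ?setTDin; apply/negP => /andP[uW /exists_inP[w]];
  rewrite ?setTDin => wW.
- by case: (no w u wW uW) => _ ->.
- by case: (no u w uW wW) => ->.
- by case: (no u w uW wW) => _ _ ->.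
Qed.

Lemma kprod_neq0 k j (p : isoclasses (mKF D k)) (p' : isoclasses (mKF D j)) (q : isoclasses (mKF D (k + j))) :
  (lift2 (@kprod D k j) (basis R p) (basis R p') q != 0) <->
  exists W : {set 'I_(size_of q)}, [/\ cut_type 0 0 W (setT :\: W) (rep_graph q),
    exists psi, psi \in occs (pemb p) W (plain (rep_graph q))
  & exists psi, psi \in occs (pemb p') (setT :\: W) (plain (rep_graph q))].
Proof.
apply: (cut_neq0 (Y := mKF D j) (Z := mKF D (k + j))
  (M1 := fun=> plain (rep_graph q)) (M2 := fun=> plain (rep_graph q))).
exact: (ev_kprod _ _ (rep_aromatic q)).
Qed.

Lemma graft_neq0 k (p : isoclasses (mKF D 1)) (p' : isoclasses (mKF D k)) (q : isoclasses (mKF D k)) :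
  (lift2 (@graft D k) (basis R p) (basis R p') q != 0) <->
  exists W : {set 'I_(size_of q)}, [/\ cut_type 1 0 W (setT :\: W) (rep_graph q),
    exists psi, psi \in occs (pemb p) W (plain (rep_graph q))
  & exists psi, psi \in occs (pemb p') (setT :\: W) (plain (rep_graph q))].
Proof.
apply: (cut_neq0 (Y := mKF D k) (Z := mKF D k)
  (M1 := fun=> plain (rep_graph q)) (M2 := fun=> plain (rep_graph q))).
exact: (ev_graft _ _ (rep_aromatic q)).
Qed.

Lemma stolon_neq0 (p p' : isoclasses (mKF D 1)) (q : isoclasses (mKF D 0)) :
  (lift2 (@stolon D) (basis R p) (basis R p') q != 0) <->
  exists W : {set 'I_(size_of q)}, [/\ cut_type 0 1 W (setT :\: W) (rep_graph q),
    exists psi, psi \in occs (pemb p) W (plain (rep_graph q))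
  & exists psi, psi \in occs (pemb p') (setT :\: W) (plain (rep_graph q))].
Proof.
apply: (cut_neq0 (Y := mKF D 1) (Z := mKF D 0)
  (M1 := fun=> plain (rep_graph q)) (M2 := fun=> plain (rep_graph q))).
exact: (ev_stolon _ _ (rep_aromatic q)).
Qed.

Lemma cprod_neq0 (p p' q : isoclasses (mCF D)) :
  (lift2 (@cprod D) (basis R p) (basis R p') q != 0) <->
  exists W : {set 'I_(size_of q)},
    [/\ cut_type 0 0 W (setT :\: W) (forget (rep q)) && saturated setT W (mg_c (rep q)).2,
    exists psi, psi \in occs (pemb p) W (mg_c (rep q))
  & exists psi, psi \in occs (pemb p') (setT :\: W) (mg_c (rep q))].
Proof.
apply: (cut_neq0 (Y := mCF D) (Z := mCF D)
  (M1 := fun=> mg_c (rep q)) (M2 := fun=> mg_c (rep q))).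
exact: (ev_cprod _ _ _ (aromatic_onT (cforest_aromatic (rep q : cforest D _)))).
Qed.

End Cutting.

Section Uniqueness.
Variables (R : realType) (D : finType) (phi : D -> fsum R (KF D 1)).
Variables (A0 A0' : fsum R (KF D 0) -> fsum R (KF D 0))
  (A1 A1' : fsum R (KF D 1) -> fsum R (KF D 1)) (A A' : fsum R (CF D) -> fsum R (CF D)).
Hypotheses (H : substitution_morphism phi A0 A1 A) (H' : substitution_morphism phi A0' A1' A').

Let good0 w := A0 w = A0' w.
Let good1 t := A1 t = A1' t.
Let good x := A x = A' x.
Let lin0 : forall c e e', good0 e -> good0 e' -> good0 (c *: e + e') :=
  linear_comb (sm_linear0 H) (sm_linear0 H').
Let lin1 : forall c e e', good1 e -> good1 e' -> good1 (c *: e + e') :=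
  linear_comb (sm_linear1 H) (sm_linear1 H').
Let lin : forall c e e', good e -> good e' -> good (c *: e + e') :=
  linear_comb (sm_linear H) (sm_linear H').

Lemma good_size1 (q : isoclasses (KF D 1)) : size_of q = 1%N -> good1 (basis R q).
Proof. by move=> /size1_dot[d ->]; rewrite /good1 (sm_vertex H) (sm_vertex H'). Qed.

Lemma good_size0 (q : isoclasses (KF D 0)) : size_of q = 0%N -> good0 (basis R q).
Proof. by move=> /size0_nil ->; rewrite /good0 (sm_one0 H) (sm_one0 H'). Qed.

Lemma good_trace e : span good1 e -> good0 (lift1 (@trace D) e).
Proof.
elim=> [t us ht hus|c e1 e2 _ IH1 _ IH2]; last by rewrite lift1_lin; apply: lin0.
rewrite /good0 (sm_trace H) (sm_trace H') ht; congr (lift1 _ (elementary _ _)).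
elim: hus => [//|u us' hu _ IH]; by rewrite /= hu IH.
Qed.

Lemma good_graft1 t u : good1 t -> good1 u -> good1 (lift2 (@graft D 1) t u).
Proof. by move=> gt gu; rewrite /good1 (sm_graft1 H) (sm_graft1 H') gt gu. Qed.
Lemma good_prod1 w t : good0 w -> good1 t -> good1 (lift2 (@kprod D 0 1) w t).
Proof. by move=> gw gt; rewrite /good1 (sm_prod1 H) (sm_prod1 H') gw gt. Qed.
Lemma good_prod0 w w' : good0 w -> good0 w' -> good0 (lift2 (@kprod D 0 0) w w').
Proof. by move=> gw gt; rewrite /good0 (sm_prod0 H) (sm_prod0 H') gw gt. Qed.
Lemma good_stolon t u : good1 t -> good1 u -> good0 (lift2 (@stolon D) t u).
Proof. by move=> gt gu; rewrite /good0 (sm_stolon H) (sm_stolon H') gt gu. Qed.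
Lemma good_cprod x y : good x -> good y -> good (lift2 (@cprod D) x y).
Proof. by move=> gt gu; rewrite /good (sm_prod H) (sm_prod H') gt gu. Qed.
Lemma good_ctree t : good1 t -> good (lift1 (@tree D) t).
Proof. by move=> gt; rewrite /good (sm_tree H) (sm_tree H') gt. Qed.

(** A tree whose root receives an arrow from r1 is the grafting of the subtree at r1
    onto the rest, up to terms that graft this subtree elsewhere and so have fewer
    arrows into the root. If the root receives no arrow, the tree is a vertex or the
    product of an aroma and a vertex. *)
Lemma good_tree n :
  (forall p : isoclasses (mKF D 0), (size_of p < n)%N -> good0 (basis R p)) ->
  (forall p : isoclasses (mKF D 1), (size_of p < n)%N -> good1 (basis R p)) ->
  forall q : isoclasses (mKF D 1), size_of q = n -> good1 (basis R q).
Proof.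
move=> h0 h1 q; have [k] := ubnP (indeg (rep_graph q)).
elim: k q => // k IHk q; rewrite ltnS => qk qn.
set g := rep_graph q in qk; have ga : aromatic g := kforest_aromatic _.
have gaT := aromatic_onT ga.
have [r rE] := kroot (rep q : kforest D 1 _); rewrite -[val _]/g in rE.
have rr : r \in roots g by rewrite rE in_set1.
have rno w : arrow g r w = false by move: rr; rewrite root_rel // => /forallP/(_ w)/andP[/negbTE].
have rno' w : tied g r w = false by move: rr; rewrite root_rel // => /forallP/(_ w)/andP[_ /negbTE].
case: (pickP (fun u => arrow g u r)) => [r1 r1r|noin].
  pose W := desc setT g r1.
  have rW : r \notin W.
    apply/negP => rd; have rr1 : r <> r1 by move=> e; rewrite -e rno in r1r.
    by have [w _] := desc_succ rd rr1 (in_setT _); rewrite rno.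
  have gaW := aromatic_on_sub (subsetT W) gaT; have gaB := aromatic_on_sub (subsetT (setT :\: W)) gaT.
  have rtW : roots_on W g = [set r1] := cutoff_roots ga r1r rW.
  have rtB : roots_on (setT :\: W) g = [set r] by rewrite (cutoff_rest ga r1r).
  have [p [f hp]] : present (mKF D 1) W (plain g) by apply/(present_k 1 gaW); rewrite rtW cards1.
  have [p' [f' hp']] : present (mKF D 1) (setT :\: W) (plain g).
    by apply/(present_k 1 gaB); rewrite rtB cards1.
  have szq : size_of q = (size_of p + size_of p')%N := cut_size (Y := mKF D 1) hp hp'.
  have p_gt : (0 < size_of p)%N.
    by rewrite -(occs_size hp); apply/card_gt0P; exists r1; apply: cutoff_self.
  have p'_gt : (0 < size_of p')%N by rewrite -(occs_size hp'); apply/card_gt0P; exists r; rewrite setTDin.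
  have gp : good1 (basis R p) by apply: h1; rewrite -qn szq -[X in (X < _)%N]addn0 ltn_add2l.
  have gp' : good1 (basis R p') by apply: h1; rewrite -qn szq -[X in (X < _)%N]add0n ltn_add2r.
  have eq0 : lift2 (@graft D 1) (basis R p) (basis R p') q != 0.
    apply/graft_neq0; exists W; split; [exact: cutoff_cut_type r1r rW|by exists f|by exists f'].
  have grafted z : lift2 (@graft D 1) (basis R p) (basis R p') z != 0 ->
      exists w, z = kclass (kgraft (rep p) (rep p' : kforest D 1 _) w).
    by move=> /lift2_basis_supp/mapP[w _ ->]; exists w.
  (* The rest has lost the arrow from r1 to the root. *)
  have lt : (indeg (rep_graph p') < indeg g)%N.
    have /occsP[fI fB fE] := hp'.
    have gE : gpull f' g = rep_graph p' by have := congr1 (fun M : mgraph D _ => M.1) fE.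
    pose F (e : 'I_(size_of p') * 'I_(size_of p')) := (f' e.1, f' e.2).
    have FI : injective F by move=> [a b] [c d] [/fI -> /fI ->].
    rewrite -gE /indeg -(card_imset _ FI); apply: proper_card; apply/properP; split.
      apply/subsetP => _ /imsetP[[a b] + ->]; rewrite in_set [X in is_true X -> _]in_set => /andP[ab rb].
      rewrite [arrow _ _ _]arrow_pull in ab; apply/andP; split; first exact: ab.
      have : f' b \in f' @: roots (gpull f' g) by rewrite imset_f.
      by rewrite (roots_pull fI fB gaB) rtB -rE.
    exists (r1, r); first by rewrite in_set /= r1r.
    apply/imsetP => -[[a b] _ [e _]]; have : f' a \in setT :\: W by rewrite -fB imset_f.
    by rewrite -e setTDin cutoff_self.
  have [wq qE] := grafted q eq0.
  have ig z w : z = kclass (kgraft (rep p) (rep p' : kforest D 1 _) w) ->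
      indeg (rep_graph z) = (indeg (rep_graph p') + (w \in roots (rep_graph p')))%N.
    by move=> ->; rewrite indeg_kclass indeg_kgraft.
  (* Getting this arrow back requires grafting onto the root. *)
  have wqr : wq \in roots (rep_graph p').
    by apply: contraLR lt => wn; rewrite [indeg g](ig q wq qE) (negbTE wn) addn0 ltnn.
  apply: (triangular lin1 (e := lift2 (@graft D 1) (basis R p) (basis R p')) (N := size_of q)).
  - exact: good_graft1.
  - move=> z /graft_neq0[W' [_ [a ha] [b hb]]].
    by rewrite szq -(cut_size (Y := mKF D 1) ha hb).
  - exact: eq0.
  move=> z ez zq; have [w zE] := grafted z ez.
  have zs : size_of z = n.
    have /graft_neq0[W' [_ [a ha] [b hb]]] := ez.
    by rewrite -qn szq; exact: (cut_size (Y := mKF D 1) ha hb).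
  apply: IHk => //; apply: leq_trans qk; rewrite (ig z w zE).
  have -> : (w \in roots (rep_graph p')) = false; last by rewrite addn0.
  apply/negP => wr; have [r' r'E] := kroot (rep p' : kforest D 1 _).
  rewrite -[val _]/(rep_graph p') in r'E.
  move/eqP: zq; apply; rewrite zE qE; congr (kclass (kgraft _ _ _)).
  by move: wr wqr; rewrite r'E !in_set1 => /eqP-> /eqP->.
have [n1|n1] := eqVneq n 1%N; first by apply: good_size1; rewrite qn.
pose W := ~: [set r].
have WE u : (u \in W) = (u != r) by rewrite in_setC in_set1.
have BE : setT :\: W = [set r] by rewrite setTD setCK.
have gaW := aromatic_on_sub (subsetT W) gaT; have gaB := aromatic_on_sub (subsetT (setT :\: W)) gaT.
have ct : cut_type 0 0 W (setT :\: W) g.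
  apply: cut_type00 => u w _; rewrite WE negbK => /eqP->.
  by split; [exact: (noin u)|exact: rno|rewrite tied_sym; exact: rno'].
have rtW : roots_on W g = set0.
  rewrite (roots_on_closed gaT (subsetT W)) ?roots_onT //.
    by apply/setP => u; rewrite in_setI WE rE in_set1 in_set0 andNb.
  move=> u w; rewrite !WE => _ _ uw; apply/eqP => wr; move: uw.
  by rewrite wr tied_sym rno' [arrow _ _ _](noin u).
have rtB : roots_on (setT :\: W) g = [set r].
  rewrite (roots_on_closed gaT (subsetT _)) ?roots_onT ?BE ?rE ?setIid //.
  by move=> u w; rewrite in_set1 => /eqP-> _; rewrite rno rno'.
have [p [f hp]] : present (mKF D 0) W (plain g) by apply/(present_k 0 gaW); rewrite rtW cards0.
have [p' [f' hp']] : present (mKF D 1) (setT :\: W) (plain g).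
  by apply/(present_k 1 gaB); rewrite rtB cards1.
have szq : size_of q = (size_of p + size_of p')%N := cut_size (Y := mKF D 1) hp hp'.
have p'1 : size_of p' = 1%N by rewrite -(occs_size hp') BE cards1.
apply: (solve_lift2 (op := @kprod D 0 1) (p := p) (p' := p') lin1); first by [].
  apply: good_prod1; last exact: good_size1 p'1.
  by apply: h0; rewrite -qn szq p'1 addn1.
apply: (proj2 (@kprod_neq0 R D 0 1 p p' q)); exists W; split=> //; [by exists f|by exists f'].
Qed.

(** An end r of a stolon, with its descendants, is a tree, tied to the rest, which is a
    tree rooted at the other end. Without stolons every vertex has an arrow, and a
    vertex r with as many descendants as possible lies on a cycle: its descendants
    descend from its successor too, which is therefore one of them. If the
    descendants of r are not all vertices, they split off as a factor; otherwise the
    aroma is the trace of the tree obtained by cutting the arrow of r, and that tree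
    is spanned by elementary endomorphisms. *)
Lemma good_aroma n :
  (forall p : isoclasses (mKF D 0), (size_of p < n)%N -> good0 (basis R p)) ->
  (forall p : isoclasses (mKF D 1), (size_of p <= n)%N -> good1 (basis R p)) ->
  forall q : isoclasses (mKF D 0), size_of q = n -> good0 (basis R q).
Proof.
move=> h0 h1 q qn; have [q0|q0] := eqVneq (size_of q) 0%N; first exact: good_size0.
set g := rep_graph q; have ga : aromatic g := kforest_aromatic _.
have gaT := aromatic_onT ga.
have rE : roots g = set0.
  by apply/eqP; rewrite -cards_eq0; have := kforest_roots (rep q : kforest D 0 _) => ->.
have out u : exists w, arrow g u w \/ tied g u w.
  have : u \notin roots g by rewrite rE in_set0.
  rewrite root_rel // => /forallPn[w]; rewrite negb_and !negbK => /orP[e|e]; exists w; by [left|right].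
have cutsz (W : {set 'I_(size_of q)}) u w : u \in W -> w \notin W ->
   (#|W| < n)%N /\ (#|setT :\: W| < n)%N.
  move=> uW wW; have c : (#|W| + #|~: W|)%N = n by rewrite cardsC card_ord.
  rewrite setTD.
  have u0 : (0 < #|W|)%N by apply/card_gt0P; exists u.
  have w0 : (0 < #|~: W|)%N by apply/card_gt0P; exists w; rewrite in_setC.
  by split; rewrite -c; [rewrite -[X in (X < _)%N]addn0 ltn_add2l|rewrite -[X in (X < _)%N]add0n ltn_add2r].
case: (pickP (fun e : 'I_(size_of q) * 'I_(size_of q) => tied g e.1 e.2)) => [[r s] /= rs|noties].
  have sr : tied g s r by rewrite tied_sym.
  have rno w : arrow g r w = false by apply/negP => /(arrow_tied ga)/(_ rs).
  have sno w : arrow g s w = false by apply/negP => /(arrow_tied ga)/(_ sr).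
  pose W := desc setT g r; have rW : r \in W by apply: desc_self; rewrite in_setT.
  have sW : s \notin W.
    apply/negP => sW; have sr' : s <> r by move=> e; move: rs; rewrite e /tied eqxx.
    by have [w _] := desc_succ sW sr' (in_setT _); rewrite sno.
  have clW u w : w \in W -> arrow g u w -> u \in W.
    by move=> wW e; apply: (desc_pred (in_setT u) wW e).
  have tW u w : u \in W -> w \notin W -> tied g u w -> u = r /\ w = s.
    move=> uW wW t; have ur : u = r.
      apply/eqP/negPn/negP => /eqP ur.
      by rewrite (desc_untied gaT (in_setT r) uW ur (in_setT w)) in t.
    by split=> //; rewrite ur in t; apply: (tied_fun ga t rs).
  have gaW := aromatic_on_sub (subsetT W) gaT; have gaB := aromatic_on_sub (subsetT (setT :\: W)) gaT.
  have ct : cut_type 0 1 W (setT :\: W) g.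
    apply/and3P; split; rewrite ?cards_eq0.
    - apply/eqP/setP => u; rewrite in_crossing in_set0 setTDin; apply/negP => /andP[uW /exists_inP[w wW e]].
      by rewrite (clW u w) in uW.
    - apply/eqP/setP => u; rewrite in_crossing in_set0; apply/negP => /andP[uW /exists_inP[w]].
      rewrite setTDin => wW e; have [ur|/eqP ur] := eqVneq u r; first by rewrite ur rno in e.
      by move/negP: wW; apply; apply: (desc_next gaT (in_setT r) uW ur (in_setT w) e).
    - suff -> : bonded W (setT :\: W) g = [set r] by rewrite cards1.
      apply/setP => u; rewrite in_bonded in_set1; apply/andP/eqP => [[uW /exists_inP[w]]|->].
        by rewrite setTDin => wW /(tW u w uW wW)[].
      by split=> //; apply/exists_inP; exists s; rewrite ?setTDin.
  have rtW : roots_on W g = [set r] by apply: (desc_root gaT (in_setT r)).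
  have rtB : roots_on (setT :\: W) g = [set s].
    apply/setP => u; rewrite in_roots_on in_set1 setTDin; apply/andP/eqP => [[uW /forall_inP no]|->].
      have [w e] := out u; have wW : w \in W.
        apply: contraT => wW; have := no w; rewrite setTDin => /(_ wW).
        by case: e => ->; rewrite ?andbF.
      case: e => e; first by rewrite (clW u w) in uW.
      by rewrite tied_sym in e; have [] := tW w u wW uW e.
    split=> //; apply/forall_inP => w; rewrite setTDin sno => wW /=.
    by apply/negP => /(tied_fun ga sr) e; rewrite -e rW in wW.
  have [p [f hp]] : present (mKF D 1) W (plain g) by apply/(present_k 1 gaW); rewrite rtW cards1.
  have [p' [f' hp']] : present (mKF D 1) (setT :\: W) (plain g).
    by apply/(present_k 1 gaB); rewrite rtB cards1.
  have [c1 c2] := cutsz W r s rW sW.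
  apply: (solve_lift2 (op := @stolon D) (p := p) (p' := p') lin0); first by [].
    apply: good_stolon; apply: h1; first by rewrite -(occs_size hp) ltnW.
    by rewrite -(occs_size hp') ltnW.
  apply: (proj2 (@stolon_neq0 R D p p' q)); exists W; split=> //; [by exists f|by exists f'].
have {}noties u w : tied g u w = false := noties (u, w).
have {}out u : exists w, arrow g u w by have [w []] := out u; [exists w|rewrite noties].
have v0 : 'I_(size_of q) by apply: (Ordinal (m := 0)); rewrite lt0n.
have [r _ rmax] : exists2 r, true & forall w, (#|desc setT g w| <= #|desc setT g r|)%N.
  by exists [arg max_(r > v0) #|desc setT g r|] => //; case: arg_maxnP => // r _ h w; apply: h.
have [v rv] := out r; pose W := desc setT g r.
have rW : r \in W by apply: desc_self; rewrite in_setT.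
(* As r has the most descendants, v has no more, so r lies on a cycle through v. *)
have vW : v \in W.
  have vd : v \in desc setT g v by apply: desc_self; rewrite in_setT.
  have sub : W \subset desc setT g v by apply: desc_trans; apply: (desc_pred (in_setT r) vd rv).
  suff -> : W = desc setT g v by [].
  by apply/eqP; rewrite eqEcard sub rmax.
have clW u w : arrow g u w -> (u \in W) = (w \in W).
  move=> e; apply/idP/idP => [uW|wW]; last exact: (desc_pred (in_setT u) wW e).
  have [ur|/eqP ur] := eqVneq u r; first by rewrite -(arrow_fun ga rv (w' := w)) // -ur.
  exact: (desc_next gaT (in_setT r) uW ur (in_setT w) e).
have [WT|] := eqVneq W setT; last first.
  rewrite -subTset => /subsetPn[s _ sW].
  have gaW := aromatic_on_sub (subsetT W) gaT; have gaB := aromatic_on_sub (subsetT (setT :\: W)) gaT.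
  have ct : cut_type 0 0 W (setT :\: W) g.
    apply: cut_type00 => u w uW wW; rewrite noties; split=> //; apply/negP => /clW;
      by rewrite uW (negbTE wW).
  have no_root (B : {set 'I_(size_of q)}) : (forall u w, arrow g u w -> (u \in B) = (w \in B)) ->
      roots_on B g = set0.
    move=> clB; apply/setP => u; rewrite in_roots_on in_set0; apply/negP => /andP[uB /forall_inP no].
    by have [w e] := out u; have := no w; rewrite -(clB u w e) e => /(_ uB).
  have rtW := no_root W clW.
  have rtB : roots_on (setT :\: W) g = set0 by apply: no_root => u w /clW; rewrite !setTDin => ->.
  have [p [f hp]] : present (mKF D 0) W (plain g) by apply/(present_k 0 gaW); rewrite rtW cards0.
  have [p' [f' hp']] : present (mKF D 0) (setT :\: W) (plain g).
    by apply/(present_k 0 gaB); rewrite rtB cards0.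
  have [c1 c2] := cutsz W r s rW sW.
  apply: (solve_lift2 (op := @kprod D 0 0) (p := p) (p' := p') lin0); first by [].
    apply: good_prod0; apply: h0; first by rewrite -(occs_size hp).
    by rewrite -(occs_size hp').
  apply: (proj2 (@kprod_neq0 R D 0 0 p p' q)); exists W; split=> //; [by exists f|by exists f'].
have ca := cut_aromatic r ga; have caT := aromatic_onT ca.
have rc : roots (cut r g) = [set r].
  apply/setP => u; rewrite root_rel // in_set1; apply/forallP/eqP => [no|-> w].
    apply/eqP/negPn/negP => ur; have [w e] := out u; have := no w.
    by rewrite arrow_cut ur e.
  by rewrite arrow_cut tied_cut eqxx.
have [x [psi hx]] : present (mPT D) setT (cut r g, cmark (Some v)).
  by apply/present_p; rewrite ?in_setT // roots_onT // rc cards1.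
have lx : linked setT (pgraph x).
  apply/(linked_occ_p caT hx); exists r; first by rewrite roots_onT.
  have [d|] := desc_cut setT g r; last by rewrite in_setT.
  by move: (d : W \subset _); rewrite WT subTset => /eqP.
have xn : size_of x = n by rewrite -(occs_size hx) cardsT card_ord.
have sx : span good1 (basis R x) by apply: (marked_span (N := n)); rewrite ?xn.
apply: (solve_lift1 (op := @trace D) (p := x) lin0); [by []|exact: good_trace|].
rewrite (ev_neq0_coef) [ev _ _ _](ev_trace _ (rep_aromatic q)).
have pos e : 0 <= ev (basis R x) setT (cut e.1 (rep_graph q), cmark (Some e.2)).
  by rewrite ev_basis ler0n.
rewrite (bigD1 (r, v)) /=; last by rewrite /arrows_in !in_setT.
apply: lt0r_neq0; apply: ltr_pwDl; last by apply: sumr_ge0 => e _; apply: pos.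
by apply/(ev_basis_gt0 R); exists psi.
Qed.

Lemma good_small n :
  (forall p : isoclasses (mKF D 0), (size_of p < n)%N -> good0 (basis R p)) /\
  (forall p : isoclasses (mKF D 1), (size_of p < n)%N -> good1 (basis R p)).
Proof.
elim: n => [|n [IH0 IH1]]; first by [].
have h1 (p : isoclasses (mKF D 1)) : (size_of p <= n)%N -> good1 (basis R p).
  by rewrite leq_eqVlt => /orP[/eqP|/IH1 //]; exact: good_tree.
split=> p; rewrite ltnS; last exact: h1.
by rewrite leq_eqVlt => /orP[/eqP|/IH0 //]; exact: good_aroma.
Qed.

(** A forest with several roots is the product of one of its clumps and the others. *)
Lemma good_clumped (q : isoclasses (mCF D)) : good (basis R q).
Proof.
have [n] := ubnP (size_of q); elim: n q => // n IH q; rewrite ltnS => qn.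
set c : cforest D _ := rep q; set g := forget c.
have ga : aromatic g := cforest_aromatic c; have gaT := aromatic_onT ga.
have /clumpingP[h1 h2 h3 h4] := cforest_clumping c; rewrite -/g in h1 h2 h3 h4.
have mE v : (mg_c c).2 v = Some (clump c v) by rewrite ffunE.
have [r0|[r rr]] := set_0Vmem (roots g).
  have no (v : 'I_(size_of q)) : False by have := h1 v; rewrite r0 in_set0.
  have q0 : q = cclass (cnil D).
    pose f0 : {ffun void -> 'I_(size_of q)} := [ffun v : void => match v with end].
    have h : f0 \in occs (mg_c (cnil D)) setT (mg_c c).
      apply/occsP; split; first by case.
        by apply/setP => v; case: (no v).
      apply/eqP; rewrite eq_mg_c //.
      apply/andP; split; last by apply/forallP => -[].
      by apply/eqP/graph_ext; rewrite ?cforest_aromatic //; apply: gpull_aromatic => // -[].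
    have [f hf] : exists f, f \in occs (pemb (cclass (cnil D))) setT (mg_c c).
      by apply/card_gt0P; rewrite occs_cclass; apply/card_gt0P; eexists; exact: h.
    exact: (class_eq (occs_id (pemb q)) hf).
  by rewrite q0 /good (sm_one H) (sm_one H').
have [r1|r1] := eqVneq (roots g) [set r].
  have [p [psi hp]] : present (mKF D 1) setT (plain g).
    by apply/(present_k 1 gaT); rewrite roots_onT // r1 cards1.
  apply: (solve_lift1 (op := @tree D) (p := p) lin); first by [].
    by apply: good_ctree; have [_] := good_small (size_of p).+1; apply.
  rewrite (ev_neq0_coef) [ev _ _ _](ev_tree _ gaT (clumping_on_rep c)).
  by apply: lt0r_neq0; apply/(ev_basis_gt0 R); exists psi.
pose W : {set 'I_(size_of q)} := [set v | clump c v == r].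
have WE v : (v \in W) = (clump c v == r) by rewrite in_set.
have ct : cut_type 0 0 W (setT :\: W) g.
  apply: cut_type00 => u w; rewrite !WE => /eqP uW wW; split; apply/negP => e.
  - by rewrite -(h3 _ _ e) uW eqxx in wW.
  - by rewrite (h3 _ _ e) uW eqxx in wW.
  - move/andP: e => [uw e]; rewrite -(h4 _ u w e) ?set21 ?set22 //= in wW.
    by rewrite uW eqxx in wW.
have sat : saturated setT W (mg_c c).2.
  apply/forall_inP => u _; apply/forall_inP => w _; apply/implyP; rewrite mE => /eqP[<-].
  by rewrite !WE (h2 (clump c u)).
have [mW mB] := clumping_on_sub gaT (clumping_on_rep c) (subsetT W) ct sat.
have gaW := aromatic_on_sub (subsetT W) gaT; have gaB := aromatic_on_sub (subsetT (setT :\: W)) gaT.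
have [p [f hp]] := present_c gaW mW; have [p' [f' hp']] := present_c gaB mB.
have szq : size_of q = (size_of p + size_of p')%N := cut_size (Y := mCF D) hp hp'.
have [s sr srr] : exists2 s, s \in roots g & s != r.
  apply/exists_inP; apply: contraNT r1 => /exists_inPn no; rewrite eqEsubset sub1set rr andbT.
  by apply/subsetP => u /no; rewrite negbK in_set1.
have p0 : (0 < size_of p)%N.
  by rewrite -(occs_size hp); apply/card_gt0P; exists r; rewrite WE h2.
have p'0 : (0 < size_of p')%N.
  by rewrite -(occs_size hp'); apply/card_gt0P; exists s; rewrite setTDin WE h2.
apply: (solve_lift2 (op := @cprod D) (p := p) (p' := p') lin); first by [].
  apply: good_cprod; apply: IH; apply: leq_trans qn; rewrite szq.
    by rewrite -[X in (X < _)%N]addn0 ltn_add2l.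
  by rewrite -[X in (X < _)%N]add0n ltn_add2r.
apply: (proj2 (@cprod_neq0 R D p p' q)); exists W; split; [exact/andP|by exists f|by exists f'].
Qed.

(** By linearity and continuity, a coefficient of the image depends only on finitely
    many coefficients of the argument. *)
Theorem substitution_unique : A = A'.
Proof.
apply/funext => x; apply/funext => q.
have [m Am] := sm_continuous H (size_of q).+1; have [m' Am'] := sm_continuous H' (size_of q).+1.
pose N := maxn m m'.
pose y : fsum R (CF D) := \sum_(z <- classes_upto (CF D) N) x z *: basis R z.
have yE z : (size_of z < N)%N -> y z = x z.
  move=> zN; rewrite /y fct_sumE (@big_single R (isoclasses (CF D)) _ z) ?classes_upto_uniq //.
  - by rewrite /basis !fctE eqxx /GRing.scale /= mulr1.
  - by rewrite classes_uptoP ltnW.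
  by move=> z' zz'; rewrite /basis !fctE eq_sym (negbTE zz') /GRing.scale /= mulr0.
have gy : good y.
  rewrite /y; elim: (classes_upto (CF D) N) => [|z L IH]; last by rewrite big_cons; apply: lin => //; apply: good_clumped.
  have z0 : (0 : fsum R (CF D)) = -1 *: basis R (cclass (cnil D)) + basis R (cclass (cnil D)).
    by rewrite scaleN1r addNr.
  by rewrite big_nil z0; apply: lin; apply: good_clumped.
have xE : x = -1 *: (y - x) + y by rewrite scaleN1r opprB subrK.
have small k : (k <= N)%N -> forall p, (size_of p < k)%N -> (y - x) p = 0.
  by move=> kN p pk; rewrite !fctE yE ?subrr //; apply: leq_trans pk kN.
rewrite xE (sm_linear H) (sm_linear H') !fctE.
rewrite (Am _ (small _ (leq_maxl _ _))) // (Am' _ (small _ (leq_maxr _ _))) //.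
by have -> : A y q = A' y q by rewrite gy.
Qed.
End Uniqueness.

(** * Coloured partitions are contractions *)

Section Characters.
Variables (R : realType) (D : finType).
Implicit Types (U V W : finType).

Lemma sum_reindex (I J : finType) (f : J -> I) (P : pred I) (F : I -> R) :
  injective f -> (forall j, P (f j)) -> (forall i, P i -> exists j, f j = i) ->
  \sum_(i | P i) F i = \sum_j F (f j).
Proof.
move=> fI fP sur; rewrite -(big_imset F (A := predT)) /=; last by move=> x y _ _; apply: fI.
apply: eq_bigl => i; apply/idP/imsetP => [/sur[j <-]|[j _ ->]]; last exact: fP.
by exists j.
Qed.

(** The pairing absorbs the symmetry factor of delta_sigma. *)
Lemma ev_delta_k k (b : isoclasses (KF D k) -> R) W (t : kforest D k W) U (A : {set U}) M psi :
  psi \in occs (mg_k t) A M -> ev (delta_sigma b) A M = b (kclass t).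
Proof.
move=> h; have [f hf] : exists f, f \in occs (pemb (kclass t)) A M.
  by apply/card_gt0P; rewrite occs_kclass; apply/card_gt0P; exists psi.
rewrite (ev_class _ hf) class_rep /delta_sigma divfK //.
exact: (@sigma_gt0 R D (mKF D k)).
Qed.

Lemma ev_delta_c (b : isoclasses (CF D) -> R) W (t : cforest D W) U (A : {set U}) M psi :
  psi \in occs (mg_c t) A M -> ev (delta_sigma b) A M = b (cclass t).
Proof.
move=> h; have [f hf] : exists f, f \in occs (pemb (cclass t)) A M.
  by apply/card_gt0P; rewrite occs_cclass; apply/card_gt0P; exists psi.
rewrite (ev_class _ hf) class_rep /delta_sigma divfK //.
exact: (@sigma_gt0 R D (mCF D)).
Qed.

(** A product over the clumps of q can be computed in any graph that contains a copy of
    q, without choosing representatives of the clumps. *)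
Lemma clump_product (b : isoclasses (KF D 1) -> R) W (q : cforest D W) U (A : {set U}) g m psi :
  psi \in occs (mg_c q) A (g, m) -> aromatic_on A g ->
  \prod_(r : {r | r \in roots (forget q)}) b (kclass (cclump r)) =
  \prod_(u in roots_on A g) ev (delta_sigma b) [set v in A | m v == Some u] (plain g).
Proof.
move=> /occsP[pI pA pM] ga.
have /andP[/eqP gE /forallP mE] : (gpull psi g == forget q) &&
    [forall w, m (psi w) == Some (psi (clump q w))] by rewrite -eq_mg_c //; apply/eqP.
have rE : roots_on A g = psi @: roots (forget q) by rewrite -gE (roots_pull pI pA ga).
rewrite rE big_imset /=; last by move=> x y _ _; apply: pI.
rewrite [RHS]big_sub; apply: eq_bigr => r _.
pose f : {ffun {v | clump q v == val r} -> U} := [ffun v => psi (val v)].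
symmetry; apply: (ev_delta_k b (psi := f)); apply/occsP; split.
- by move=> x y; rewrite !ffunE => /pI/val_inj.
- apply/setP => u; rewrite in_set; apply/imsetP/andP => [[v _ ->]|[]].
    by rewrite ffunE -pA imset_f // (eqP (mE _)) (eqP (valP v)).
  rewrite -pA => /imsetP[v _ ->]; rewrite (eqP (mE v)) => /eqP[/pI e].
  have vr : clump q v == val r by apply/eqP.
  by exists (exist _ v vr); rewrite ?ffunE.
- apply/eqP; rewrite eq_mg_k; apply/eqP.
  transitivity (gpull (val : {v | clump q v == val r} -> W) (gpull psi g)); last by rewrite gE.
  by apply: gpull_comp => v; rewrite ffunE.
Qed.

Lemma clump_character_occ (b : isoclasses (KF D 1) -> R) W (q : cforest D W) U (A : {set U}) g m psi :
  psi \in occs (mg_c q) A (g, m) -> aromatic_on A g -> clump_character b (cclass q) =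
  \prod_(u in roots_on A g) ev (delta_sigma b) [set v in A | m v == Some u] (plain g).
Proof.
move=> h ga; have [f hf] : exists f, f \in occs (pemb (cclass q)) A (g, m).
  by apply/card_gt0P; rewrite occs_cclass; apply/card_gt0P; exists psi.
exact: (clump_product b hf ga).
Qed.
End Characters.

Section Partitions.
Variables (D : finType) (V : finType) (c : cforest D V).
Let g := forget c.
Let ga : aromatic g := cforest_aromatic c.

Section OnePart.
Variable p : cpart c.
Let h := val p.
Let ha : aromatic (forget h) := cforest_aromatic h.

Lemma part_root v : (clump h v == v) = (v \in roots (forget h)).
Proof.
have /clumpingP[h1 h2 _ _] := cforest_clumping h.
by apply/eqP/idP => [<-|/h2].
Qed.

Lemma part_arrow_sub v w : arrow (forget h) v w -> arrow g v w.
Proof. by have /and4P[/subsetP sE _ _ _] := valP p; apply: sE. Qed.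
Lemma part_stolon_sub t : t \in stolons (forget h) -> t \in stolons g.
Proof. by have /and4P[_ /subsetP sS _ _] := valP p; apply: sS. Qed.
Lemma part_tied_sub v w : tied (forget h) v w -> tied g v w.
Proof. by move=> /andP[vw /part_stolon_sub t]; rewrite /tied vw. Qed.

Lemma part_nonroot v : v \notin roots (forget h) ->
  exists w, arrow (forget h) v w || tied (forget h) v w.
Proof.
rewrite root_rel // => /forallPn[w]; rewrite negb_and !negbK => e; by exists w.
Qed.

(** A vertex has at most one arrow or stolon, so a partition keeps it exactly when the
    vertex is not a root of the partition. *)
Lemma part_arrow v w : arrow (forget h) v w = arrow g v w && (v \notin roots (forget h)).
Proof.
apply/idP/andP => [e|[e /part_nonroot[w' /orP[e'|e']]]].
- split; first exact: part_arrow_sub.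
  by rewrite root_rel //; apply/forallPn; exists w; rewrite e.
- by rewrite (arrow_fun ga e (part_arrow_sub e')).
- by case: (arrow_tied ga e (part_tied_sub e')).
Qed.

Lemma part_tied v w : tied (forget h) v w = tied g v w && (v \notin roots (forget h)).
Proof.
apply/idP/andP => [e|[e /part_nonroot[w' /orP[e'|e']]]].
- split; first exact: part_tied_sub.
  by rewrite root_rel //; apply/forallPn; exists w; rewrite e andbF.
- by case: (arrow_tied ga (part_arrow_sub e') e).
- by rewrite (tied_fun ga e (part_tied_sub e')).
Qed.

Lemma part_deco : deco (forget h) = deco g.
Proof. by have /and4P[_ _ /eqP] := valP p. Qed.

Lemma part_clump v : clump c (clump h v) = clump c v.
Proof. by have /and4P[_ _ _ /forallP/(_ v)/eqP] := valP p. Qed.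

Lemma part_stolon t : (t \in stolons (forget h)) = (t \in stolons g) && [disjoint t & roots (forget h)].
Proof.
apply/idP/andP => [tS|[tS dis]].
  split; first exact: part_stolon_sub.
  rewrite disjoint_subset; apply/subsetP => v vt; rewrite inE; apply/negP => /rootsP[_ /(_ t tS)].
  by rewrite vt.
have [v [w [tE vw]]] := stolonP ga tS.
have : v \notin roots (forget h) by have /pred0P/(_ v) := dis; rewrite /= tE set21 /= => ->.
by move=> vr; have : tied (forget h) v w; [rewrite part_tied vw|rewrite tE => /andP[]].
Qed.
End OnePart.

Lemma cpart_eq (p p' : cpart c) : (forall v, clump (val p) v = clump (val p') v) -> p = p'.
Proof.
move=> e; apply: val_inj; apply: val_inj; rewrite [LHS]surjective_pairing [RHS]surjective_pairing.
have rE v : (v \in roots (forget (val p))) = (v \in roots (forget (val p'))).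
  by rewrite -!part_root e.
congr (_, _); last exact/ffunP.
apply: graph_ext; rewrite ?cforest_aromatic //.
- by move=> v w; rewrite [LHS]part_arrow [RHS]part_arrow rE.
- by move=> v w; rewrite [LHS]part_tied [RHS]part_tied rE.
- by move=> v; rewrite [deco _]part_deco [in RHS]part_deco.
Qed.

Definition labelled_part : finType := {h : cpart c & coloring (val h)}.

Definition contract (x : labelled_part) : {ffun V -> V * D} :=
  [ffun v => (clump (val (tag x)) v, tagged x (cproj (val (tag x)) v))].

Lemma contract_inj : injective contract.
Proof.
move=> [p k] [p' k'] /ffunP e; have pp : p = p'.
  by apply: cpart_eq => v; have := e v; rewrite !ffunE => -[].
subst p'; congr (existT _ _ _); apply/ffunP => r.
have := e (val r); rewrite !ffunE /= => -[].
by rewrite cproj_id.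
Qed.

Lemma contractE x v : (contract x v).1 = clump (val (tag x)) v.
Proof. by rewrite ffunE. Qed.

Lemma contract_heads x : heads setT (contract x) = roots (forget (val (tag x))).
Proof. by apply/setP => v; rewrite in_set in_setT contractE part_root. Qed.

Lemma contract_contraction x : contraction setT g (contract x).
Proof.
case: x => p k; have /clumpingP[h1 h2 h3 h4] := cforest_clumping (val p).
have cc v : clump (val p) (clump (val p) v) = clump (val p) v by apply/h2/h1.
apply/contractionP; split.
- by move=> v _; rewrite in_setT.
- move=> v _; rewrite !ffunE /= cc; congr (_, k _); apply: val_inj; exact: cc.
- move=> v _; rewrite contractE => /eqP; rewrite part_root => vr.
  have tie w : tied (forget (val p)) v w -> clump (val p) w = clump (val p) v.
    by move=> /andP[_ tS]; apply: (h4 _ _ _ tS); rewrite ?set21 ?set22.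
  apply/attachedP; split.
  + move=> w _ e; rewrite !contractE; symmetry; apply: h3.
    by rewrite -[_ \in _]/(arrow (forget (val p)) v w) part_arrow e.
  + move=> w _ e; rewrite !contractE.
    have t : tied (forget (val p)) v w by rewrite part_tied e.
    split; last exact: tie.
    apply/eqP; rewrite part_root; apply/negP => wr.
    by rewrite tied_sym part_tied wr andbF in t.
  + have [w e] := part_nonroot vr; exists w; rewrite ?in_setT //.
    by case/orP: e => [/part_arrow_sub ->|/part_tied_sub ->]; rewrite ?orbT.
- by move=> v; rewrite in_setT.
Qed.

Lemma contract_compatible x : compatible setT (mg_c c).2 (contract x).
Proof. by apply/forall_inP => v _; rewrite contractE !ffunE part_clump. Qed.

(** The kept arrows are those that do not start at a head, and the kept stolons those
    that contain no head. *)
Lemma contract_onto s : contraction setT g s -> compatible setT (mg_c c).2 s ->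
  exists x, contract x = s.
Proof.
move=> /contractionP[c1 c2 c3 _] /forall_inP cm.
have {}c2 v : s (s v).1 = s v by apply: c2; rewrite in_setT.
pose k : graph D V := ([set e in edges g | (s e.1).1 != e.1],
  [set t in stolons g | [forall v in t, (s v).1 != v]], deco g).
have arrowk v w : arrow k v w = arrow g v w && ((s v).1 != v) by rewrite /arrow inE.
have ka : aromatic k by apply: sub_aromatic ga; apply/subsetP => x; rewrite inE => /andP[].
have att v w : (s v).1 != v -> arrow g v w -> (s w).1 = (s v).1.
  move=> /eqP vv e; have /attachedP[h _ _] := c3 v (in_setT v) vv.
  by apply: h; rewrite ?in_setT.
have att' v w : (s v).1 != v -> tied g v w -> (s w).1 != w /\ (s w).1 = (s v).1.
  move=> /eqP vv e; have /attachedP[_ h _] := c3 v (in_setT v) vv.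
  by have [|/eqP] := h w _ e; rewrite ?in_setT.
have stk t : t \in stolons k -> t \in stolons g /\ forall v, v \in t -> (s v).1 != v.
  by rewrite inE => /andP[tS /forall_inP].
have kC : clumping k [ffun v => (s v).1].
  apply/clumpingP; split.
  - move=> v; rewrite ffunE; apply/rootsP; split.
      by move=> w; rewrite inE c2 eqxx andbF.
    move=> t /stk[_ h]; apply/negP => /h; by rewrite c2 eqxx.
  - move=> r rr; rewrite ffunE; apply/eqP/negPn/negP => sr.
    have /eqP sr' := sr; have /attachedP[_ _ [w _ /orP[e|e]]] := c3 r (in_setT r) sr'.
      by move: rr; rewrite root_rel // => /forallP/(_ w); rewrite arrowk e sr.
    have /rootsP[_ /(_ [set r; w])] := rr; rewrite set21; case/(_ _)/negP => //.
    move: (e) => /andP[_ tS]; rewrite inE [_ \in stolons g]tS /=; apply/forall_inP => v.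
    by rewrite in_set2 => /orP[/eqP->//|/eqP->]; have [] := att' r w sr e.
  - by move=> v w; rewrite inE => /andP[e sv]; rewrite !ffunE (att v w).
  - move=> t v w /stk[tS h] vt wt; rewrite !ffunE.
    have [x [y [tE xy]]] := stolonP ga tS.
    have sx : (s x).1 != x by apply: h; rewrite tE set21.
    have [_ e] := att' x y sx xy.
    by move: vt wt; rewrite tE !in_set2 => /orP[] /eqP-> /orP[] /eqP->; rewrite ?e.
pose h : cforest D V := mk_cforest ka kC.
have hP : subforest c h.
  apply/and4P; split.
  - by apply/subsetP => x; rewrite inE => /andP[].
  - by apply/subsetP => x; rewrite inE => /andP[].
  - by [].
  apply/forallP => v; rewrite ffunE; have := cm v (in_setT v); rewrite !ffunE => /eqP[->].
  exact: eqxx.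
pose p : cpart c := exist _ h hP.
exists (existT _ p [ffun r : {r | r \in roots (forget h)} => (s (val r)).2] : labelled_part).
apply/ffunP => v; rewrite !ffunE /= ffunE c2; by case: (s v).
Qed.
End Partitions.

(** * The coproduct formula *)

Section Star.
Variables (R : realType) (D : finType).
Variables (a : isoclasses (CF D) -> R) (b0 : D -> isoclasses (KF D 1) -> R).
Let phi (d : D) : fsum R (KF D 1) := delta_sigma (b0 d).

Section OneForest.
Variables (V : finType) (c : cforest D V).
Let g := forget c.
Let ga : aromatic g := cforest_aromatic c.
Variable x : labelled_part c.
Let h := val (tag x).
Let k : coloring h := tagged x.
Let s := contract x.
Let sh v : (s v).1 = clump h v. Proof. exact: contractE. Qed.
Let sk v : (s v).2 = k (cproj h v). Proof. by rewrite ffunE. Qed.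

Lemma ev_quotient :
  ev (delta_sigma a) (heads setT s) (quot setT (mg_c c) s) = a (cclass (cquot k)).
Proof.
have sc : contraction setT g s := contract_contraction x.
have hE : heads setT s = roots (forget h) := contract_heads x.
pose psi : {ffun {r | r \in roots (forget h)} -> V} := [ffun r => val r].
have psiI : injective psi by move=> u v; rewrite !ffunE => /val_inj.
have rh (r : {r | r \in roots (forget h)}) : val r \in heads setT s by rewrite hE (valP r).
apply: (ev_delta_c a (psi := psi)); apply/occsP; split=> //.
  apply/setP => v; rewrite hE; apply/imsetP/idP => [[r _ ->]|vr]; first by rewrite ffunE (valP r).
  by exists (exist _ v vr); rewrite ?ffunE.
apply/eqP; rewrite [quot _ _ _]surjective_pairing eq_mg_c //; apply/andP; split; last first.
  apply/forallP => r; apply/eqP; rewrite !ffunE /=.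
  by congr Some; exact: contractE.
apply/eqP/graph_ext.
- apply: aromatic_on_pull psiI _ (quot_aromatic (M := mg_c c) (aromatic_onT ga) sc).
  by move=> r; rewrite ffunE.
- exact: cforest_aromatic.
- move=> r r'; rewrite arrow_pull arrow_quot !ffunE.
  apply/exists_inP/gquot_edgeP => [[w _ /andP[/eqP e rw]]|[w]].
    exists w; last by apply: val_inj; rewrite /= -e sh.
    rewrite in_setD andbC; apply/andP; split; first exact: rw.
    by rewrite -[_ \in _]/(arrow (forget h) (val r) w) part_arrow (valP r) andbF.
  rewrite in_setD => /andP[_ e] ->; exists w; rewrite ?in_setT // sh eqxx; exact: e.
- move=> r r'; rewrite tied_pull // tied_quot !ffunE !rh /= /tied.
  rewrite -[val r != _]/(val r != val r') (inj_eq val_inj); congr (_ && _).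
  apply/idP/gquot_stolonP; rewrite imsetU1 imset_set1 in_setD.
    move=> e; rewrite e andbT part_stolon e /=; apply/negP => /pred0P/(_ (val r)).
    by rewrite /= set21 (valP r).
  by move=> /andP[].
- by move=> r; rewrite !ffunE /= cproj_id.
Qed.

(** The blocks of colour d are the clumps of the subforest of colour d. *)
Lemma weight_product :
  weight phi setT g s = tensor_form (fun d => clump_character (b0 d)) [ffun d => cclass (ccolor k d)].
Proof.
have hE : heads setT s = roots (forget h) := contract_heads x.
have ha : aromatic (forget h) := cforest_aromatic h.
have /clumpingP[h1 h2 h3 h4] := cforest_clumping h.
have kE u v : clump h u = clump h v -> k (cproj h u) = k (cproj h v).
  by move=> e; congr (k _); apply: val_inj.
rewrite /weight hE (partition_big (fun u => (s u).2) predT) //=.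
apply: eq_bigr => d _; rewrite ffunE.
pose A : {set V} := [set v | colored k d v].
have AE v : (v \in A) = (k (cproj h v) == d) by rewrite in_set.
pose psi : {ffun {v | colored k d v} -> V} := [ffun r => val r].
have psiI : injective psi by move=> u v; rewrite !ffunE => /val_inj.
have occ : psi \in occs (mg_c (ccolor k d)) A (mg_c h).
  apply/occsP; split=> //.
    apply/setP => v; apply/imsetP/idP => [[r _ ->]|vr]; first by rewrite ffunE in_set (valP r).
    by rewrite in_set in vr; exists (exist _ v vr); rewrite ?ffunE.
  apply/eqP; rewrite eq_mg_c //; apply/andP; split.
    by apply/eqP; apply: eq_gpull => v; rewrite ffunE.
  apply/forallP => v; apply/eqP.
  have cE : val (clump (ccolor k d) v) = clump h (val v).
    rewrite [clump _ _]ffunE val_insubd; have -> : colored k d (clump h (val v)); last by [].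
    have e : k (cproj h (clump h (val v))) = k (cproj h (val v)) by apply: kE; apply: h2.
    by rewrite /colored e; exact: (valP v).
  rewrite [LHS]ffunE [psi v]ffunE [psi _]ffunE; congr Some; exact: esym cE.
have gaA : aromatic_on A (forget h) := aromatic_on_sub (subsetT A) (aromatic_onT ha).
rewrite (clump_character_occ (b0 d) occ gaA).
have rE : roots_on A (forget h) = A :&: roots (forget h).
  rewrite -(roots_onT ha); apply: (roots_on_closed (aromatic_onT ha) (subsetT A)).
  move=> v w; rewrite !AE => /eqP <- _ /orP[e|/andP[vw e]]; apply/eqP/kE; symmetry.
    exact: h3.
  by apply: (h4 _ _ _ e); rewrite ?set21 ?set22.
apply: eq_big => [u|u /andP[ur /eqP ud]].
  by rewrite rE in_setI AE andbC sk.
rewrite /phi ud; have -> : [set v in A | (mg_c h).2 v == Some u] = [set v in setT | (s v).1 == u].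
  apply/setP => v; rewrite [LHS]in_set [RHS]in_set in_setT AE ffunE sh /= -[Some _ == _]/(clump h v == u).
  have [vu|_] := eqVneq (clump h v) u; last by rewrite andbF.
  have e : k (cproj h v) = k (cproj h u) by apply: kE; rewrite -vu; exact: esym (h2 _ (h1 v)).
  by rewrite andbT -ud sk e eqxx.
set B := [set v in setT | _].
have BE v : (v \in B) = (clump h v == u) by rewrite !in_set sh.
have Bu v : v \in B -> (v \in roots (forget h)) = (v == u).
  by rewrite BE => /eqP <-; rewrite -part_root eq_sym.
apply/esym/ev_agree; split.
- move=> v w vB wB; rewrite [LHS]part_arrow (Bu v vB) [RHS]arrow_cut andbC; by [].
- move=> t /subsetP tB; rewrite [LHS]part_stolon [RHS]in_set; congr (_ && _).
  apply/idP/idP => [/pred0P/(_ u)|ut]; first by rewrite /= ur andbT => ->.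
  apply/pred0P => v /=; apply/negP => /andP[vt]; rewrite (Bu v (tB v vt)) => /eqP vu.
  by rewrite -vu vt in ut.
- by move=> v _; rewrite [deco _]part_deco.
- by [].
Qed.
End OneForest.

(** Coloured partitions are contractions, the contracted forest is the quotient, and
    characters multiply over blocks as weights do. *)
Lemma star_subst (p : isoclasses (CF D)) :
  star (tensor_form (fun d => clump_character (b0 d))) a p
  = subst phi (delta_sigma a) setT (pemb p).
Proof.
have -> : pemb p = mg_c (rep p : cforest D _) by [].
rewrite /subst (sum_reindex _ (@contract_inj D _ (rep p : cforest D _))); first last.
- by move=> s /andP[]; apply: contract_onto.
- by move=> x; rewrite contract_contraction contract_compatible.
rewrite /star /coproduct big_map big_enum /=; apply: eq_bigr => x _.
by rewrite -weight_product ev_quotient.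
Qed.

Lemma substitute_delta :
  substitute phi (delta_sigma a)
  = delta_sigma (star (tensor_form (fun d => clump_character (b0 d))) a).
Proof. by apply/funext => p; rewrite /delta_sigma star_subst. Qed.
End Star.

Lemma A_phi_substitute (R : realType) (D : finType) (phi : D -> fsum R (KF D 1)) :
  A_phi phi = @substitute R D phi (mCF D).
Proof.
have ex := substitution_exists phi.
rewrite /A_phi; case: xgetP => [[[A0 A1] A] _ /= H|no]; first exact: substitution_unique H ex.
by case: (no (@substitute R D phi (mKF D 0), @substitute R D phi (mKF D 1),
  @substitute R D phi (mCF D))); exact: ex.
Qed.

Theorem theorem4p19 (R : realType) (D : finType) (n : nat)
    (f : D -> 'rV[R]_n -> 'rV[R]_n) (f_smooth : forall d, smooth_field (f d))
    (a : isoclasses (CF D) -> R) (b0 : D -> isoclasses (KF D 1) -> R) :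
  forall (N : nat) (psi : 'rV[R]_n -> R) (x : 'rV[R]_n), smooth psi ->
    S_subst f (fun d => delta_sigma (b0 d)) a N psi x =
    S_series f (star (tensor_form (fun d => clump_character (b0 d))) a) N psi x.
Proof.
move=> N psi x _; rewrite /S_subst /S_series A_phi_substitute; congr (F_D _ _ _ _ _).
exact: substitute_delta.
Qed.
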